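(* Let $T$ be a $k$-regular tree and let $\phi$ be a Sturmian coloring of $T$. Then there exists a group $\Gamma$ of automorphisms of $T$ such that $\phi$ is $\Gamma$-invariant, so that $\phi=\phi_X\circ\pi$ for a coloring $\phi_X$ of the vertices of the quotient graph $X=\Gamma\backslash T$, where $\pi:T\to X$ is the quotient map, and such that the following hold. (1) $X$ is one of the following two types of graphs: (a) a geodesic ray with loops possibly attached: the vertices are $v_0,v_1,v_2,\dots$ (pairwise distinct), there is exactly one edge joining $v_i$ and $v_{i+1}$ for each $i\ge 0$, at each vertex there is either no loop or one loop, and there are no other edges; (b) an infinite (two-sided) geodesic with loops possibly attached: the vertices are $v_i$, $i\in\mathbb{Z}$ (pairwise distinct), there is exactly one edge joining $v_i$ and $v_{i+1}$ for each $i\in\mathbb{Z}$, at each vertex there is either no loop or one loop, and there are no other edges. (2) If $\phi$ is of bounded type, then $X$ is of type (a). (3) $\phi$ is eventually periodic if and only if $X$, together with its edge indices, is one of the following two graphs, where $t=k-1$: (i) the ray $v_0,v_1,v_2,\dots$ with exactly one loop, attached at $v_0$, such that for every $i\ge 0$ the index of the oriented edge from $v_i$ to $v_{i+1}$ is $t$ and the index of the oriented edge from $v_{i+1}$ to $v_i$ is $1$; (ii) the ray $v_0,v_1,v_2,\dots$ without loops, such that the index of the oriented edge from $v_0$ to $v_1$ is $t+1$, for every $i\ge 1$ the index of the oriented edge from $v_i$ to $v_{i+1}$ is $t$, and for every $i\ge 0$ the index of the oriented edge from $v_{i+1}$ to $v_i$ is $1$.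
   Context: $T$ is a $k$-regular tree ($k\ge 2$; every vertex has exactly $k$ neighbors) with vertex set $VT$ and path metric $d$ with edges of length $1$. A coloring of $T$ is a map $\phi:VT\to\mathcal{A}$, where $\mathcal{A}$ is a countable set (the alphabet). $B_n(x)$ is the ball of radius $n$ around the vertex $x$ (viewed as a subgraph of $T$). Two balls $B_n(x)$, $B_n(y)$ are equivalent if there is a color-preserving graph isomorphism $B_n(x)\to B_n(y)$; the equivalence class is denoted $[B_n(x)]$ and called a colored $n$-ball. The subword complexity $b_\phi(n)$ is the number of distinct colored $n$-balls occurring in $T$. The coloring $\phi$ is Sturmian if $b_\phi(n)=n+2$ for all $n\ge 0$. A colored $n$-ball $[B]$ is special if there are vertices $x,y$ with $[B_n(x)]=[B_n(y)]=[B]$ and $[B_{n+1}(x)]\ne[B_{n+1}(y)]$. The type set of a vertex $x$ is $\Lambda_x=\{n\ge 0: [B_n(x)]\text{ is special}\}$. A vertex is of bounded type if its type set is finite; $\phi$ is of bounded type if some vertex is of bounded type. A coloring $\phi$ is $\Gamma$-invariant if $\phi(\gamma x)=\phi(x)$ for all $x\in VT$, $\gamma\in\Gamma$. It is periodic if it is $\Gamma$-invariant for some (not necessarily discrete) group $\Gamma$ of automorphisms of $T$ with $\Gamma\backslash T$ finite. It is eventually periodic if there is a subtree $K$ of $T$ with finitely many vertices such that $T-K=\bigcup T_i$ is a finite union of subtrees $T_i$ such that for each $i$ there is a periodic coloring $\phi_i$ of $T$ with $\phi_i|_{T_i}=\phi|_{T_i}$. The group $\Gamma$ is allowed to act with inversions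 (elements exchanging the endpoints of an edge). The quotient graph $\Gamma\backslash T$ has as vertices the $\Gamma$-orbits of vertices and as edges the $\Gamma$-orbits of (unoriented) edges of $T$; an edge of the quotient both of whose endpoints coincide is called a loop (this includes images of edges inverted by an element of $\Gamma$). The index of an oriented edge of the quotient from $p$ to $q$ is the number of edges of $T$ starting at a fixed lift of $p$, ending at a lift of $q$, and projecting to the given edge. *)

(* Defs.v *)
From mathcomp Require Export all_boot all_order all_algebra.
From mathcomp Require Export boolp classical_sets functions cardinality.

Set Implicit Arguments.
Unset Strict Implicit.
Unset Printing Implicit Defensive.

Local Open Scope classical_set_scope.
Local Open Scope card_scope.

Section Trees.
Variables (V : choiceType) (e : rel V).

(* In a tree, a subtree is determined by its vertex set: it is the subgraph
   induced on a nonempty set S any two points of which are joined by a walk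
   inside S. *)
Definition subtree (S : set V) : Prop :=
  S !=set0 /\
  forall x y, S x -> S y ->
    exists p : seq V,
      [/\ path e x p, last x p = y & forall z, z \in p -> S z].

(* The bound on the length discards the closed walks x, y, x along an edge. *)
Definition acyclic : Prop := forall c : seq V, ucycle e c -> size c <= 2.

Definition is_tree : Prop :=
  [/\ symmetric e, irreflexive e, subtree [set: V] & acyclic].

Definition regular (k : nat) : Prop := forall x, [set y | e x y] #= `I_k.

(* d(x, y) <= n : some walk from x to y has at most n edges. *)
Definition gball (n : nat) (x : V) : set V :=
  [set y | exists p : seq V, [/\ path e x p, last x p = y & size p <= n]].

(* Groups of automorphisms, not necessarily discrete; inversions are
   allowed. *)
Definition automorphism (g : V -> V) : Prop :=
  bijective g /\ forall x y, e (g x) (g y) = e x y.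

Definition automorphism_group (G : set (V -> V)) : Prop :=
  [/\ forall g, G g -> automorphism g,
      G id,
      forall g h, G g -> G h -> G (g \o h)
    & forall g, G g -> exists h, [/\ G h, cancel g h & cancel h g]].

(* The quotient graph G\T: a vertex is an orbit of vertices; an unoriented
   edge of T is the pair [set x; y] of its endpoints, and an edge of G\T is an
   orbit of such pairs. *)
Definition vertex_orbit (G : set (V -> V)) (x : V) : set V :=
  [set g x | g in G].

Definition quotient_vertices (G : set (V -> V)) : set (set V) :=
  range (vertex_orbit G).

Definition edge_orbit (G : set (V -> V)) (a : set V) : set (set V) :=
  [set g @` a | g in G].

(* The edges of G\T with endpoints P and Q; for P = Q these are the loops
   at P. *)
Definition quotient_edges (G : set (V -> V)) (P Q : set V) :
    set (set (set V)) :=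
  [set E | exists x y, [/\ P x, Q y, e x y & E = edge_orbit G [set x; y]]].

(* The oriented edge E from P to Q has index n; the number does not depend on
   the lift x of P, and P is nonempty when it is a vertex of G\T. *)
Definition has_index (G : set (V -> V)) (E : set (set V)) (P Q : set V)
    (n : nat) : Prop :=
  forall x, P x ->
    [set y | [/\ e x y, Q y & edge_orbit G [set x; y] = E]] #= `I_n.

Definition index_to (G : set (V -> V)) (P Q : set V) (n : nat) : Prop :=
  forall E, quotient_edges G P Q E -> has_index G E P Q n.

Definition unique_edge (G : set (V -> V)) (P Q : set V) : Prop :=
  exists E, quotient_edges G P Q = [set E].

Definition no_edge (G : set (V -> V)) (P Q : set V) : Prop :=
  quotient_edges G P Q = set0.

Definition ray_with_loops (G : set (V -> V)) (v : nat -> set V) : Prop :=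
  [/\ injective v,
      range v = quotient_vertices G,
      forall i, unique_edge G (v i) (v i.+1),
      forall i, no_edge G (v i) (v i) \/ unique_edge G (v i) (v i)
    & forall i j, i <> j -> j <> i.+1 -> i <> j.+1 -> no_edge G (v i) (v j)].

Definition line_with_loops (G : set (V -> V)) (v : int -> set V) : Prop :=
  [/\ injective v,
      range v = quotient_vertices G,
      forall i, unique_edge G (v i) (v (i + 1)%R),
      forall i, no_edge G (v i) (v i) \/ unique_edge G (v i) (v i)
    & forall i j : int, i <> j -> j <> (i + 1)%R -> i <> (j + 1)%R ->
        no_edge G (v i) (v j)].

Definition is_ray (G : set (V -> V)) : Prop := exists v, ray_with_loops G v.

Definition is_line (G : set (V -> V)) : Prop := exists v, line_with_loops G v.

Definition looped_cusp (t : nat) (G : set (V -> V)) : Prop :=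
  exists v : nat -> set V,
    [/\ ray_with_loops G v,
        unique_edge G (v 0) (v 0),
        forall i, 0 < i -> no_edge G (v i) (v i),
        forall i, index_to G (v i) (v i.+1) t
      & forall i, index_to G (v i.+1) (v i) 1].

Definition loopless_cusp (t : nat) (G : set (V -> V)) : Prop :=
  exists v : nat -> set V,
    [/\ ray_with_loops G v,
        forall i, no_edge G (v i) (v i),
        index_to G (v 0) (v 1) t.+1,
        forall i, 0 < i -> index_to G (v i) (v i.+1) t
      & forall i, index_to G (v i.+1) (v i) 1].

Section Colorings.
Variables (A : countType) (phi : V -> A).

(* The isomorphism is not required to map centre to centre. *)
Definition ball_equiv (n : nat) (x y : V) : Prop :=
  exists f : V -> V,
    [/\ set_bij (gball n x) (gball n y) f,
        forall u w, gball n x u -> gball n x w -> e (f u) (f w) = e u w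
      & forall u, gball n x u -> phi (f u) = phi u].

(* The class of the n-ball at x, encoded by the set of the centres of the
   n-balls of T in this class. *)
Definition colored_ball (n : nat) (x : V) : set V :=
  [set y | ball_equiv n x y].

Definition sturmian : Prop :=
  forall n, range (colored_ball n) #= `I_(n + 2).

Definition special (n : nat) (B : set V) : Prop :=
  exists x y, [/\ colored_ball n x = B, colored_ball n y = B
                & colored_ball n.+1 x <> colored_ball n.+1 y].

Definition type_set (x : V) : set nat :=
  [set n | special n (colored_ball n x)].

Definition bounded_type : Prop := exists x, finite_set (type_set x).

Definition invariant_under (G : set (V -> V)) : Prop :=
  forall g x, G g -> phi (g x) = phi x.

(* T being locally finite, G\T is finite as soon as it has finitely many
   vertices. *)
Definition periodic : Prop :=
  exists G, [/\ automorphism_group G, invariant_under G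
              & finite_set (quotient_vertices G)].

End Colorings.

(* T - K is the union of the T_ i as a graph: both vertices and edges are
   covered. *)
Definition eventually_periodic (A : countType) (phi : V -> A) : Prop :=
  exists (K : set V) (m : nat) (T_ : 'I_m -> set V),
    [/\ subtree K /\ finite_set K,
        forall i, subtree (T_ i),
        ~` K = \bigcup_i T_ i,
        forall x y, ~ K x -> ~ K y -> e x y -> exists i, T_ i x /\ T_ i y
      & forall i, exists psi : V -> A,
          periodic psi /\ forall x, T_ i x -> psi x = phi x].

End Trees.

(* Main.v *)
(* Colour refinement computes the equivalence R n of n-balls, since an
   isomorphism of balls preserves their interiors and hence their centres, and
   its limit Ri is the orbit relation of Aut(phi).  For a Sturmian coloring
   exactly one R n class splits at each step, and it splits in two.

   If phi is of unbounded type, this forbids a vertex with three neighbours in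
   distinct orbits other than its own, so the infinite connected quotient is a
   ray or a line.  If phi is of bounded type, take the least m for which some
   R m class C meets finitely many orbits: the orbits are then exactly the
   level sets of the distance to C, and the quotient is a ray.

   If phi is eventually periodic, a cone of T carries a periodic coloring, so
   only boundedly many balls occur deep in it; the levels then grow by one per
   step of depth, which makes the far end of the ray a cusp, and moving a piece
   of C far into the cone by a period shows that the cusp starts at C.
   Conversely, on a cusp the colors are eventually periodic along the levels
   because few balls are available, and deep in T the level is a Busemann
   function of T, along which a periodic sequence pulls back to a periodic
   coloring. *)

Require Import Defs.
From mathcomp Require Import zify.
Set Implicit Arguments.
Unset Strict Implicit.
Unset Printing Implicit Defensive.
Local Open Scope classical_set_scope.

(** * Trees *)

(** Two counts do most of the work. Step n has n + 2 classes, so n + 3 pairwise inequivalent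
    vertices cannot exist, and a list meeting every class has at least n + 2 entries; most
    contradictions below are one of these two bounds. On a level of a cusp the neighbours divide
    into 1 below and k - 1 above. For k > 2 the unequal multiplicities allow a class to tell its
    lower neighbour from its upper ones; for k = 2 they do not, and that case is argued apart: in
    bounded type the cusp shape is then automatic, in unbounded type the group itself is changed.
    Leastness of m makes C the only class of its step with finitely many orbits, so that each later
    split has to cut one whole level off an infinite remainder. The subtrees in the definition of
    eventual periodicity are arbitrary, and the period groups need not be discrete. Cones inside the
    subtrees supply balls of every radius, and a period group enters only through a finite list of
    orbit representatives. *)

Lemma perm_match (T : eqType) (r : rel T) (s t : seq T) :
  equivalence_rel r -> (forall z, count (r z) s = count (r z) t) ->
  exists2 t', perm_eq t' t & all2 r s t'.
Proof.
move=> /equivalence_relP [rr rT].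
elim: s t => [|v s IH] t h.
  case: t h => [|w t] h; first by exists [::].
  by have := h w; rewrite /= rr.
have : has (r v) t by rewrite has_count -h /= rr.
case/hasP=> w wt rvw.
have ptw := perm_to_rem wt.
have [z|t' pt' at'] := IH (rem w t).
  have := h z; rewrite (permP ptw (r z)) /=.
  have -> : r z v = r z w.
    apply/idP/idP => hz.
      by rewrite (rT _ _ hz).
    have := rT _ _ hz => ->; by rewrite -(rT _ _ rvw).
  exact: addnI.
exists (w :: t'); last by rewrite /= rvw.
by rewrite perm_sym (permPl ptw) perm_cons perm_sym.
Qed.

(** Removing [u] from [s] and [w] from [t] keeps the class counts equal, so the rest can still be
    matched. Prescribing one pair lets a map built outwards respect the image of the parent, and
    lets a chosen edge be carried to a chosen edge. *)
Lemma match_fun (T : eqType) (r : rel T) (s t : seq T) (u w : T) :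
  equivalence_rel r -> (forall z, count (r z) s = count (r z) t) ->
  uniq s -> uniq t -> u \in s -> w \in t -> r u w ->
  exists b : T -> T,
    [/\ b u = w, {in s, forall v, b v \in t /\ r v (b v)},
        {in s &, injective b} & forall v, v \in t -> exists2 z, z \in s & b z = v].
Proof.
move=> er h us ut us_ wt ruw.
have /equivalence_relP [rr rT] := er.
have ps := perm_to_rem us_; have pt := perm_to_rem wt.
have [z|t' pt' at'] := @perm_match T r (rem u s) (rem w t) er.
  have := h z; rewrite (permP pt (r z)) (permP ps (r z)) /=.
  have -> : r z u = r z w.
    apply/idP/idP => hz; first by rewrite (rT _ _ hz).
    have := rT _ _ hz => ->; by rewrite -(rT _ _ ruw).
  exact: addnI.
pose s1 := u :: rem u s; pose t1 := w :: t'.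
have p1 : perm_eq t1 t by rewrite perm_sym (permPl pt) perm_cons perm_sym.
have us1 : uniq s1 by rewrite -(perm_uniq ps).
have ut1 : uniq t1 by rewrite (perm_uniq p1).
have a1 : all2 r s1 t1 by rewrite /= ruw.
have sz : size s1 = size t1 by move: a1; rewrite all2E => /andP[/eqP].
pose b v := nth v t1 (index v s1).
have bE v : v \in s -> b v \in t /\ r v (b v).
  rewrite (perm_mem ps) => vs.
  have iv : index v s1 < size t1 by rewrite -sz index_mem.
  split; first by rewrite -(perm_mem p1) mem_nth.
  move: a1; rewrite all2E => /andP[_ /all_nthP ha].
  have := ha (v, v) (index v s1); rewrite size_zip -sz minnn index_mem => /(_ vs).
  by rewrite nth_zip //= nth_index.
exists b; split => //.
- by rewrite /b /= eqxx.
- move=> x y; rewrite !(perm_mem ps) => xs ys; rewrite /b.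
  rewrite (set_nth_default x y) -?sz ?index_mem // => /eqP.
  rewrite nth_uniq -?sz ?index_mem // => /eqP hi.
  by rewrite -(nth_index x xs) hi nth_index.
- move=> v; rewrite -(perm_mem p1) => vt.
  have iv : index v t1 < size s1 by rewrite sz index_mem.
  exists (nth u s1 (index v t1)); first by rewrite (perm_mem ps) mem_nth.
  by rewrite /b index_uniq // (set_nth_default v) ?sz -?sz // nth_index.
Qed.

Lemma card_seq (T : choiceType) (A : set T) n : (A #= `I_n)%card ->
  exists s : seq T, [/\ uniq s, size s = n & forall y, y \in s <-> A y].
Proof.
move=> /card_set_bijP[f [hf fi fs]].
case: n hf fi fs => [|n] hf fi fs.
  by exists [::]; split=> // y; split=> // /hf.
have [x0 _ _] := fs 0 isT.
have [g gP] : exists g : nat -> T, forall i, i < n.+1 -> A (g i) /\ f (g i) = i.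
  exists (fun i => xget x0 [set y | A y /\ f y = i]) => i ilt.
  case: xgetP => [y _ []//|/=]; have [y Ay fy] := fs i ilt => /(_ y).
  by case.
exists (map g (iota 0 n.+1)); split.
- rewrite map_inj_in_uniq ?iota_uniq // => a b; rewrite !mem_iota /= add0n => ha hb hg.
  by have [_ <-] := gP _ ha; have [_ <-] := gP _ hb; rewrite hg.
- by rewrite size_map size_iota.
- move=> y; split.
    by move/mapP => [i]; rewrite mem_iota add0n /= => hi ->; case: (gP _ hi).
  move=> Ay; apply/mapP; exists (f y); first by rewrite mem_iota /=; apply: hf.
  have [h1 h2] := gP _ (hf _ Ay).
  by apply: fi; rewrite ?inE.
Qed.

Section Tree.
Variables (V : choiceType) (e : rel V) (k : nat).
Hypotheses (k2 : 2 <= k) (eT : is_tree e) (eR : regular e k).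

Lemma tree_sym x y : e x y = e y x.
Proof. by case: eT => h _ _ _; apply: h. Qed.

Lemma tree_irr x : e x x = false.
Proof. by case: eT => _ h _ _; apply: h. Qed.

Lemma tree_conn x y : exists p, path e x p /\ last x p = y.
Proof. by case: eT => _ _ [_ h] _; case: (h x y I I) => p [? ? _]; exists p. Qed.

Lemma nb_ex x : exists s : seq V, [/\ uniq s, size s = k & s =i e x].
Proof. by have [s [us ss h]] := card_seq (eR x); exists s; split=> // y; apply/idP/idP => /h. Qed.

Definition nb x := projT1 (cid (nb_ex x)).
Lemma nb_uniq x : uniq (nb x). Proof. by rewrite /nb; case: cid => s []. Qed.
Lemma size_nb x : size (nb x) = k. Proof. by rewrite /nb; case: cid => s []. Qed.
Lemma mem_nb x y : (y \in nb x) = e x y.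
Proof. by rewrite /nb; case: cid => s [_ _ h] /=; rewrite h. Qed.

Lemma gball_ex x y : exists n, `[< gball e n x y >].
Proof. by have [p [hp hl]] := tree_conn x y; exists (size p); apply/asboolP; exists p. Qed.

Definition dist x y := ex_minn (gball_ex x y).

Lemma gballP n x y : gball e n x y <-> dist x y <= n.
Proof.
rewrite /dist; case: ex_minnP => m /asboolP [p [hp hl hs]] hm; split.
  by move=> h; apply: hm; apply/asboolP.
by move=> h; exists p; split=> //; apply: leq_trans h.
Qed.

Lemma dist_path x p : path e x p -> dist x (last x p) <= size p.
Proof. by move=> hp; apply/gballP; exists p. Qed.

Lemma distP x y : exists p, [/\ path e x p, last x p = y & size p = dist x y].
Proof.
have /gballP [p [hp hl hs]] := leqnn (dist x y); exists p; split=> //.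
by apply/eqP; rewrite eqn_leq hs -[X in dist _ X]hl dist_path.
Qed.

Lemma dist_xx x : dist x x = 0.
Proof. by have := @dist_path x [::] isT; rewrite leqn0 => /eqP. Qed.

Lemma dist_eq0 x y : dist x y = 0 -> x = y.
Proof. by have [[|a p] [_ hl hs]] := distP x y => // h0; rewrite -hs in h0. Qed.

Lemma dist_tri y x z : dist x z <= dist x y + dist y z.
Proof.
have [p [hp hl <-]] := distP x y; have [q [hq hl' <-]] := distP y z.
rewrite -size_cat -hl' -hl -last_cat; apply: dist_path.
by rewrite cat_path hp hl.
Qed.

Lemma dist_edge x y : e x y -> dist x y = 1.
Proof.
move=> h; have := @dist_path x [:: y]; rewrite /= h => /(_ isT).
case E: (dist x y) => [|[|]] // _.
by move: h; rewrite (dist_eq0 E) tree_irr.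
Qed.

Lemma dist_sym x y : dist x y = dist y x.
Proof.
wlog suff H : x y / dist x y <= dist y x.
  by apply/eqP; rewrite eqn_leq !H.
have [p [hp hl <-]] := distP y x; subst x.
have q : path e (last y p) (rev (belast y p)).
  by move: hp; rewrite -rev_path; rewrite (@eq_path _ _ e) // => a b; rewrite tree_sym.
have := dist_path q; rewrite size_rev size_belast.
by case: (p) => //= a r; rewrite rev_cons last_rcons.
Qed.

Lemma dist_nb x y z : e y z -> dist x z <= (dist x y).+1.
Proof. by move=> h; apply: leq_trans (dist_tri y _ _) _; rewrite (dist_edge h) addn1. Qed.

Lemma dist_pred x y n : dist x y = n.+1 -> exists2 z, e y z & dist x z = n.
Proof.
have [p [hp hl hs]] := distP x y => hn; rewrite hn in hs.
case/lastP: p hp hl hs => // p a; rewrite rcons_path last_rcons size_rcons => /andP[hp he] ha [hs].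
subst a; exists (last x p); first by rewrite tree_sym.
apply/eqP; rewrite eqn_leq -{1}hs dist_path //= -ltnS -hn.
exact: dist_nb.
Qed.

Lemma no_short_cycle x p : path e x p -> uniq (x :: p) -> 1 < size p -> e (last x p) x = false.
Proof.
case: eT => _ _ _ ac hp hu hs; apply/negP => he.
have : size (x :: p) <= 2 by apply: ac; rewrite /ucycle /= rcons_path hp he -/(uniq (x :: p)) hu.
by rewrite /= ltnS leqNgt hs.
Qed.

Lemma geod o x : exists p, [/\ path (fun a b => e a b && (dist o b < dist o a)) x p, last x p = o
  & size p = dist o x].
Proof.
move En : (dist o x) => n; elim: n x En => [|n IH] x En.
  by exists [::]; split=> //=; rewrite (dist_eq0 En).
have [z ez dz] := dist_pred En.
have [p [hp hl hs]] := IH z dz.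
by exists (z :: p); split=> //=; rewrite ?hs // ez dz En ltnS leqnn.
Qed.

(** Descend from [y] to the root, then climb to [z]. The walk uses no edge between vertices equally
    far from the root and never gets farther than both ends; closing it up by an edge or by an outer
    vertex gives the forbidden cycles of [dist_parity] and [up_unique]. *)
Lemma geod_walk o y z : exists p,
  path (fun a b => e a b && (dist o b != dist o a)) y p /\ last y p = z
  /\ {subset p <= [pred w | dist o w <= maxn (dist o y) (dist o z)]}
  /\ {subset p <= [pred w | (dist o w < dist o y) || (dist o w <= dist o z)]}.
Proof.
have [p [hp hl _]] := geod o y; have [q [hq hql _]] := geod o z.
have mono a (r : seq V) : path (fun a b => e a b && (dist o b < dist o a)) a r ->
    {in r, forall w, dist o w < dist o a}.
  elim: r a => //= b r IH a /andP[/andP[_ h]] /IH hr w.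
  by rewrite inE => /orP[/eqP ->//|/hr /ltn_trans]; apply.
pose q' := rev (belast z q).
have hq' : path (fun a b => e a b && (dist o b != dist o a)) o q'.
  have := hq; rewrite -rev_path hql; apply: sub_path => a b /= /andP[h1 h2].
  by rewrite tree_sym h1 /= neq_ltn h2 orbT.
have lq' : last o q' = z.
  by rewrite -hql /q'; case: (q) => //= a r; rewrite rev_cons last_rcons.
have mq w : w \in q' -> dist o w <= dist o z.
  rewrite mem_rev => /mem_belast; rewrite inE => /orP[/eqP -> //|/(mono _ _ hq)].
  exact: ltnW.
exists (p ++ q'); split; last split; last split.
- rewrite cat_path hl hq' andbT; apply: sub_path hp => a b /andP[-> h] /=.
  by rewrite neq_ltn h.
- by rewrite last_cat hl.
- move=> w; rewrite mem_cat inE leq_max => /orP[/(mono _ _ hp)|/mq ->]; last by rewrite orbT.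
  by move/ltnW ->.
- by move=> w; rewrite mem_cat inE => /orP[/(mono _ _ hp) -> //|/mq ->]; rewrite orbT.
Qed.

Lemma dist_parity o x y : e x y -> dist o x <> dist o y.
Proof.
move=> exy hd; have [p [hp [hl _]]] := geod_walk o x y.
case: (shortenP hp) hl => q hq uq _ hl.
have hq' : path e x q by apply: sub_path hq => a b /andP[].
case: (leqP (size q) 1) => hs; last first.
  by have := no_short_cycle hq' uq hs; rewrite hl tree_sym exy.
case: q hq hl uq hs {hq'} => [|a [|//]] /=.
  by move=> _ hxy; rewrite hxy tree_irr in exy.
by rewrite andbT => /andP[_ /eqP h] ha _ _; apply: h; rewrite ha.
Qed.

Lemma up_unique o x y z : e x y -> e x z -> dist o y < dist o x -> dist o z < dist o x -> y = z.
Proof.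
move=> exy exz hy hz; apply: contrapT => nyz.
have [p [hp [hl [hm _]]]] := geod_walk o y z.
case: (shortenP hp) hl => q hq uq hsub hl.
have hq' : path e y q by apply: sub_path hq => a b /andP[].
have := @no_short_cycle x (y :: q); rewrite /= exy hq' hl tree_sym exz => H.
suff : true = false by []; apply: H => //.
- move: uq => /= ->; rewrite andbT inE negb_or.
  apply/andP; split; first by apply/eqP => hxy; rewrite hxy tree_irr in exy.
  apply/negP => /hsub /hm; rewrite inE leqNgt gtn_max.
  by rewrite hy hz.
- by case: q hl {hq uq hsub hq'} => //= hyz; case: nyz.
Qed.

(** The default value makes the root its own parent. *)
Definition par o x := xget o [set z | e x z /\ dist o z < dist o x].

Lemma parP o x : x != o -> e x (par o x) /\ dist o x = (dist o (par o x)).+1.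
Proof.
move=> hx; rewrite /par; case: xgetP => [y _ [h1 h2]|/= h].
  split=> //; apply/eqP; rewrite eqn_leq h2 andbT.
  by apply: dist_nb; rewrite tree_sym.
case En : (dist o x) => [|n].
  by have /eqP := dist_eq0 En; rewrite eq_sym (negbTE hx).
by have [z ez dz] := dist_pred En; case: (h z); rewrite ez dz En.
Qed.

Lemma par_root o : par o o = o.
Proof. by rewrite /par; case: xgetP => // y _ []; rewrite dist_xx. Qed.

Lemma nb_cases o x y : e x y ->
  (x != o /\ y = par o x) \/ [/\ y != o, x = par o y, y <> par o x & dist o y = (dist o x).+1].
Proof.
move=> exy; have := @dist_parity o x y exy => /eqP; rewrite neq_ltn => /orP[h|h].
  have yo : y != o by apply/eqP => yo; rewrite yo dist_xx in h.
  have [h1 h2] := parP yo.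
  have hx : x = par o y by apply: (@up_unique o y) => //; [rewrite tree_sym|rewrite h2].
  right; split=> //; last by rewrite hx.
  case: (eqVneq x o) => [->|xo]; first by rewrite par_root; apply/eqP.
  by have [_ h3] := parP xo => hy; rewrite hy in h2 h; rewrite h3 ltnNge leqnSn in h.
have xo : x != o by apply/eqP => yo; rewrite yo dist_xx in h.
have [h1 h2] := parP xo.
by left; split=> //; apply: (@up_unique o x) => //; rewrite h2.
Qed.

Lemma par_nb o x y : y != o -> par o y = x -> e x y /\ dist o y = (dist o x).+1.
Proof. by move=> yo <-; have [h1 h2] := parP yo; rewrite tree_sym. Qed.

End Tree.
Arguments dist {V e} eT _ _.
Arguments nb {V e k} eR _.
Arguments par {V e} eT _ _.
Arguments gballP {V e eT n x y}.
Arguments nb_uniq {V e k eR} x.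
Arguments size_nb {V e k eR} x.
Arguments mem_nb {V e k eR} x y.
Arguments dist_path {V e eT x p} _.
Arguments distP {V e} eT x y.
Arguments dist_xx {V e eT} x.
Arguments dist_eq0 {V e eT x y} _.
Arguments dist_tri {V e eT} y x z.
Arguments dist_edge {V e eT x y} _.
Arguments dist_sym {V e eT} x y.
Arguments dist_nb {V e eT} x {y z} _.
Arguments dist_pred {V e eT x y n} _.
Arguments dist_parity {V e eT} o {x y} _ _.
Arguments up_unique {V e eT o x y z} _ _ _ _.
Arguments parP {V e eT o x} _.
Arguments par_root {V e eT} o.
Arguments nb_cases {V e} eT o {x y} _.
Arguments par_nb {V e eT o x y} _ _.

(** * Extension of automorphisms *)

Section Ext.
Variables (V : choiceType) (e : rel V) (k : nat).
Hypotheses (k2 : 2 <= k) (eT : is_tree e) (eR : regular e k).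
Local Notation dist := (dist eT).
Local Notation nb := (nb eR).
Local Notation par := (par eT).

Lemma nb_ex1 x : exists y, e x y.
Proof.
have := size_nb (eR := eR) x; have := mem_nb (eR := eR) x.
case: (nb x) => [|y s] h hs; first by move: k2; rewrite -hs.
by exists y; rewrite -h mem_head.
Qed.

(* The automorphism is built outwards from x; a vertex at distance i from x only
   has to keep its E i class, so E may coarsen with the distance. *)
Lemma tree_ext (E : nat -> rel V) x y x1 y1 :
  (forall i, equivalence_rel (E i)) ->
  (forall i u w, E i u w -> E i.+1 u w) ->
  (forall i u w, E i u w -> forall z, count (E i.+1 z) (nb u) = count (E i.+1 z) (nb w)) ->
  E 0 x y -> e x x1 -> e y y1 -> E 1 x1 y1 ->
  exists f, [/\ automorphism e f, f x = y, f x1 = y1 & forall z, E (dist x z) z (f z)].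
Proof.
move=> Eeq Emono Ecnt Exy ex1 ey1 E1.
pose good i u w u' w' (b : V -> V) := [/\ b u' = w', {in nb u, forall v, b v \in nb w /\ E i.+1 v (b v)},
        {in nb u &, injective b} & forall v, v \in nb w -> exists2 z, z \in nb u & b z = v].
have H (a : nat * V * V * V * V) : exists b, let: (i, u, w, u', w') := a in
    E i u w -> e u u' -> e w w' -> E i.+1 u' w' -> good i u w u' w' b.
  case: a => [[[[i u] w] u'] w'].
  case: (pselect [/\ E i u w, e u u', e w w' & E i.+1 u' w']) => [[h1 h2 h3 h4]|hn]; last first.
    by exists id => h1 h2 h3 h4; case: hn.
  have [||b hb] := @match_fun V _ (nb u) (nb w) u' w' (Eeq i.+1) (Ecnt _ _ _ h1) (nb_uniq _) (nb_uniq _) _ _ h4.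
  - by rewrite mem_nb.
  - by rewrite mem_nb.
  - by exists b.
pose B i u w u' w' := projT1 (cid (H (i, u, w, u', w'))).
have BP i u w u' w' : E i u w -> e u u' -> e w w' -> E i.+1 u' w' -> good i u w u' w' (B i u w u' w').
  by rewrite /B; case: cid.
clearbody B.
pose up z := if z == x then x1 else par x z.
have upE z : e z (up z).
  by rewrite /up; case: eqVneq => [->//|/(parP (eT := eT)) []].
(* [G n z] holds the image of [z] together with the image of [up z], the neighbour whose image is
   already fixed: the parent, or [x1] when [z] is the root. *)
pose G := fix G n z : V * V := if n is n'.+1 then
   (B n' (par x z) (G n' (par x z)).1 (up (par x z)) (G n' (par x z)).2 z, (G n' (par x z)).1) else (y, y1).
pose f z := (G (dist x z) z).1.
have inv n z : dist x z = n -> [/\ E n z (G n z).1, e (G n z).1 (G n z).2 & E n.+1 (up z) (G n z).2].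
  elim: n z => [|n IH] z hz.
    by rewrite -(dist_eq0 hz) /up eqxx.
  have zx : z != x by apply/eqP => h; rewrite h dist_xx in hz.
  have [epz hp] := parP zx (eT := eT); rewrite hz in hp.
  have [h1 h2 h3] := IH _ (esym (succn_inj hp)).
  have [b1 b2 b3 b4] := BP _ _ _ _ _ h1 (upE _) h2 h3.
  have zn : z \in nb (par x z) by rewrite mem_nb tree_sym.
  have [b5 b6] := b2 _ zn.
  split=> //=.
  - by rewrite tree_sym // -(mem_nb (eR := eR)).
  - by rewrite /up (negbTE zx); apply/Emono/Emono.
have f0 : f x = y by rewrite /f dist_xx.
have fdist z : z != x -> dist x z = (dist x (par x z)).+1 by move=> /(parP (eT := eT)) [].
pose b p := B (dist x p) p (f p) (up p) (G (dist x p) p).2.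
have bgood p : good (dist x p) p (f p) (up p) (G (dist x p) p).2 (b p).
  by have [h1 h2 h3] := inv _ p erefl; apply: BP.
have fb p v : e p v -> f v = b p v.
  move=> epv; case: (nb_cases eT x epv) => [[px ->]|[vx -> _ hd]].
    have [h1 _ _ _] := bgood p.
    have -> : par x p = up p by rewrite /up (negbTE px).
    by rewrite h1 fdist //= /f /up (negbTE px).
  by rewrite {1}/f fdist.
have fE z : E (dist x z) z (f z) by have [] := inv _ z erefl.
have fe p v : e p v -> e (f p) (f v).
  move=> epv; rewrite (fb _ _ epv); have [_ h _ _] := bgood p.
  have [|h1 _] := h v; first by rewrite mem_nb.
  by rewrite mem_nb in h1.
(* No folding: a child sent to the parent of the image of its parent would share its image with its
   grandparent, against injectivity of the local matching. *)
have fd z : dist y (f z) = dist x z /\ (z != x -> par y (f z) = f (par x z)).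
  move En : (dist x z) => n; elim: n z En => [|n IH] z En.
    by rewrite -(dist_eq0 En) f0 dist_xx eqxx.
  have zx : z != x by apply/eqP => h; rewrite h dist_xx in En.
  have [ezp _] := parP zx (eT := eT).
  have hp : dist x (par x z) = n by apply: succn_inj; rewrite -fdist.
  have [d1 d2] := IH _ hp.
  have epz : e (par x z) z by rewrite tree_sym.
  case: (nb_cases eT y (fe _ _ epz)) => [[py hy]|[zy hpp _ hd]]; last by rewrite hd d1 -hpp.
  have px : par x z != x by apply: contraNneq py => ->; rewrite f0.
  have := d2 px; rewrite -hy (fb _ _ epz) => hh.
  have [epp _] := parP px (eT := eT).
  have [_ _ hi _] := bgood (par x z).
  move: hh; rewrite (fb _ _ epp) => /hi; rewrite !mem_nb => /(_ epz epp) hzz.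
  have h1 := fdist _ px; rewrite -hzz En hp in h1; lia.
have finj : injective f.
  move=> z z' hf; have hd : dist x z = dist x z' by rewrite -!(fd _).1 hf.
  move En : (dist x z) hd => n; elim: n z z' hf En => [|n IH] z z' hf En hd.
    by rewrite -(dist_eq0 En) -(dist_eq0 (esym hd)).
  have zx : z != x by apply/eqP => h; rewrite h dist_xx in En.
  have zx' : z' != x by apply/eqP => h; rewrite h dist_xx in hd.
  have hp : par x z = par x z'.
    apply: IH; first by rewrite -!(fd _).2 // hf.
    - by apply: succn_inj; rewrite -fdist.
    - by apply: succn_inj; rewrite -fdist.
  have [e1 _] := parP zx (eT := eT); have [e2 _] := parP zx' (eT := eT).
  rewrite tree_sym // in e1; rewrite -hp tree_sym // in e2.
  have [_ _ hi _] := bgood (par x z).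
  by apply: hi; rewrite ?mem_nb // -!fb.
have fsurj v : exists z, f z = v.
  move En : (dist y v) => n; elim: n v En => [|n IH] v En.
    by exists x; rewrite f0 (dist_eq0 En).
  have vy : v != y by apply/eqP => h; rewrite h dist_xx in En.
  have [e1 h1] := parP vy (eT := eT).
  have [u hu] := IH (par y v) (succn_inj (etrans (esym h1) En)).
  have [_ _ _ hs] := bgood u.
  have [|z zu <-] := hs v; first by rewrite mem_nb hu tree_sym.
  by exists z; apply: fb; rewrite -(mem_nb (eR := eR)).
have fe' p v : e (f p) (f v) -> e p v.
  suff H1 p' v' : f v' != y -> f p' = par y (f v') -> e p' v'.
    move=> h; case: (nb_cases eT y h) => [[h1 h2]|[h1 h2 _ _]]; last exact: H1.
    by rewrite tree_sym //; apply: H1.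
  move=> vy hp; have vx : v' != x by apply: contraNneq vy => ->; rewrite f0.
  have := (fd v').2 vx; rewrite -hp => /finj ->.
  by rewrite tree_sym //; case: (parP vx (eT := eT)).
exists f; split=> //.
- split; last by move=> u v; apply/idP/idP; [apply: fe'|apply: fe].
  pose g v := xget x [set z | f z = v].
  have fg v : f (g v) = v by rewrite /g; case: xgetP => //= h; have [z hz] := fsurj v; case: (h z).
  by exists g => // z; apply: finj; rewrite fg.
- rewrite (fb _ _ ex1); have [h _ _ _] := bgood x.
  have <- : up x = x1 by rewrite /up eqxx.
  by rewrite h dist_xx.
Qed.

Lemma conn_ind (P : V -> Prop) x : P x -> (forall y z, P y -> e y z -> P z) -> forall y, P y.
Proof.
move=> hx hP y; have [p [hp <-]] := tree_conn eT x y.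
by elim: p x hx hp => //= z p IH x hx /andP[xz]; apply/IH/(hP x).
Qed.

(** * Distance to a set of vertices *)

Section Dto.
Variables (P : pred V) (w0 : V) (hw0 : P w0).

Lemma dto_ex x : exists d, `[< exists2 w, P w & dist x w = d >].
Proof. by exists (dist x w0); apply/asboolP; exists w0. Qed.

Definition dto x := ex_minn (dto_ex x).

Lemma dtoP x : exists2 w, P w & dist x w = dto x.
Proof. by rewrite /dto; case: ex_minnP => d /asboolP. Qed.

Lemma dto_le x w : P w -> dto x <= dist x w.
Proof.
by rewrite /dto => hw; case: ex_minnP => d _ hd; apply: hd; apply/asboolP; exists w.
Qed.

Lemma dto0 x : dto x = 0 <-> P x.
Proof.
split=> [h|h]; last by apply/eqP; rewrite -leqn0 -(dist_xx (eT := eT) x); apply: dto_le.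
by have [w hw] := dtoP x; rewrite h => /dist_eq0 ->.
Qed.

Lemma dto_nb x y : e x y -> dto y <= (dto x).+1.
Proof.
move=> exy; have [w hw <-] := dtoP x; apply: leq_trans (dto_le _ hw) _.
by rewrite ![dist _ w]dist_sym dist_nb.
Qed.

Lemma dto_pred x i : dto x = i.+1 -> exists2 y, e x y & dto y = i.
Proof.
move=> h; have [w hw] := dtoP x; rewrite h dist_sym => /dist_pred [y ey dy].
exists y => //; apply/eqP; rewrite eqn_leq -{1}dy dist_sym dto_le //= -ltnS -h.
by apply: dto_nb; rewrite tree_sym.
Qed.

Lemma dto_all x i : i <= dto x -> exists y, dto y = i.
Proof.
move Ed : (dto x) => d; elim: d x Ed => [|d IH] x Ed.
  by rewrite leqn0 => /eqP ->; exists x.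
rewrite leq_eqVlt => /orP[/eqP ->|]; first by exists x.
by have [y _ hy] := dto_pred Ed; rewrite ltnS; apply: IH hy.
Qed.

End Dto.

End Ext.
Arguments dto {V e eT P w0} hw0 _ : simpl never.

(** * Colour refinement *)

Section Refine.
Variables (V : choiceType) (e : rel V) (k : nat) (A : countType) (phi : V -> A).
Hypotheses (k2 : 2 <= k) (eT : is_tree e) (eR : regular e k).
Local Notation dist := (dist eT).
Local Notation nb := (nb eR).
Local Notation par := (par eT).

Lemma auto_dist_le g x y : (forall u v, e u v -> e (g u) (g v)) -> dist (g x) (g y) <= dist x y.
Proof.
move=> ge; move En : (dist x y) => n; elim: n y En => [|n IH] y En.
  by rewrite (dist_eq0 En) dist_xx.
have [z ez dz] := dist_pred En.
by apply: leq_trans (dist_nb _ (_ : e (g z) _)) _; [apply: ge; rewrite tree_sym|rewrite ltnS IH].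
Qed.

Lemma auto_dist g x y : automorphism e g -> dist (g x) (g y) = dist x y.
Proof.
move=> [[h gh hg] ge]; apply/eqP; rewrite eqn_leq auto_dist_le => [|u v]; last by rewrite ge.
rewrite -{1}(gh x) -{1}(gh y) auto_dist_le // => u v.
by rewrite -(ge (h u) (h v)) !hg.
Qed.

Fixpoint R n : rel V := if n is n'.+1 then
    fun x y => R n' x y && `[< forall z, count (R n' z) (nb x) = count (R n' z) (nb y) >]
  else fun x y => phi x == phi y.

Lemma R_eqr n : equivalence_rel (R n).
Proof.
elim: n => [|n /equivalence_relP [r t]] /=.
  by move=> x y z; split=> // /eqP ->.
apply/equivalence_relP; split=> [x|x y /andP[/t h1 /asboolP h2] z].
  by rewrite r; apply/asboolP.
rewrite /= h1; congr (_ && _); apply/asboolP/asboolP => h w; first by rewrite -h2.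
by rewrite h2.
Qed.

Lemma R_refl n x : R n x x.
Proof. by have /equivalence_relP [r _] := R_eqr n. Qed.
Lemma R_sym n x y : R n x y = R n y x.
Proof.
have /equivalence_relP [r t] := R_eqr n.
by apply/idP/idP => h; [rewrite -(t _ _ h)|rewrite -(t _ _ h)]; rewrite r.
Qed.
Lemma R_trans n y x z : R n x y -> R n y z -> R n x z.
Proof.
have /equivalence_relP [r t] := R_eqr n.
by move=> h; rewrite (t _ _ h).
Qed.
Lemma R_S n x y : R n.+1 x y -> R n x y.
Proof. by case/andP. Qed.
Lemma R_le m n x y : m <= n -> R n x y -> R m x y.
Proof.
by move=> h; rewrite -(subnK h); elim: (n - m) => // i IH; rewrite addSn => /R_S.
Qed.
Lemma R_cnt n x y z : R n.+1 x y -> count (R n z) (nb x) = count (R n z) (nb y).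
Proof. by case/andP => _ /asboolP. Qed.
Lemma R_succ n x y : R n x y -> (forall z, count (R n z) (nb x) = count (R n z) (nb y)) -> R n.+1 x y.
Proof. by move=> h1 h2 /=; rewrite h1; apply/asboolP. Qed.

Lemma cnt_nb (r : rel V) x y z : r z z -> count (r z) (nb x) = count (r z) (nb y) -> e x z ->
  exists2 w, e y w & r z w.
Proof.
move=> rz h ez.
have : has (r z) (nb x) by apply/hasP; exists z; rewrite ?mem_nb.
rewrite has_count h -has_count => /hasP [w wy rw].
by exists w => //; rewrite -(mem_nb (eR := eR)).
Qed.

Lemma R_nb n x y z : R n.+1 x y -> e x z -> exists2 w, e y w & R n z w.
Proof. by move=> h; apply: cnt_nb; [apply: R_refl|apply: R_cnt]. Qed.

(** * Isomorphisms of balls *)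

Definition ball_iso n x y f :=
  [/\ set_bij (gball e n x) (gball e n y) f,
      forall u w, gball e n x u -> gball e n x w -> e (f u) (f w) = e u w
    & forall u, gball e n x u -> phi (f u) = phi u].

Lemma two_nb u : exists u1 u2, [/\ e u u1, e u u2 & u1 <> u2].
Proof.
have := nb_uniq (eR := eR) u; have := size_nb (eR := eR) u; have := mem_nb (eR := eR) u.
case: (nb u) => [|a [|b s]] h hs; try by move: k2; rewrite -hs.
rewrite /= inE negb_or => /andP[/andP[/eqP ab _] _].
by exists a, b; rewrite -!h !inE !eqxx !orbT.
Qed.

Lemma leaf_nb x u w m : dist x u = m.+1 -> e u w -> dist x w <= m.+1 -> w = par x u.
Proof.
by move=> hu euw hw; case: (nb_cases eT x euw) => [[_ ->]//|[_ _ _ hd]]; rewrite hd hu ltnn in hw.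
Qed.

(* A vertex of the ball of radius m.+1 is on the last sphere iff it is a leaf of
   the ball, so an isomorphism preserves the smaller ball. *)
Lemma ball_iso_down m x y f : ball_iso m.+1 x y f -> ball_iso m x y f.
Proof.
move=> [[ff fi fs] fe fc].
have sub z u : gball e m z u -> gball e m.+1 z u by move=> /(gballP (eT := eT)) h; apply/(gballP (eT := eT))/leqW.
have fi' u w : gball e m.+1 x u -> gball e m.+1 x w -> f u = f w -> u = w.
  by move=> h1 h2; apply: fi; rewrite inE.
have nbin z u w : gball e m z u -> e u w -> gball e m.+1 z w.
  move=> /(gballP (eT := eT)) h euw; apply/(gballP (eT := eT)).
  by apply: leq_trans (dist_nb _ euw) _.
split; last by move=> u /sub; apply: fc.
- split.
  + move=> u hu; apply/(gballP (eT := eT)); rewrite leqNgt; apply/negP => hd.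
    have : dist y (f u) = m.+1.
      by apply/eqP; rewrite eqn_leq hd andbT; apply/(gballP (eT := eT)); apply/ff/sub.
    move=> hd'; have [u1 [u2 [e1 e2 n12]]] := two_nb u; apply: n12.
    have b1 := nbin _ _ _ hu e1; have b2 := nbin _ _ _ hu e2.
    apply: fi' => //; transitivity (par y (f u)); last symmetry.
      apply: leaf_nb hd' _ _; first by rewrite fe //; apply: sub.
      by apply/(gballP (eT := eT))/ff.
    apply: leaf_nb hd' _ _; first by rewrite fe //; apply: sub.
    by apply/(gballP (eT := eT))/ff.
  + by move=> u w; rewrite !inE => /sub h1 /sub h2; apply: fi'.
  + move=> v hv; have [u hu fu] := fs v (sub _ _ hv); exists u => //.
    apply/(gballP (eT := eT)); rewrite leqNgt; apply/negP => hd.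
    have hd' : dist x u = m.+1.
      by apply/eqP; rewrite eqn_leq hd andbT; apply/(gballP (eT := eT)).
    have [v1 [v2 [e1 e2 n12]]] := two_nb v; apply: n12.
    have [u1 hu1 f1] := fs _ (nbin _ _ _ hv e1); have [u2 hu2 f2] := fs _ (nbin _ _ _ hv e2).
    rewrite -f1 -f2; congr f; transitivity (par x u); last symmetry.
      apply: leaf_nb hd' _ _; first by rewrite -fe // fu f1.
      by apply/(gballP (eT := eT)).
    apply: leaf_nb hd' _ _; first by rewrite -fe // fu f2.
    by apply/(gballP (eT := eT)).
- by move=> u w /sub h1 /sub h2; apply: fe.
Qed.

Lemma ball_iso_le m n x y f : m <= n -> ball_iso n x y f -> ball_iso m x y f.
Proof.
by move=> h; rewrite -(subnK h); elim: (n - m) => // i IH; rewrite addSn => /ball_iso_down.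
Qed.

Lemma ball_iso_center n x y f : ball_iso n x y f -> f x = y.
Proof.
move=> /(ball_iso_le (leq0n n)) [[ff _ _] _ _].
have /ff : gball e 0 x x by apply/(gballP (eT := eT)); rewrite dist_xx.
by move=> /(gballP (eT := eT)); rewrite leqn0 => /eqP /dist_eq0.
Qed.

(** Geodesics of length at most n from [u] or from [f u] stay inside the larger balls, so they can
    be pushed forward and lifted back edge by edge. *)
Lemma ball_iso_nb n x y u f : ball_iso n.+1 x y f -> e x u -> ball_iso n u (f u) f.
Proof.
move=> hf exu; have fx := ball_iso_center hf; have [[ff fi fs] fe fc] := hf.
have bu w : dist u w <= n -> gball e n.+1 x w.
  move=> h; apply/(gballP (eT := eT)); apply: leq_trans (dist_tri u _ _) _.
  by rewrite (dist_edge exu) add1n ltnS.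
have xx : gball e n.+1 x x by apply/(gballP (eT := eT)); rewrite dist_xx.
have uu : gball e n.+1 x u by apply: bu; rewrite dist_xx.
have eyu : e y (f u) by rewrite -fx fe.
have bu' w : dist (f u) w <= n -> gball e n.+1 y w.
  move=> h; apply/(gballP (eT := eT)); apply: leq_trans (dist_tri (f u) _ _) _.
  by rewrite (dist_edge eyu) add1n ltnS.
have fd d w : d <= n -> dist u w = d -> dist (f u) (f w) <= d.
  elim: d w => [|d IH] w hd hw; first by rewrite (dist_eq0 hw) dist_xx.
  have [z ez hz] := dist_pred hw.
  apply: leq_trans (_ : (dist (f u) (f z)).+1 <= _); last by rewrite ltnS IH // ltnW.
  by apply: dist_nb; rewrite fe 1?(tree_sym eT) //; apply: bu; rewrite ?hw ?hz // ltnW.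
split; last by move=> w /(gballP (eT := eT)) /bu; apply: fc.
- split.
  + move=> w /(gballP (eT := eT)) h; apply/(gballP (eT := eT)).
    exact: leq_trans (fd _ _ h erefl) h.
  + move=> w z; rewrite !inE => /(gballP (eT := eT)) /bu h1 /(gballP (eT := eT)) /bu h2.
    by apply: fi; rewrite inE.
  + move=> v /(gballP (eT := eT)) hv.
    suff [w hw fw] : exists2 w, dist u w <= dist (f u) v & f w = v.
      by exists w => //; apply/(gballP (eT := eT)); exact: leq_trans hw hv.
    move Ed : (dist (f u) v) hv => d; elim: d v Ed => [|d IH] v Ed hd.
      by exists u; [rewrite dist_xx|exact: dist_eq0 Ed].
    have [z ez hz] := dist_pred Ed.
    have [w hw fw] := IH _ hz (ltnW hd).
    have [w' hw' fw'] : exists2 w', gball e n.+1 x w' & f w' = v.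
      have [|w' h1 h2] := fs v _; last by exists w'.
      by apply: bu'; rewrite Ed.
    exists w' => //; apply: leq_trans (_ : (dist u w).+1 <= _); last by [].
    apply: dist_nb; rewrite -fe ?fw ?fw' 1?(tree_sym eT) //.
    by apply: bu; apply: leq_trans hw (ltnW hd).
- by move=> w z /(gballP (eT := eT)) /bu h1 /(gballP (eT := eT)) /bu h2; apply: fe.
Qed.

Lemma ball_iso_R n x y f : ball_iso n x y f -> R n x y.
Proof.
elim: n x y f => [|n IH] x y f hf.
  have := ball_iso_center hf => <-; case: hf => _ _ fc /=; rewrite fc //.
  by apply/(gballP (eT := eT)); rewrite dist_xx.
have fx := ball_iso_center hf.
apply: R_succ => [|z]; first by apply: IH (ball_iso_down hf).
have [[ff fi fs] fe fc] := hf.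
have bx w : e x w -> gball e n.+1 x w.
  by move=> h; apply/(gballP (eT := eT)); rewrite (dist_edge h).
have xx : gball e n.+1 x x by apply/(gballP (eT := eT)); rewrite dist_xx.
have um : uniq (map f (nb x)).
  rewrite map_inj_in_uniq ?nb_uniq // => u w; rewrite !mem_nb => /bx hu /bx hw.
  by apply: fi; rewrite inE.
have sub : {subset map f (nb x) <= nb y}.
  move=> v /mapP [u]; rewrite mem_nb => xu ->.
  by rewrite mem_nb -fx fe //; apply: bx.
(* The images of the neighbours of [x] are k distinct neighbours of [y], hence all of them. *)
have [sz eqm] := uniq_min_size um sub (eq_leq (etrans (size_nb y) (esym (etrans (size_map _ _) (size_nb x))))).
have pm : perm_eq (map f (nb x)) (nb y) by apply: uniq_perm => //; apply: nb_uniq.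
rewrite -(permP pm) count_map; apply: eq_in_count => u; rewrite mem_nb /= => xu.
have := IH _ _ _ (ball_iso_nb hf xu) => h.
apply/idP/idP => hz; first exact: R_trans h.
by apply: R_trans hz _; rewrite R_sym.
Qed.

Lemma auto_ball_iso g x n : automorphism e g -> (forall u, phi (g u) = phi u) -> ball_iso n x (g x) g.
Proof.
move=> ga gc; have [[h gh hg] ge] := ga; split=> //; split.
- by move=> u /(gballP (eT := eT)) hu; apply/(gballP (eT := eT)); rewrite auto_dist.
- by move=> u w _ _; apply: (can_inj gh).
- move=> v /(gballP (eT := eT)) hv; exists (h v) => //.
  by apply/(gballP (eT := eT)); rewrite -(auto_dist _ _ ga) hg.
Qed.

Lemma R_ball_iso n x y : R n x y -> exists f, ball_iso n x y f.
Proof.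
move=> hxy.
(* A vertex at distance i from [x] has to keep its class only up to step n - i, and beyond radius n
   nothing is required. *)
pose E i : rel V := if i <= n then R (n - i) else fun _ _ => true.
have [x1 [y1 [ex ey h1]]] : exists x1 y1, [/\ e x x1, e y y1 & E 1 x1 y1].
  have [x1 ex1] := nb_ex1 k2 eR x.
  rewrite /E; case: (n) hxy => [|n'] h.
    by have [y1 ey1] := nb_ex1 k2 eR y; exists x1, y1.
  by have [y1 ey1 hr] := R_nb h ex1; exists x1, y1; rewrite subn1.
have [||||f [fa fx _ fE]] := @tree_ext V e k k2 eT eR E x y x1 y1 _ _ _ _ ex ey h1.
- by move=> i; rewrite /E; case: ifP => // _; apply: R_eqr.
- move=> i u w; rewrite /E; case: (ltnP i n) => // hi; rewrite (ltnW hi).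
  by apply: R_le; apply: leq_sub2l.
- move=> i u w; rewrite /E; case: (ltnP i n) => hi.
    by rewrite (ltnW hi) => hu z; apply: R_cnt; rewrite -subSn // subSS.
  by move=> _ z; rewrite !count_predT !size_nb.
- by rewrite /E leq0n subn0.
have fc u : dist x u <= n -> phi (f u) = phi u.
  move=> hu; have := fE u; rewrite /E hu => /(R_le (leq0n _)) /= /eqP ->//.
exists f; split.
- split.
  + by move=> u /(gballP (eT := eT)) hu; apply/(gballP (eT := eT)); rewrite -fx auto_dist.
  + by move=> u w _ _; case: fa => [[h gh hg] _]; apply: (can_inj gh).
  + move=> v /(gballP (eT := eT)) hv; have [[h gh hg] _] := fa; exists (h v) => //.
    by apply/(gballP (eT := eT)); rewrite -(auto_dist _ _ fa) hg fx.
- by move=> u w _ _; case: fa.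
- by move=> u /(gballP (eT := eT)); apply: fc.
Qed.

Lemma ball_equivP n x y : ball_equiv e phi n x y <-> R n x y.
Proof. by split=> [[f]|/R_ball_iso [f hf]]; [apply: ball_iso_R|exists f]. Qed.

(** * The limit relation and the automorphisms of the coloring *)

Definition Ri : rel V := fun x y => `[< forall n, R n x y >].

Lemma Ri_R n x y : Ri x y -> R n x y.
Proof. by move/asboolP. Qed.

Lemma Ri_eqr : equivalence_rel Ri.
Proof.
apply/equivalence_relP; split=> [x|x y h z]; first by apply/asboolP => n; apply: R_refl.
have {}h n := Ri_R n h.
apply/asboolP/asboolP => hz n; last exact: R_trans (hz n).
by apply: R_trans (hz n); rewrite R_sym.
Qed.
Lemma Ri_refl x : Ri x x. Proof. by apply/asboolP => n; apply: R_refl. Qed.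
Lemma Ri_sym x y : Ri x y = Ri y x.
Proof. by apply/asboolP/asboolP => h n; rewrite R_sym. Qed.
Lemma Ri_trans y x z : Ri x y -> Ri y z -> Ri x z.
Proof. by move=> /asboolP h1 /asboolP h2; apply/asboolP => n; apply: R_trans (h2 n). Qed.

Lemma nRi_R x y : ~~ Ri x y -> exists N, forall n, N <= n -> ~~ R n x y.
Proof.
move=> /asboolP /existsNP [N hN]; exists N => n hn; apply/negP => /(R_le hn) //.
Qed.

(** Each inequivalent pair is separated at some step, and a finite list has finitely many pairs.
    This replaces the limit relation near a vertex by [R n] for any large n. *)
Lemma R_stab (s : seq V) : exists N, forall u v, u \in s -> v \in s -> forall n, N <= n -> R n u v -> Ri u v.
Proof.
have H u (t : seq V) : exists N, forall v, v \in t -> forall n, N <= n -> R n u v -> Ri u v.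
  elim: t => [|v t [N IH]]; first by exists 0.
  case: (boolP (Ri u v)) => [h|/nRi_R [M hM]].
    by exists N => w; rewrite inE => /orP[/eqP -> //|]; apply: IH.
  exists (maxn M N) => w; rewrite inE => /orP[/eqP ->|wt] n; rewrite geq_max => /andP[h1 h2].
    by rewrite (negbTE (hM _ h1)).
  exact: IH.
suff [N hN] : exists N, forall u, u \in s -> forall v, v \in s -> forall n, N <= n -> R n u v -> Ri u v.
  by exists N => u v hu; apply: hN.
move: {-2}s => t; elim: t => [|u t [N IH]]; first by exists 0.
have [M hM] := H u s.
exists (maxn M N) => w; rewrite inE => /orP[/eqP -> v vs n|wt v vs n]; rewrite geq_max => /andP[h1 h2].
  exact: hM.
exact: IH.
Qed.

(** On the finite list of [z] and all neighbours involved, the limit relation is some [R N], for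
    which the counts agree. *)
Lemma Ri_cnt x y z : Ri x y -> count (Ri z) (nb x) = count (Ri z) (nb y).
Proof.
move=> h; have [N hN] := R_stab (z :: nb x ++ nb y).
have H w : {subset nb w <= z :: nb x ++ nb y} -> count (Ri z) (nb w) = count (R N z) (nb w).
  move=> sub; apply: eq_in_count => u /sub uw; apply/idP/idP => [/Ri_R //|].
  by apply: hN => //; rewrite mem_head.
have sx : {subset nb x <= z :: nb x ++ nb y} by move=> u uw; rewrite inE mem_cat uw !orbT.
have sy : {subset nb y <= z :: nb x ++ nb y} by move=> u uw; rewrite inE mem_cat uw !orbT.
by rewrite (H _ sx) (H _ sy); apply/R_cnt/Ri_R.
Qed.

Lemma Ri_nb x y z : Ri x y -> e x z -> exists2 w, e y w & Ri z w.
Proof. by move=> h; apply: cnt_nb; [apply: Ri_refl|apply: Ri_cnt]. Qed.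

Definition autG : set (V -> V) := [set g | automorphism e g /\ forall x, phi (g x) = phi x].

Lemma autG_Ri g x : autG g -> Ri x (g x).
Proof. by move=> [ga gc]; apply/asboolP => n; apply: ball_iso_R (auto_ball_iso _ _ ga gc). Qed.

(** [tree_ext] with the constant relation [Ri]. Moving an edge and not only a vertex is what puts
    all edges between two given orbits into a single edge orbit. *)
Lemma Ri_autG_edge x y x1 y1 : Ri x y -> e x x1 -> e y y1 -> Ri x1 y1 ->
  exists g, [/\ autG g, g x = y & g x1 = y1].
Proof.
move=> h ex ey h1.
have [||||f [fa fx fx1 fE]] := @tree_ext V e k k2 eT eR (fun _ => Ri) x y x1 y1 _ _ _ _ ex ey h1 => //.
- by move=> _; apply: Ri_eqr.
- by move=> _ u w hu z; apply: Ri_cnt.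
exists f; split=> //; split=> // u.
by have := Ri_R 0 (fE u) => /= /eqP ->.
Qed.

Lemma Ri_autG x y : Ri x y -> exists2 g, autG g & g x = y.
Proof.
move=> h; have [x1 ex] := nb_ex1 k2 eR x; have [y1 ey h1] := Ri_nb h ex.
by have [g [h2 h3 _]] := Ri_autG_edge h ex ey h1; exists g.
Qed.

Lemma auto_inv g h : automorphism e g -> cancel g h -> cancel h g -> automorphism e h.
Proof.
move=> [_ ge] gh hg; split; first by exists g.
by move=> x y; rewrite -(ge (h x) (h y)) !hg.
Qed.

Lemma autG_group : automorphism_group e autG.
Proof.
split.
- by move=> g [].
- by split=> //; split=> //; exists id.
- move=> g h [[gb ge] gc] [[hb he] hc]; split; last by move=> x /=; rewrite gc hc.
  by split; [apply: bij_comp|move=> x y /=; rewrite ge he].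
- move=> g [ga gc]; have [[h gh hg] ge] := ga; exists h; split=> //; split.
    exact: auto_inv gh hg.
  by move=> x; rewrite -(gc (h x)) hg.
Qed.

End Refine.
Arguments R_refl {V e k A phi eR n} x.
Arguments R_sym {V e k A phi eR} n x y.
Arguments Ri_refl {V e k A phi eR} x.
Arguments Ri_sym {V e k A phi eR} x y.
Arguments R_stab {V e k A phi eR} s.

(** * Special balls *)

Section Sturm.
Variables (V : choiceType) (e : rel V) (k : nat) (A : countType) (phi : V -> A).
Hypotheses (k2 : 2 <= k) (eT : is_tree e) (eR : regular e k) (St : sturmian e phi).
Local Notation dist := (dist eT).
Local Notation nb := (nb eR).
Local Notation par := (par eT).
Local Notation R := (R phi eR).
Local Notation Ri := (Ri phi eR).

Lemma colored_ballE n x y : colored_ball e phi n x = colored_ball e phi n y <-> R n x y.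
Proof.
split=> [h|h].
  suff : colored_ball e phi n x y by move/(ball_equivP phi k2 eT eR).
  by rewrite h; apply/(ball_equivP phi k2 eT eR); apply: R_refl.
apply/seteqP; split=> z /(ball_equivP phi k2 eT eR) hz; apply/(ball_equivP phi k2 eT eR).
  by apply: R_trans hz; rewrite R_sym.
exact: R_trans hz.
Qed.

Lemma reps n : exists s : seq V,
  [/\ size s = n + 2, pairwise (fun x y => ~~ R n x y) s & forall x, exists2 y, y \in s & R n x y].
Proof.
have [s [us ss hs]] := card_seq (St n).
have x0 : V.
  case: s us ss hs => [|B s] _ ss hs; first by rewrite addn2 in ss.
  by have [x _ _] := cid2 ((hs B).1 (mem_head _ _)).
pose r B := xget x0 [set x | colored_ball e phi n x = B].
have rP B : B \in s -> colored_ball e phi n (r B) = B.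
  move=> /hs [x _ hx]; rewrite /r; case: xgetP => [y _ //|h].
  by case: (h x).
exists (map r s); split; first by rewrite size_map.
  rewrite pairwise_map; apply/(pairwiseP (set0 : set V)) => i j; rewrite !inE => hi hj hij /=.
  apply/negP => /colored_ballE; rewrite !rP ?mem_nth // => /eqP.
  by rewrite nth_uniq // => /eqP hij'; rewrite hij' ltnn in hij.
move=> x; have hx : colored_ball e phi n x \in s by apply/hs; exists x.
by exists (r (colored_ball e phi n x)); [apply: map_f|apply/colored_ballE; rewrite rP].
Qed.

Lemma pw_size n s : pairwise (fun x y => ~~ R n x y) s -> size s <= n + 2.
Proof.
move=> ps; have [t [st _ ht]] := reps n.
pose f x := find (R n x) t.
have fP x : f x < size t /\ R n x (nth x t (f x)).
  have hh : has (R n x) t by apply/hasP; have [y yt hy] := ht x; exists y.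
  by split; [rewrite -has_find|apply: nth_find].
rewrite -(size_map f) -(size_iota 0 (n + 2)); apply: uniq_leq_size.
  rewrite uniq_pairwise pairwise_map; apply: sub_pairwise ps => x y /= nr.
  apply: contraNN nr => /eqP hf.
  have [lx rx] := fP x; have [_ ry] := fP y.
  apply: R_trans rx _; rewrite R_sym (set_nth_default y) // hf.
  exact: ry.
by move=> i /mapP [x _ ->]; rewrite mem_iota -st; case: (fP x).
Qed.

(** The number of classes grows by one. A splitting pair not distributed over the new classes of [a]
    and [b] has a member [y'] in neither of them, and then there is one class too many. *)
Lemma split_pair n : exists a b, [/\ R n a b, ~~ R n.+1 a b &
  forall x y, R n x y -> ~~ R n.+1 x y ->
   (R n.+1 x a /\ R n.+1 y b) \/ (R n.+1 x b /\ R n.+1 y a)].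
Proof.
have [s [ss ps _]] := reps n.+1.
have [a [b [hab nab]]] : exists a b, R n a b /\ ~~ R n.+1 a b.
  apply: contrapT => hn; have /pw_size : pairwise (fun x y => ~~ R n x y) s.
    apply: sub_pairwise ps => x y nr; apply/negP => h; apply: hn.
    by exists x, y.
  by rewrite ss addSn ltnn.
exists a, b; split=> // x y hxy nxy; apply: contrapT => hn.
have {hn}[x' [y' [hx' nx' ya yb]]] : exists x y, [/\ R n x y, ~~ R n.+1 x y, ~~ R n.+1 y a & ~~ R n.+1 y b].
  case: (boolP (R n.+1 x a)) => xa.
    case: (boolP (R n.+1 y a)) => ya.
      by move: nxy; rewrite (R_trans xa) // R_sym.
    case: (boolP (R n.+1 y b)) => yb; first by case: hn; left.
    by exists x, y.
  case: (boolP (R n.+1 x b)) => xb; last by exists y, x; rewrite !(R_sym _ y x) .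
  case: (boolP (R n.+1 y b)) => yb.
    by move: nxy; rewrite (R_trans xb) // R_sym.
  case: (boolP (R n.+1 y a)) => ya; first by case: hn; right.
  by exists x, y.
have [u [su pu _]] := reps n.
(* [c] moves each representative, inside its class of step n, off the classes of [b] and [y'] at
   step [n.+1]. Adjoining [b] and [y'] gives n + 4 inequivalent vertices where only n + 3 are
   possible. *)
pose c v := if R n.+1 v b then a else if R n.+1 v y' then (if R n.+1 x' b then a else x') else v.
have cR v : R n v (c v).
  rewrite /c; case: ifP => [/R_S h|_]; first by apply: R_trans h _; rewrite R_sym.
  case: ifP => [/R_S h|_]; last exact: R_refl.
  have hv : R n v x' by apply: R_trans h _; rewrite R_sym.
  case: ifP => // /R_S h2; apply: R_trans hv (R_trans h2 _).
  by rewrite R_sym.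
have cb v : ~~ R n.+1 b (c v).
  rewrite R_sym /c; case: ifP => // h1; case: ifP => [_|]; last by rewrite h1.
  by case: ifP => // ->.
have cy v : ~~ R n.+1 y' (c v).
  rewrite /c; case: ifP => // h1; case: ifP => [_|h2]; last by rewrite R_sym h2.
  by case: ifP => // _; rewrite R_sym.
have /pw_size : pairwise (fun x y => ~~ R n.+1 x y) (y' :: b :: map c u).
  rewrite 2!pairwise_cons; apply/and3P; split.
  - by apply/allP => z; rewrite inE => /orP[/eqP ->//|/mapP [v _ ->]].
  - by apply/allP => _ /mapP [v _ ->].
  rewrite pairwise_map; apply: sub_pairwise pu => v w; apply: contraNN => /R_S h.
  by apply: R_trans (cR v) (R_trans h _); rewrite R_sym.
rewrite /= size_map su; lia.
Qed.

Lemma cover_size n l : (forall z, exists2 r, r \in l & R n z r) -> n + 2 <= size l.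
Proof.
move=> hl; have [t [st pt _]] := reps n.
pose f x := find (R n x) l.
have fP x : f x < size l /\ R n x (nth x l (f x)).
  have hh : has (R n x) l by apply/hasP; have [y yt hy] := hl x; exists y.
  by split; [rewrite -has_find|apply: nth_find].
rewrite -st -(size_map f) -(size_iota 0 (size l)); apply: uniq_leq_size.
  rewrite uniq_pairwise pairwise_map; apply: sub_pairwise pt => x y /= nr.
  apply: contraNN nr => /eqP hf.
  have [lx rx] := fP x; have [_ ry] := fP y.
  apply: R_trans rx _; rewrite R_sym (set_nth_default y) // hf.
  exact: ry.
by move=> i /mapP [x _ ->]; rewrite mem_iota; case: (fP x).
Qed.

Definition Sp n x := exists2 w, R n x w & ~~ R n.+1 x w.

Lemma Sp_two n x y z : R n x y -> R n x z -> ~~ R n.+1 x y -> ~~ R n.+1 x z -> R n.+1 y z.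
Proof.
move=> hy hz ny nz; have [a [b [_ nab H]]] := split_pair n.
case: (H _ _ hy ny) (H _ _ hz nz) => [[h1 h2]|[h1 h2]] [[h3 h4]|[h3 h4]];
  try by apply: R_trans h2 _; rewrite R_sym.
  by move: nab; rewrite (@R_trans _ _ _ _ _ _ _ x) // R_sym.
by move: nab; rewrite (@R_trans _ _ _ _ _ _ _ x) // R_sym.
Qed.

Lemma Sp_uniq n x y : Sp n x -> Sp n y -> R n x y.
Proof.
have [a [b [hab nab H]]] := split_pair n.
have H1 z : Sp n z -> R n z a.
  move=> [w h1 h2]; case: (H _ _ h1 h2) => [[/R_S //]|[/R_S h _]].
  by apply: R_trans h _; rewrite R_sym.
by move=> /H1 hx /H1 hy; apply: R_trans hx _; rewrite R_sym.
Qed.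

Lemma Sp_ex n : exists a b, [/\ Sp n a, R n a b & ~~ R n.+1 a b].
Proof. by have [a [b [hab nab _]]] := split_pair n; exists a, b; split=> //; exists b. Qed.

Lemma Sp_R n x y : R n x y -> Sp n x -> Sp n y.
Proof.
move=> hxy [w h1 h2]; case: (boolP (R n.+1 x y)) => h.
  exists w; first by apply: R_trans h1; rewrite R_sym.
  by apply: contraNN h2; apply: R_trans.
by exists x; rewrite R_sym.
Qed.

Lemma nSp n x y : ~ Sp n x -> R n x y -> R n.+1 x y.
Proof. by move=> hn h; apply: contrapT => /negP h2; apply: hn; exists y. Qed.

Lemma type_setP n x : type_set e phi x n <-> Sp n x.
Proof.
split=> [[x' [y' [/colored_ballE h1 /colored_ballE h2 h3]]]|[w h1 h2]].
  have h4 : ~~ R n.+1 x' y' by apply/negP => /colored_ballE.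
  by apply: (Sp_R h1); exists y' => //; apply: R_trans h1 _; rewrite R_sym.
exists x, w; split=> //; first by apply/colored_ballE; rewrite R_sym.
by move/colored_ballE; apply/negP.
Qed.

End Sturm.

(** * Bounded and unbounded type *)

Section Struct.
Variables (V : choiceType) (e : rel V) (k : nat) (A : countType) (phi : V -> A).
Hypotheses (k2 : 2 <= k) (eT : is_tree e) (eR : regular e k) (St : sturmian e phi).
Local Notation dist := (dist eT).
Local Notation nb := (nb eR).
Local Notation par := (par eT).
Local Notation R := (R phi eR).
Local Notation Ri := (Ri phi eR).
Local Notation Sp := (Sp phi eR).

Let Sp_two := @Sp_two V e k A phi k2 eT eR St.
Let Sp_uniq := @Sp_uniq V e k A phi k2 eT eR St.
Let Sp_ex := Sp_ex k2 eT eR St.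
Let Sp_R := @Sp_R V e k A phi eR.
Let nSp := @nSp V e k A phi eR.

(* Let the class of x split at step n.+1, with n large. At most one y_i splits at
   step n and at most one at step n.+2, so some y = y_i splits at none of the
   steps n, n.+1, n.+2. Then y has neighbours in both halves of the class of x,
   although R n.+1 equivalent vertices near x are in the same orbit. *)
Lemma degree_unbounded x y1 y2 y3 : (forall N, exists2 n, N <= n & Sp n x) ->
  e x y1 -> e x y2 -> e x y3 -> ~~ Ri x y1 -> ~~ Ri x y2 -> ~~ Ri x y3 ->
  ~~ Ri y1 y2 -> ~~ Ri y1 y3 -> ~~ Ri y2 y3 -> False.
Proof.
move=> unb e1 e2 e3 n1 n2 n3 n12 n13 n23.
pose s := [:: x, y1, y2, y3 & nb y1 ++ nb y2 ++ nb y3].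
have [N hN] := R_stab (phi := phi) (eR := eR) s.
have sI u v n : u \in s -> v \in s -> N <= n -> ~~ Ri u v -> ~~ R n u v.
  by move=> us vs hn; apply: contraNN; apply: hN hn.
have [[//|n] hn Spx] := unb N.+1.
have [x2 x2r x2n] := Spx.
have xs : x \in s by rewrite mem_head.
have key y : e x y -> y \in s -> {subset nb y <= s} -> ~~ Ri x y -> ~ Sp n y -> ~ Sp n.+2 y -> False.
  move=> exy ys subs nxy ns1 ns2.
  have [w ew rw] := R_nb x2r exy.
  have rw1 := nSp ns1 rw.
  have ns3 : ~ Sp n.+1 y.
    by move=> sy; have := Sp_uniq Spx sy; apply/negP/sI => //; apply: leqW.
  have rw3 := nSp ns2 (nSp ns3 rw1).
  have ewx : e w x2 by rewrite tree_sym.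
  have rw3' : R n.+3 w y by rewrite R_sym.
  have [x3 ex3 rx3] := R_nb rw3' ewx.
  have rx : R n.+1 x x3 by apply: R_trans x2r _; apply: R_S rx3.
  have : Ri x x3 by apply: (hN _ _ xs _ n.+1) rx; [apply: subs; rewrite mem_nb|apply: leqW].
  move=> /(Ri_R n.+2) h; move: x2n; rewrite (R_trans h) // R_sym //.
have y1s : y1 \in s by rewrite !inE eqxx !orbT.
have y2s : y2 \in s by rewrite !inE eqxx !orbT.
have y3s : y3 \in s by rewrite !inE eqxx !orbT.
have s1 : {subset nb y1 <= s} by move=> u hu; rewrite !inE !mem_cat hu !orbT.
have s2 : {subset nb y2 <= s} by move=> u hu; rewrite !inE !mem_cat hu !orbT.
have s3 : {subset nb y3 <= s} by move=> u hu; rewrite !inE !mem_cat hu !orbT.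
have ex u v n' : u \in s -> v \in s -> N <= n' -> ~~ Ri u v -> Sp n' u -> ~ Sp n' v.
  by move=> us vs h /(sI _ _ _ us vs h)/negP nuv su sv; apply/nuv/Sp_uniq.
have ex1 u v us vs := ex u v n us vs hn.
have ex2 u v us vs := ex u v n.+2 us vs (leqW (leqW hn)).
have := key _ e1 y1s s1 n1; have := key _ e2 y2s s2 n2; have := key _ e3 y3s s3 n3.
have := ex1 _ _ y1s y2s n12; have := ex1 _ _ y1s y3s n13; have := ex1 _ _ y2s y3s n23.
have := ex2 _ _ y1s y2s n12; have := ex2 _ _ y1s y3s n13; have := ex2 _ _ y2s y3s n23.
case: (pselect (Sp n y1)); case: (pselect (Sp n y2)); case: (pselect (Sp n y3));
case: (pselect (Sp n.+2 y1)); case: (pselect (Sp n.+2 y2)); case: (pselect (Sp n.+2 y3)); tauto.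
Qed.

(** * Classes meeting finitely many orbits *)

Definition fin n z := exists l : seq V, forall w, R n z w -> exists2 r, r \in l & Ri r w.

Lemma fin_R n y z : R n y z -> fin n y -> fin n z.
Proof. by move=> h [l hl]; exists l => w hw; apply/hl/(R_trans h). Qed.

Lemma fin_S n z : fin n z -> fin n.+1 z.
Proof. by move=> [l hl]; exists l => w /R_S /hl. Qed.

Lemma fin_nSp n z : ~ Sp n z -> fin n.+1 z -> fin n z.
Proof. by move=> hn [l hl]; exists l => w /(nSp hn) /hl. Qed.

Lemma fin_union n y z : R n y z -> ~~ R n.+1 y z -> fin n.+1 y -> fin n.+1 z -> fin n y.
Proof.
move=> h nyz [l hl] [l' hl']; exists (l ++ l') => w hw.
case: (boolP (R n.+1 y w)) => hyw.
  by have [r rl hr] := hl _ hyw; exists r; rewrite ?mem_cat ?rl.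
have [r rl hr] := hl' _ (Sp_two h hw nyz hyw).
by exists r; rewrite // mem_cat rl orbT.
Qed.

(** Otherwise finitely many orbits would cover T, while step n has n + 2 classes for every n. *)
Lemma not_all_fin n : exists z, ~ fin n z.
Proof.
apply: contrapT => /forallNP hn.
have {}hn z : fin n z by apply: contrapT.
have [s [_ _ hs]] := reps k2 eT eR St n.
have [l hl] : exists l : seq V, forall w, exists2 r, r \in l & Ri r w.
  suff [l hl] : exists l : seq V, forall z w, z \in s -> R n z w -> exists2 r, r \in l & Ri r w.
    by exists l => w; have [z zs hz] := hs w; apply: (hl z) => //; rewrite R_sym.
  elim: (s) => [|z t [l hl]]; first by exists [::].
  have [l' hl'] := hn z; exists (l' ++ l) => y w; rewrite inE => /orP[/eqP -> /hl' [r h1 h2]|yt].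
    by exists r => //; rewrite mem_cat h1.
  by move=> /(hl _ _ yt) [r h1 h2]; exists r => //; rewrite mem_cat h1 orbT.
have [t [st pt _]] := reps k2 eT eR St (size l).
pose f x := find (Ri^~ x) l.
have fP x : f x < size l /\ Ri (nth x l (f x)) x.
  have hh : has (Ri^~ x) l by apply/hasP; have [y yt hy] := hl x; exists y.
  by split; [rewrite -has_find|apply: (nth_find x hh)].
suff : size t <= size l by rewrite st; lia.
rewrite -(size_map f) -(size_iota 0 (size l)); apply: uniq_leq_size.
  rewrite uniq_pairwise pairwise_map; apply: sub_pairwise pt => x y /= nr.
  apply: contraNN nr => /eqP hf.
  have [lx rx] := fP x; have [_ ry] := fP y.
  apply: Ri_R; apply: Ri_trans ry; rewrite Ri_sym -hf (set_nth_default x) //.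
by move=> i /mapP [x _ ->]; rewrite mem_iota; case: (fP x).
Qed.

Lemma fin_not_special n z : fin n z -> exists N, forall n', N <= n' -> ~ Sp n' z.
Proof.
move=> [l hl]; have [N hN] := R_stab (phi := phi) (eR := eR) (z :: l).
exists (maxn N n) => n'; rewrite geq_max => /andP[h1 h2] [w hw /negP]; apply.
have [r rl hr] := hl _ (R_le h2 hw).
have : Ri z r.
  apply: hN h1 _; rewrite ?mem_head ?inE ?rl ?orbT //.
  by apply: R_trans hw _; rewrite R_sym; apply: Ri_R.
by move=> h; apply: (Ri_R n'.+1); apply: Ri_trans h hr.
Qed.

Lemma not_special_fin N x : (forall n, N <= n -> ~ Sp n x) -> fin N x.
Proof.
move=> h; exists [:: x] => w hw; exists x; rewrite ?mem_head //.
apply/asboolP => n; case: (leqP n N) => hn; first exact: R_le hw.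
rewrite -(subnK (ltnW hn)); elim: (n - N) => // i IH.
by rewrite addSn; apply: nSp => //; apply: h; apply: leq_addl.
Qed.

(** A class that never splits again is a single orbit. Conversely, finitely many orbits are all
    separated at some step, after which the class of [z] is no longer special. *)
Lemma bounded_typeP : bounded_type e phi <-> exists n z, fin n z.
Proof.
have tE x : type_set e phi x = [set n | Sp n x].
  by apply/seteqP; split=> n; move/(type_setP phi k2 eT eR).
split=> [[x]|[n [z /fin_not_special [N hN]]]].
  rewrite tE => /finite_seqP [s hs]; exists (\max_(i <- s) i).+1, x.
  apply: not_special_fin => n hn hx.
  have : n \in s by have : [set n | Sp n x] n by []; rewrite hs.
  by move=> /(@leq_bigmax_seq _ _ xpredT id) /(_ isT); rewrite leqNgt hn.
exists z; rewrite tE; apply: (@sub_finite_set _ _ `I_N) (finite_II N).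
by move=> i hi /=; rewrite ltnNge; apply/negP => /hN.
Qed.

Lemma unbounded_special : ~ bounded_type e phi -> forall x N, exists2 n, N <= n & Sp n x.
Proof.
move=> hb x N; apply: contrapT => hn; apply: hb; apply/bounded_typeP; exists N, x.
by apply: not_special_fin => n h1 h2; apply: hn; exists n.
Qed.

(* The distance to the R n class of z. *)
Definition dcl n z := dto (eT := eT) (R_refl (phi := phi) (eR := eR) (n := n) z).

Lemma dclP n z x : exists2 w, R n z w & dist x w = dcl n z x.
Proof. exact: dtoP. Qed.

Lemma dcl0 n z x : dcl n z x = 0 <-> R n z x.
Proof. exact: dto0. Qed.

Lemma dcl_nb n z x y : e x y -> dcl n z y <= (dcl n z x).+1.
Proof. exact: dto_nb. Qed.

Lemma dcl_pred n z x i : dcl n z x = i.+1 -> exists2 y, e x y & dcl n z y = i.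
Proof. exact: dto_pred. Qed.

Lemma dcl_all n z x i : i <= dcl n z x -> exists y, dcl n z y = i.
Proof. exact: dto_all. Qed.

(** The i further refinement steps see a shortest way from [u] to the class, and [v] has an
    equivalent one. *)
Lemma dcl_sep n z i u v : dcl n z u <= i -> R (n + i) u v -> dcl n z v <= dcl n z u.
Proof.
elim: i u v => [|i IH] u v.
  rewrite leqn0 addn0 => /eqP h hr; rewrite h leqn0; apply/eqP/dcl0.
  by move/dcl0: h => h; apply: R_trans hr.
rewrite leq_eqVlt addnS ltnS => /orP[/eqP h hr|h /R_S]; last exact: IH.
have [u' eu hu] := dcl_pred h; have [v' ev hv] := R_nb hr eu.
have h2 : dcl n z v' <= i by rewrite -hu; apply: IH hv; rewrite hu.
by apply: leq_trans (dcl_nb _ _ (_ : e v' v)) _; rewrite 1?(tree_sym eT) // h ltnS.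
Qed.

(** Were the class infinite in orbits, take n + 2 of its orbits, separated from step N on. Together
    with vertices at distances 1, ..., N + 1 from the class they form n + N + 3 inequivalent
    vertices at step n + N, one too many. *)
Lemma far_fin n z : (forall j, exists x, forall w, R n z w -> j < dist x w) -> fin n z.
Proof.
move=> far; apply: contrapT => nfin.
have H m : exists l : seq V, [/\ size l = m, all (R n z) l & pairwise (fun x y => ~~ Ri x y) l].
  elim: m => [|m [l [sl al pl]]]; first by exists [::].
  have [w hw nw] : exists2 w, R n z w & forall r, r \in l -> ~~ Ri r w.
    apply: contrapT => hn; apply: nfin; exists l => w hw; apply: contrapT => h2.
    by apply: hn; exists w => // r rl; apply/negP => hr; apply: h2; exists r.
  exists (w :: l); split; rewrite ?pairwise_cons /= ?sl ?hw // pl andbT.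
  by apply/allP => r /nw; rewrite Ri_sym.
have [l [sl al pl]] := H n.+2.
have [N hN] := R_stab (phi := phi) (eR := eR) l.
have [x hx] := far N.
have dx : N < dcl n z x by have [w hw <-] := dclP n z x; apply: hx.
(* [v i] is at distance [minn i (dcl n z x)], which is [i] as long as [i <= N.+1]. *)
pose v i := projT1 (cid (dcl_all (leq_trans (geq_minr i (dcl n z x)) (leqnn _)))).
have vP i : i <= N.+1 -> dcl n z (v i) = i.
  by move=> hi; rewrite /v; case: cid => y /= ->; apply/minn_idPl/(leq_trans hi).
have /(pw_size k2 eT St) : pairwise (fun x y => ~~ R (n + N) x y) (l ++ map v (iota 1 N.+1)).
  rewrite pairwise_cat; apply/and3P; split.
  - apply/allrelP => a b al' /mapP [i]; rewrite mem_iota => /andP[i1 i2] ->.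
    apply/negP => h; have a0 : dcl n z a = 0 by apply/dcl0/(allP al).
    have := dcl_sep (_ : dcl n z a <= N) h; rewrite a0 => /(_ isT).
    by rewrite vP // leqn0 => /eqP i0; rewrite i0 in i1.
  - apply: (sub_in_pairwise (P := [in l])) pl => [a b ia ib|]; last by apply/allP.
    by apply: contraNN; apply: hN => //; apply: leq_addl.
  - rewrite pairwise_map; have := iota_ltn_sorted 1 N.+1; rewrite (sorted_pairwise ltn_trans).
    apply: (sub_in_pairwise (P := fun i => i <= N.+1)); last first.
      by apply/allP => i; rewrite mem_iota => /andP[]; lia.
    move=> a b; rewrite !unfold_in => ha hb hab /=; apply/negP => h.
    have := dcl_sep (_ : dcl n z (v a) <= N) h; rewrite !vP //.
    by move=> /(_ (leq_trans hab hb)); rewrite leqNgt hab.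
by rewrite size_cat size_map size_iota sl; lia.
Qed.

Definition core m c := fin m c /\ forall n z, n < m -> ~ fin n z.

Lemma core_ex : bounded_type e phi -> exists m c, core m c.
Proof.
move/bounded_typeP => [n [z hz]].
have hex : exists n, `[< exists z, fin n z >] by exists n; apply/asboolP; exists z.
case: (ex_minnP hex) => m /asboolP [c hc] hm; exists m, c; split=> // n' z' hn hz'.
by have := hm n'; rewrite leqNgt hn => H; have : false by apply: H; apply/asboolP; exists z'.
Qed.

Section Core.
Variables (m : nat) (c : V).
Hypothesis Hc : core m c.
Local Notation d := (dcl m c).

Lemma core_Sp m' : m = m'.+1 -> forall z, fin m z -> Sp m' z.
Proof.
case: Hc => _ hm mE z hz; apply: contrapT => hn.
by apply: (hm m' z); [rewrite mE|apply: fin_nSp; rewrite -?mE].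
Qed.

(** A second finite class would be the other half of the class from which that of [c] was cut at the
    preceding step, making this class finite against the leastness of m. For m = 0 the two classes
    would be all there are. *)
Lemma core_fin z : fin m z -> R m c z.
Proof.
case: Hc => hc hm hz; apply: contrapT => /negP nr.
case Em : m => [|m'].
  have [w hw] := not_all_fin m; apply: hw.
  have := @pw_size V e k A phi k2 eT eR St m [:: w; c; z].
  rewrite /= nr !andbT; case: (boolP (R m w c)) => [h _|_] /=.
    by apply: fin_R hc; rewrite R_sym.
  case: (boolP (R m w z)) => [h _|_] /=; first by apply: fin_R hz; rewrite R_sym.
  by rewrite Em => /(_ isT).
have s1 := core_Sp Em hc; have s2 := core_Sp Em hz.
apply: (hm m' c); first by rewrite Em.
by apply: (@fin_union m' c z (Sp_uniq s1 s2)); rewrite -?Em.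
Qed.

(* The special class at step m + j is that of the vertices at distance j.+1,
   together with infinitely many orbits farther away. *)
Lemma core_levels j :
  (forall z, fin (m + j) z <-> d z <= j) /\
  (forall z z', d z <= j -> d z' = d z -> R (m + j) z z').
Proof.
elim: j => [|j [P1 P2]].
  rewrite addn0; split=> [z|z z'].
    split=> [/core_fin h|]; first by rewrite leqn0; apply/eqP/dcl0.
    by rewrite leqn0 => /eqP /dcl0 h; case: Hc => h1 _; apply: fin_R h1.
  rewrite leqn0 => /eqP h; rewrite h => /dcl0 h'; move/dcl0: h => h.
  by apply: R_trans h'; rewrite R_sym.
have sep u v : d u <= j.+1 -> R (m + j).+1 u v -> d v <= d u.
  by rewrite -addnS; apply: dcl_sep.
(* Equivalent vertices stay on level [j.+1], and this level consists of neighbours of level j, which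
   meets finitely many orbits. *)
have S1 z : d z = j.+1 -> fin (m + j).+1 z.
  move=> hz; have [y ey hy] := dcl_pred hz.
  have /P1 [l hl] : d y <= j by rewrite hy.
  exists (flatten (map nb l)) => w hw.
  have hw1 : d w = j.+1.
    apply/eqP; rewrite eqn_leq -{1}hz sep ?hz //= ltnNge; apply/negP => hwj.
    have : d z <= d w by apply: sep; rewrite 1?R_sym // leqW.
    by rewrite hz ltnNge hwj.
  have [y' ey' hy'] := dcl_pred hw1.
  have [r rl hr] : exists2 r, r \in l & Ri r y' by apply/hl/P2; rewrite ?hy ?hy'.
  rewrite Ri_sym in hr; rewrite tree_sym // in ey'.
  have [r' er' hr'] := Ri_nb hr ey'.
  exists r'; last by rewrite Ri_sym.
  by apply/flattenP; exists (nb r); [apply: map_f|rewrite mem_nb].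
(* Finite at the next step but not yet at this one: the class has to split in between. *)
have S2 z : d z = j.+1 -> Sp (m + j) z.
  move=> hz; apply: contrapT => /fin_nSp /(_ (S1 _ hz)) /P1.
  by rewrite hz ltnn.
have [z0 hz0] : exists z0, d z0 = j.+1.
  have [z hz] := not_all_fin (m + j); apply: (@dcl_all m c z).
  by rewrite ltnNge; apply/negP => /P1.
have sp0 := S2 _ hz0.
rewrite addnS; split=> [z|z z' hz hz'].
  split=> [hz|].
    case: (pselect (Sp (m + j) z)) => [sz|/fin_nSp /(_ hz) /P1 /leqW //].
    have hr := Sp_uniq sp0 sz.
    case: (boolP (R (m + j).+1 z0 z)) => hr'.
      by rewrite -hz0 sep // hz0.
    have : fin (m + j) z0 by apply: fin_union hr hr' (S1 _ hz0) hz.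
    by move=> /P1; rewrite hz0 ltnn.
  rewrite leq_eqVlt => /orP[/eqP /S1 //|]; rewrite ltnS => /P1; exact: fin_S.
case: (leqP (d z) j) => hj.
  apply: nSp; last exact: P2.
  move=> sz; have hr := Sp_uniq sz sp0.
  by have := dcl_sep hj hr; rewrite hz0 ltnNge hj.
have hzj : d z = j.+1 by apply/eqP; rewrite eqn_leq hz hj.
have hr := Sp_uniq (S2 _ hzj) (S2 _ (etrans hz' hzj)).
apply: contrapT => /negP hr'.
have := fin_union hr hr' (S1 _ hzj) (S1 _ (etrans hz' hzj)).
by move=> /P1; rewrite hzj ltnn.
Qed.

Lemma core_Ri z z' : Ri z z' <-> d z = d z'.
Proof.
split=> [h|h].
  apply/eqP; rewrite eqn_leq.
  have h1 i : R (m + i) z z' by apply: Ri_R.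
  by rewrite (dcl_sep (leqnn _) (h1 _)) (dcl_sep (leqnn _)) // R_sym.
apply/asboolP => n; have [_ H] := core_levels (maxn (d z) n).
apply: (R_le (n := m + maxn (d z) n)); first by rewrite (leq_trans (leq_maxr (d z) n)) ?leq_addl.
by apply: H; rewrite ?leq_maxl.
Qed.

Lemma core_surj i : exists z, d z = i.
Proof.
have [P1 _] := core_levels i; have [z hz] := not_all_fin (m + i).
by apply: (@dcl_all m c z); rewrite ltnW // ltnNge; apply/negP => /P1.
Qed.

(** The split following step m + j cuts off exactly level [j.+1]. The special class has only two
    halves, so its vertices beyond that level stay together. *)
Lemma core_tail j z z' : j < d z -> j < d z' -> R m z z' -> R (m + j) z z'.
Proof.
elim: j => [|j IH] hz hz' hr; first by rewrite addn0.
have {IH}hj := IH (ltnW hz) (ltnW hz') hr.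
have [P1 _] := core_levels j; have [P1' _] := core_levels j.+1.
rewrite addnS in P1' *; apply: contrapT => /negP hn.
have sz : Sp (m + j) z by exists z'.
have [z0 hz0] := core_surj j.+1.
have s0 : Sp (m + j) z0.
  apply: contrapT => H; have /P1 : fin (m + j) z0.
    apply: (fin_nSp H); apply/(P1' z0).
    by rewrite hz0.
  by rewrite hz0 ltnn.
have far w : j.+1 < d w -> ~~ R (m + j).+1 z0 w.
  move=> hw; apply/negP; rewrite -addnS => hr'.
  have := dcl_sep (_ : d z0 <= j.+1) hr'; rewrite hz0 => /(_ (leqnn _)).
  by rewrite leqNgt hw.
have h1 := Sp_uniq s0 sz.
by move: hn; rewrite (Sp_two h1 (R_trans h1 hj)) // far.
Qed.

(** The split that produces step m cuts off only C, which is level 0. *)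
Lemma core_pred m' z z' : m = m'.+1 -> 0 < d z -> 0 < d z' -> R m' z z' -> R m z z'.
Proof.
move=> mE hz hz' hr; apply: contrapT => /negP hn.
have sz : Sp m' z by exists z'; rewrite -?mE.
have sc : Sp m' c by apply: core_Sp => //; case: Hc.
have far w : 0 < d w -> ~~ R m'.+1 c w.
  by move=> hw; apply/negP; rewrite -mE => /dcl0 h; rewrite h in hw.
have h1 := Sp_uniq sc sz.
by move: hn; rewrite mE (Sp_two h1 (R_trans h1 hr)) // far.
Qed.

(** A class other than C meets infinitely many orbits, and each level is a single orbit. *)
Lemma core_inf z L : 0 < d z -> exists2 w, R m z w & L <= d w.
Proof.
move=> hz; apply: contrapT => hn.
suff /core_fin /dcl0 h : fin m z by rewrite h in hz.
pose v i := projT1 (cid (core_surj i)).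
have vP i : d (v i) = i by rewrite /v; case: cid.
exists (map v (iota 0 L)) => w hw; exists (v (d w)); last by apply/core_Ri; rewrite vP.
apply: map_f; rewrite mem_iota /= ltnNge; apply/negP => h.
by apply: hn; exists w.
Qed.

End Core.

End Struct.
Arguments dcl {V e k A} phi eT eR n z x : simpl never.

(** * Quotients with level functions *)

Section Quot.
Variables (V : choiceType) (e : rel V) (k : nat).
Hypotheses (k2 : 2 <= k) (eT : is_tree e) (eR : regular e k).
Local Notation dist := (dist eT).
Local Notation nb := (nb eR).

Lemma card_nb (P : pred V) x n : count P (nb x) = n <-> ([set y | e x y /\ P y] #= `I_n)%card.
Proof.
have H m : count P (nb x) = m -> ([set y | e x y /\ P y] #= `I_m)%card.
  move=> hc; have -> : [set y | e x y /\ P y] = [set` filter P (nb x)].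
    apply/seteqP; split=> y /=; rewrite mem_filter mem_nb.
      by move=> [-> ->].
    by move=> /andP[-> ->].
  rewrite -hc -size_filter; apply/card_set_bijP; exists (fun y => index y (filter P (nb x))); split.
  - by move=> y /= hy; rewrite index_mem.
  - move=> y z; rewrite !inE /= => hy hz h.
    by rewrite -(nth_index y hy) h nth_index.
  - move=> i /= hi; exists (nth x (filter P (nb x)) i); first by rewrite /= mem_nth.
    by rewrite index_uniq // filter_uniq ?nb_uniq.
split=> [|h]; first exact: H.
by have h' := H _ erefl; apply/card_eq_II/card_eq_trans; [apply: card_esym h'|apply: h].
Qed.

(** * Quotients by a group transitive on the edges between two orbits *)

Variable (q : rel V) (G : set (V -> V)).
Hypotheses (qeq : equivalence_rel q) (Gg : automorphism_group e G)
  (GO : forall x y, q x y <-> exists2 g, G g & g x = y)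
  (GE : forall x y x1 y1, q x y -> e x x1 -> e y y1 -> q x1 y1 -> exists g, [/\ G g, g x = y & g x1 = y1]).

Lemma q_refl x : q x x. Proof. by have /equivalence_relP [] := qeq. Qed.
Lemma q_sym x y : q x y = q y x.
Proof.
have /equivalence_relP [r t] := qeq.
by apply/idP/idP => h; [rewrite -(t _ _ h)|rewrite -(t _ _ h)]; rewrite r.
Qed.
Lemma q_trans y x z : q x y -> q y z -> q x z.
Proof. by have /equivalence_relP [r t] := qeq => h; rewrite (t _ _ h). Qed.

Lemma q_nb x y z : q x y -> e x z -> exists2 w, e y w & q z w.
Proof.
move=> /GO [g gG <-] ez; exists (g z); last by apply/GO; exists g.
by have [/(_ g gG) [_ ->]] := Gg.
Qed.

Definition cls x : set V := [set y | q x y].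

Lemma orbitE x : vertex_orbit G x = cls x.
Proof. by apply/seteqP; split=> y /= => [[g gG <-]|/GO [g gG <-]]; [apply/GO; exists g|exists g]. Qed.

Lemma edge_orbit_sub (g : V -> V) (S : set V) : G g -> edge_orbit G (g @` S) `<=` edge_orbit G S.
Proof.
move=> gG _ [h hG <-]; exists (h \o g); first by have [_ _ H _] := Gg; apply: H.
by rewrite image_comp.
Qed.

Lemma edge_orbit_eq (g : V -> V) (S : set V) : G g -> edge_orbit G (g @` S) = edge_orbit G S.
Proof.
move=> gG; apply/seteqP; split; first exact: edge_orbit_sub.
have [_ _ _ /(_ g gG) [h [hG gh hg]]] := Gg.
have {1}-> : S = h @` (g @` S).
  rewrite image_comp; have -> : h \o g = id by apply/funext => z /=; rewrite gh.
  by rewrite image_id.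
exact: edge_orbit_sub.
Qed.

Lemma edge_orbit_q x y a b : q x a -> q y b -> e x y -> e a b ->
  edge_orbit G [set x; y] = edge_orbit G [set a; b].
Proof.
move=> qa qb exy eab; have [g [gG <- <-]] := GE qa exy eab qb.
by rewrite -(@edge_orbit_eq g) // image_setU !image_set1.
Qed.

Definition adj x y := exists x' y', [/\ q x x', q y y' & e x' y'].

Lemma no_edgeP x y : ~ adj x y -> no_edge e G (cls x) (cls y).
Proof. by move=> h; apply/seteqP; split=> // E [a [b [ha hb eab _]]]; case: h; exists a, b. Qed.

Lemma adj_no_edge x y : no_edge e G (cls x) (cls y) -> ~ adj x y.
Proof.
move=> h [a [b [ha hb eab]]].
have : quotient_edges e G (cls x) (cls y) (edge_orbit G [set a; b]) by exists a, b.
by rewrite h.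
Qed.

Lemma unique_edgeP x y : adj x y -> unique_edge e G (cls x) (cls y).
Proof.
move=> [a [b [ha hb eab]]]; exists (edge_orbit G [set a; b]); apply/seteqP; split=> E.
  move=> [a' [b' [ha' hb' eab' ->]]] /=; apply: edge_orbit_q => //.
    by apply: q_trans ha; rewrite q_sym.
  by apply: q_trans hb; rewrite q_sym.
by move=> ->; exists a, b.
Qed.

Lemma adj_unique_edge x y : unique_edge e G (cls x) (cls y) -> adj x y.
Proof.
move=> [E hE]; have : quotient_edges e G (cls x) (cls y) E by rewrite hE.
by move=> [a [b [ha hb eab _]]]; exists a, b.
Qed.

(** All edges between the two orbits lie in one edge orbit, so the index counts every neighbour in
    the orbit of [y]. *)
Lemma index_toP x y n : adj x y ->
  index_to e G (cls x) (cls y) n <-> (forall a, q x a -> count (q y) (nb a) = n).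
Proof.
move=> hadj.
have H E a : quotient_edges e G (cls x) (cls y) E -> q x a ->
    [set z | [/\ e a z, cls y z & edge_orbit G [set a; z] = E]] = [set z | e a z /\ q y z].
  move=> [u [v [hu hv euv ->]]] ha; apply/seteqP; split=> z /= => [[]//|[h1 h2]].
  split=> //; apply: edge_orbit_q => //.
    by apply: q_trans hu; rewrite q_sym.
  by apply: q_trans hv; rewrite q_sym.
split=> [h a ha|h E hE a ha].
  have [u [v [hu hv euv]]] := hadj.
  have hE : quotient_edges e G (cls x) (cls y) (edge_orbit G [set u; v]) by exists u, v.
  by apply/card_nb; have := h _ hE a ha; rewrite H.
by rewrite (H _ _ hE ha); apply/card_nb; apply: h.
Qed.

Section Lev.
Variable d : V -> nat.
Hypotheses (dq : forall x y, q x y <-> d x = d y) (dsurj : forall i, exists x, d x = i)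
  (dnb : forall x y, e x y -> d y <= (d x).+1).

Lemma lev_clsE x i : d x = i -> cls x = [set y | d y = i].
Proof. by move=> <-; apply/seteqP; split=> y /= h; [apply/esym/dq|apply/dq]. Qed.

Hypothesis dpred : forall x i, d x = i.+1 -> exists2 y, e x y & d y = i.

Lemma lev_adjS x y : d y = (d x).+1 -> adj x y.
Proof.
move=> h; have [z ez hz] := dpred h; exists z, y; split; first by apply/dq.
  exact: q_refl.
by rewrite (tree_sym eT).
Qed.

Lemma lev_adj x y : adj x y -> d y <= (d x).+1 /\ d x <= (d y).+1.
Proof.
move=> [a [b [/dq -> /dq -> eab]]]; split; apply: dnb => //.
by rewrite (tree_sym eT).
Qed.

Lemma adj_sym x y : adj x y -> adj y x.
Proof. by move=> [a [b [h1 h2 h3]]]; exists b, a; rewrite (tree_sym eT). Qed.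

Lemma lev_ray : ray_with_loops e G (fun i => [set x | d x = i]).
Proof.
have H i : exists2 x, d x = i & [set y | d y = i] = cls x.
  have [x hx] := dsurj i; exists x; [by []|exact/esym/lev_clsE].
split.
- move=> i j hij; have [x hx] := dsurj i.
  have : [set y | d y = j] x by rewrite -hij.
  by move=> /= <-.
- apply/seteqP; split=> [_ [i _ <-]|_ [x _ <-]].
    by have [x hx ->] := H i; exists x => //; rewrite orbitE.
  by exists (d x) => //; rewrite orbitE (lev_clsE erefl).
- move=> i; have [x hx ->] := H i; have [y hy ->] := H i.+1.
  by apply/unique_edgeP/lev_adjS; rewrite hx hy.
- move=> i; have [x hx ->] := H i.
  by case: (pselect (adj x x)) => h; [right; apply: unique_edgeP|left; apply: no_edgeP].
- move=> i j h1 h2 h3; have [x hx ->] := H i; have [y hy ->] := H j.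
  by apply: no_edgeP => /lev_adj; rewrite hx hy; lia.
Qed.

(* The local form of the two graphs of the theorem; a neighbour of level 0 of a
   vertex of level 0 is the loop. *)
Definition cusp_lev :=
  (forall z, 0 < d z -> count (fun w => d w == (d z).-1) (nb z) = 1 /\
                        count (fun w => d w == (d z).+1) (nb z) = k.-1) /\
  (forall z, d z = 0 -> count (fun w => d w == 0) (nb z) <= 1).

Lemma lev_count x y : count (q y) (nb x) = count (fun w => d w == d y) (nb x).
Proof. by apply: eq_count => w; apply/idP/eqP => [/dq //|h]; apply/dq. Qed.

Lemma count_pos x : 0 < d x -> count (fun w => d w == (d x).-1) (nb x) +
  count (fun w => d w == d x) (nb x) + count (fun w => d w == (d x).+1) (nb x) = k.
Proof.
move=> hx; rewrite -[RHS](size_nb (eR := eR) x).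
have : {in nb x, forall w, d w <= (d x).+1 /\ d x <= (d w).+1}.
  by move=> w; rewrite mem_nb => h; split; apply: dnb; rewrite // (tree_sym eT).
elim: (nb x) => //= w s IH hs.
have [|h1 h2] := hs w; first exact: mem_head.
rewrite -IH => [|u us]; last by apply: hs; rewrite inE us orbT.
by case: eqP => e1; case: eqP => e2; case: eqP => e3; lia.
Qed.

Lemma count_zero x : d x = 0 -> count (fun w => d w == 0) (nb x) + count (fun w => d w == 1) (nb x) = k.
Proof.
move=> hx; rewrite -[RHS](size_nb (eR := eR) x).
have : {in nb x, forall w, d w <= 1} by move=> w; rewrite mem_nb => /dnb; rewrite hx.
elim: (nb x) => //= w s IH hs.
have h1 := hs w (mem_head _ _).
rewrite -IH => [|u us]; last by apply: hs; rewrite inE us orbT.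
by case: eqP => e1; case: eqP => e2; lia.
Qed.

Lemma count_levels (P : pred nat) x : 0 < d x -> count (fun w => P (d w)) (nb x) =
  P (d x).-1 * count (fun w => d w == (d x).-1) (nb x) + P (d x) * count (fun w => d w == d x) (nb x)
  + P (d x).+1 * count (fun w => d w == (d x).+1) (nb x).
Proof.
move=> hx; have : {in nb x, forall w, d w <= (d x).+1 /\ d x <= (d w).+1}.
  by move=> w; rewrite mem_nb => h; split; apply: dnb; rewrite // (tree_sym eT).
elim: (nb x) => [|w s IH] hs /=; first by rewrite !muln0.
have [|h1 h2] := hs w; first exact: mem_head.
rewrite IH => [|u us]; last by apply: hs; rewrite inE us orbT.
have [h|[h|h]] : d w = (d x).-1 \/ d w = d x \/ d w = (d x).+1 by lia.
- have -> : (d w == d x) = false by lia.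
  have -> : (d w == (d x).+1) = false by lia.
  by rewrite h eqxx !mulnDr muln1 muln0 !add0n !addnA.
- have -> : (d w == (d x).-1) = false by lia.
  have -> : (d w == (d x).+1) = false by lia.
  by rewrite h eqxx !mulnDr muln1 !muln0 !add0n; lia.
- have -> : (d w == (d x).-1) = false by lia.
  have -> : (d w == d x) = false by lia.
  by rewrite h eqxx !mulnDr muln1 !muln0 !add0n; lia.
Qed.

Lemma adj_count x y : adj x y <-> 0 < count (q y) (nb x).
Proof.
rewrite -has_count; split=> [[a [b [ha hb eab]]]|/hasP [b]].
  have [|w ew hw] := q_nb (_ : q a x) eab; first by rewrite q_sym.
  by apply/hasP; exists w; [rewrite mem_nb|apply: q_trans hw].
by rewrite mem_nb => h1 h2; exists x, b; rewrite q_refl.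
Qed.

Lemma cusp_levP : cusp_lev -> looped_cusp e k.-1 G \/ loopless_cusp e k.-1 G.
Proof.
move=> [h1 h0].
have H i : exists2 x, d x = i & [set y | d y = i] = cls x.
  have [x hx] := dsurj i; exists x; [by []|exact/esym/lev_clsE].
have noloop i : 0 < i -> no_edge e G [set x | d x = i] [set x | d x = i].
  move=> hi; have [x hx ->] := H i; apply: no_edgeP => /adj_count; rewrite lev_count.
  rewrite -hx in hi; have := count_pos hi; have [-> ->] := h1 _ hi; lia.
have up i : 0 < i -> index_to e G [set x | d x = i] [set x | d x = i.+1] k.-1.
  move=> hi; have [x hx ->] := H i; have [y hy ->] := H i.+1.
  apply/index_toP; first by apply: lev_adjS; rewrite hx hy.
  move=> a /dq ha; rewrite lev_count hy -hx ha.
  by case: (h1 a); rewrite // -ha hx.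
have down i : index_to e G [set x | d x = i.+1] [set x | d x = i] 1.
  have [x hx ->] := H i.+1; have [y hy ->] := H i.
  apply/index_toP; first by apply/adj_sym/lev_adjS; rewrite hx hy.
  move=> a /dq ha; rewrite lev_count hy.
  by have [] := h1 a; rewrite -ha hx.
have [x0 hx0 E0] := H 0; have [x1 hx1 E1] := H 1.
have a01 : adj x0 x1 by apply: lev_adjS; rewrite hx0 hx1.
(* Zero or one neighbour of level 0 at level 0: this decides between the graph without a loop, where
   all k edges at [v 0] go up, and the graph with one. *)
have := h0 _ hx0; case En : (count _ _) => [|[|//]] _; [right|left]; exists (fun i => [set x | d x = i]).
- split=> //; first exact: lev_ray.
  + case=> [|i]; last exact: noloop.
    by rewrite E0; apply: no_edgeP => /adj_count; rewrite lev_count hx0 En.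
  + rewrite E0 E1; apply/index_toP => // a ha; rewrite lev_count hx1 prednK; last by lia.
    have hb : count (q x0) (nb a) = 0.
      apply/eqP; rewrite -leqn0 leqNgt; apply/negP => /adj_count [u [v [hu hv euv]]].
      have : adj x0 x0 by exists u, v; split=> //; apply: q_trans ha hu.
      by move/adj_count; rewrite lev_count hx0 En.
    move/dq: ha; rewrite hx0 => ha; have := count_zero (esym ha).
    by move: hb; rewrite lev_count hx0 => ->.
- have a00 : adj x0 x0 by apply/adj_count; rewrite lev_count hx0 En.
  split=> //; first exact: lev_ray.
  + by rewrite E0; apply: unique_edgeP.
  + case=> [|i]; last exact: up.
    rewrite E0 E1; apply/index_toP => // a ha; rewrite lev_count hx1.
    have ha' : d a = 0 by rewrite -hx0; symmetry; apply/dq.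
    have : 0 < count (q x0) (nb a).
      apply/adj_count; have [u [v [hu hv euv]]] := a00; exists u, v; split=> //.
      by apply: q_trans hu; rewrite q_sym.
    have := count_zero ha'; have := h0 _ ha'; rewrite lev_count hx0; lia.
Qed.

End Lev.

Lemma cusp_lev_ex : looped_cusp e k.-1 G \/ loopless_cusp e k.-1 G ->
  exists d : V -> nat, [/\ forall x y, q x y <-> d x = d y, forall i, exists x, d x = i,
    forall x y, e x y -> d y <= (d x).+1 & cusp_lev d].
Proof.
move=> hc.
(* The common content of the two graphs. At [v 0] either alternative of the last clause leaves at
   most one neighbour of level 0. *)
have [v [vr hup hdown h01]] : exists v, [/\ ray_with_loops e G v,
    forall i, 0 < i -> no_edge e G (v i) (v i) /\ index_to e G (v i) (v i.+1) k.-1,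
    forall i, index_to e G (v i.+1) (v i) 1 & index_to e G (v 0) (v 1) k.-1 \/ no_edge e G (v 0) (v 0)].
  case: hc => [[v [h1 h2 h3 h4 h5]]|[v [h1 h2 h3 h4 h5]]]; exists v; split=> //; try by [left|right].
  - by move=> i hi; split; [apply: h3|apply: h4].
  - by move=> i hi; split; [apply: h2|apply: h4].
have [vi vq ve vl vn] := vr.
have vex x : exists i, v i x.
  have : quotient_vertices G (vertex_orbit G x) by exists x.
  by rewrite -vq => [[i _ hi]]; exists i; rewrite hi orbitE; apply: q_refl.
have vcls i x : v i x -> v i = cls x.
  have : quotient_vertices G (v i) by rewrite -vq; exists i.
  move=> [y _ <-]; rewrite orbitE => hyx; apply/seteqP; split=> z /= hz.
    by apply: q_trans hz; rewrite q_sym.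
  exact: q_trans hz.
pose d x := projT1 (cid (vex x)).
have dP x : v (d x) x by rewrite /d; case: cid.
have dv x i : v i x -> d x = i.
  by move=> h; apply: vi; rewrite (vcls _ _ h) (vcls _ _ (dP x)).
have dq x y : q x y <-> d x = d y.
  split=> [h|h]; last by have := dP y; rewrite -h (vcls _ _ (dP x)).
  by symmetry; apply: dv; rewrite (vcls _ _ (dP x)).
have vne i : exists x, v i x.
  have : quotient_vertices G (v i) by rewrite -vq; exists i.
  by move=> [y _ <-]; exists y; rewrite orbitE; apply: q_refl.
have dsurj i : exists x, d x = i by have [x hx] := vne i; exists x; apply: dv.
have dnb x y : e x y -> d y <= (d x).+1.
  move=> exy; rewrite leqNgt; apply/negP => hlt.
  have : no_edge e G (v (d x)) (v (d y)) by apply: vn; lia.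
  rewrite (vcls _ _ (dP x)) (vcls _ _ (dP y)) => /adj_no_edge; apply.
  by exists x, y; split=> //; apply: q_refl.
exists d; split=> //.
have cnt x y : count (q y) (nb x) = count (fun w => d w == d y) (nb x) by apply: lev_count.
have ix i j n x : index_to e G (v i) (v j) n -> unique_edge e G (v i) (v j) -> v i x ->
    count (fun w => d w == j) (nb x) = n.
  move=> h u hx; have [y hy] := vne j; rewrite (vcls _ _ hx) (vcls _ _ hy) in h u.
  have ha := adj_unique_edge u.
  have := (index_toP _ ha).1 h x (q_refl x).
  by rewrite cnt (dv _ _ hy).
have ve' i : unique_edge e G (v i.+1) (v i).
  have := ve i; have [x hx] := vne i; have [y hy] := vne i.+1.
  by rewrite (vcls _ _ hx) (vcls _ _ hy) => /adj_unique_edge /adj_sym /unique_edgeP.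
split=> [z hz|z hz].
  case Ez : (d z) hz => [//|i] _; have hv : v i.+1 z by rewrite -Ez.
  by split; [apply: ix (hdown i) (ve' i) hv|apply: ix (hup i.+1 isT).2 (ve i.+1) hv].
have hvz : v 0 z by rewrite -hz.
have := count_zero dnb hz; case: h01 => [h|h].
  by rewrite (ix _ _ _ _ h (ve 0) hvz); lia.
have : ~ adj z z by apply: adj_no_edge; rewrite -(vcls _ _ hvz).
move/adj_count; rewrite cnt hz => /negP; rewrite -eqn0Ngt => /eqP ->.
by lia.
Qed.

End Quot.

(** * Rays and lines *)

Section Line.
Import GRing.Theory.
Variables (V : choiceType) (e : rel V) (k : nat).
Hypotheses (k2 : 2 <= k) (eT : is_tree e) (eR : regular e k).
Variable (q : rel V) (G : set (V -> V)).
Hypotheses (qeq : equivalence_rel q) (Gg : automorphism_group e G)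
  (GO : forall x y, q x y <-> exists2 g, G g & g x = y)
  (GE : forall x y x1 y1, q x y -> e x x1 -> e y y1 -> q x1 y1 -> exists g, [/\ G g, g x = y & g x1 = y1]).
Hypotheses (deg : forall x y1 y2 y3, e x y1 -> e x y2 -> e x y3 -> ~~ q x y1 -> ~~ q x y2 -> ~~ q x y3 ->
   ~~ q y1 y2 -> ~~ q y1 y3 -> ~~ q y2 y3 -> False)
  (inf : forall l : seq V, exists z, forall r, r \in l -> ~~ q r z).

Let qr := q_refl qeq.
Let qs := q_sym qeq.
Let qt := @q_trans V q qeq.
Let qnb := q_nb Gg GO.

(** The distance to the orbit of [x0] is the level. By induction each level is one orbit: above
    level 0 this is the assumption on [x0], and a vertex of higher level already has a neighbour
    below, so by [deg] it has at most one orbit above. *)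
Lemma ray_end x0 : (forall y1 y2, e x0 y1 -> e x0 y2 -> ~~ q x0 y1 -> ~~ q x0 y2 -> q y1 y2) -> is_ray e G.
Proof.
move=> hend; pose d := dto (eT := eT) (qr x0).
have dle z z' : q z z' -> d z' <= d z.
  move En : (d z) => i; elim: i z z' En => [|i IH] z z' hz hq.
    by rewrite leqn0; apply/eqP/dto0; apply: qt hq; apply/(dto0 eT (qr x0)).
  have [y ey hy] := dto_pred hz; have [y' ey' hq'] := qnb hq ey.
  have h := IH _ _ hy hq'; rewrite (tree_sym eT) in ey'.
  by apply: leq_trans (dto_nb eT (qr x0) ey') _.
have dP z z' : d z = d z' -> q z z'.
  move En : (d z) => i; elim: i z z' En => [|i IH] z z' hz /esym hz'.
    move/(dto0 eT (qr x0)): hz => hz; move/(dto0 eT (qr x0)): hz' => hz'; apply: qt hz'.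
    by rewrite qs.
  have [y ey hy] := dto_pred hz; have [y' ey' hy'] := dto_pred hz'.
  have hq' : q y' y by apply: IH.
  rewrite (tree_sym eT) in ey; rewrite (tree_sym eT) in ey'.
  have [w ew hw] := qnb hq' ey'.
  have dw : d w = i.+1 by apply/eqP; rewrite eqn_leq -{1}hz' dle //= -hz' dle // qs.
  have nd a b : d a != d b -> ~~ q a b.
    by apply: contraNN => hab; rewrite eqn_leq !dle // qs.
  suff hzw : q z w by apply: qt hzw _; rewrite qs.
  case: i {IH} hz hz' hy hy' dw => [|i] hz hz' hy hy' dw.
    have hx : q y x0 by rewrite qs; apply/(dto0 eT (qr x0)).
    have [z1 ez1 hz1] := qnb hx ey; have [w1 ew1 hw1] := qnb hx ew.
    have hz1w1 : q z1 w1.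
      have d0 : d x0 = 0 by apply/(dto0 eT (qr x0)); apply: qr.
      apply: hend => //; apply: nd; rewrite d0 eq_sym -lt0n.
        by rewrite (leq_trans _ (dle z1 z _)) ?hz // qs.
      by rewrite (leq_trans _ (dle w1 w _)) ?dw // qs.
    by apply: qt hz1 (qt hz1w1 _); rewrite qs.
  have [u eu hu] := dto_pred hy.
  apply: contrapT => /negP nzw.
  have {}hu : d u = i by []. have {}hy : d y = i.+1 by [].
  by apply: (deg eu ey ew) => //; apply: nd; rewrite ?hy ?hz ?hu ?dw; lia.
have dq z z' : q z z' <-> d z = d z'.
  by split=> [h|]; [apply/eqP; rewrite eqn_leq !dle // qs|apply: dP].
have dsurj i : exists z, d z = i.
  pose v j := xget x0 [set z | d z = j].
  have [z hz] := inf (map v (iota 0 i)).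
  apply: (@dto_all _ _ eT _ _ (qr x0) z); rewrite leqNgt; apply/negP => hlt.
  have : v (d z) \in map v (iota 0 i) by apply: map_f; rewrite mem_iota.
  move=> /hz /negP; apply; apply/dq; rewrite /v.
  by case: xgetP => [y _ //|h]; case: (h z).
exists (fun i => [set x | d x = i]); apply: (lev_ray k2 eT qeq Gg GO GE dq dsurj).
- by move=> x y; apply: dto_nb.
- by move=> x i; apply: dto_pred.
Qed.

(** A two-sided walk that always leaves the orbits of its last two vertices exists. By [deg] its
    orbits are closed under adjacency, and they are distinct since the quotient is infinite. *)
Lemma line_noend (x0 : V) : (forall x, exists y1 y2, [/\ e x y1, e x y2, ~~ q x y1, ~~ q x y2 & ~~ q y1 y2]) -> is_line e G.
Proof.
move=> hno.
have [nxt nxtP] : exists nxt : V -> V -> V, forall p x, [/\ e x (nxt p x), ~~ q x (nxt p x) & ~~ q p (nxt p x)].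
  have H (a : V * V) : exists y, [/\ e a.2 y, ~~ q a.2 y & ~~ q a.1 y].
    have [y1 [y2 [e1 e2 n1 n2 n12]]] := hno a.2.
    case: (boolP (q a.1 y1)) => h; last by exists y1.
    exists y2; split=> //; apply: contraNN n12 => h2; apply: qt h2; by rewrite qs.
  exists (fun p x => projT1 (cid (H (p, x)))) => p x; by case: cid.
have [a1 [b1 [ea eb na nb nab]]] := hno x0.
(* The state is the pair of the last two vertices. Started from [x0] towards [a1] and towards [b1],
   the walk gives the two halves of [w]. *)
pose it y := fix it n := if n is n'.+1 then (let: (p, x) := it n' in (x, nxt p x)) else (x0, y).
pose f y n := (it y n).1.
have it2 y n : (it y n).2 = f y n.+1 by rewrite /f /=; case: (it y n).
have fS y n : f y n.+2 = nxt (f y n) (f y n.+1).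
  by rewrite -[in RHS]it2 /f /=; case: (it y n).
have f0 y : f y 0 = x0 by []. have f1 y : f y 1 = y by [].
clearbody f; clear it it2.
have fe y n : e x0 y -> e (f y n) (f y n.+1).
  by case: n => [|n] h; [rewrite f0 f1|rewrite fS; case: (nxtP (f y n) (f y n.+1))].
have fn y n : ~~ q x0 y -> ~~ q (f y n) (f y n.+1).
  by case: n => [|n] h; [rewrite f0 f1|rewrite fS; case: (nxtP (f y n) (f y n.+1))].
have fn2 y n : ~~ q (f y n) (f y n.+2) by rewrite fS; case: (nxtP (f y n) (f y n.+1)).
pose w (i : int) := match i with Posz n => f a1 n | Negz n => f b1 n.+1 end.
have wneg n : w (- (Posz n))%R = f b1 n.
  by case: n => [|n]; [rewrite /= !f0|rewrite -NegzE].
have wpos n : w (Posz n) = f a1 n by [].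
have cases (i : int) : (exists n : nat, i = (Posz n)) \/ (exists n : nat, i = (- (Posz (n.+2)))%R) \/ i = (-1)%R.
  case: i => n; first by left; exists n.
  by case: n => [|n]; right; [right|left; exists n; rewrite NegzE].
have Z1 (a b : int) : a = b -> w a = w b by move=> ->.
have W1 i : e (w i) (w (i + 1)%R).
  case: (cases i) => [[n hi]|[[n hi]|hi]].
  - rewrite (Z1 (i + 1)%R (Posz n.+1)) ?hi; [exact: fe|lia].
  - rewrite (Z1 (i + 1)%R (- (Posz n.+1))%R); last by lia.
    by rewrite hi !wneg (tree_sym eT); apply: fe.
  - rewrite (Z1 (i + 1)%R (Posz 0)) ?(Z1 i (- Posz 1)%R); [|lia|lia].
    by rewrite wneg f1 /w f0 (tree_sym eT).
have W2 i : ~~ q (w i) (w (i + 1)%R).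
  case: (cases i) => [[n hi]|[[n hi]|hi]].
  - rewrite (Z1 (i + 1)%R (Posz n.+1)) ?hi; [exact: fn|lia].
  - rewrite (Z1 (i + 1)%R (- (Posz n.+1))%R); last by lia.
    by rewrite hi !wneg qs; apply: fn.
  - rewrite (Z1 (i + 1)%R (Posz 0)) ?(Z1 i (- Posz 1)%R); [|lia|lia].
    by rewrite wneg f1 /w f0 qs.
have W3 i : ~~ q (w (i - 1)%R) (w (i + 1)%R).
  case: (cases i) => [[[|n] hi]|[[n hi]|hi]].
  - rewrite (Z1 (i + 1)%R (Posz 1)) ?(Z1 (i - 1)%R (- Posz 1)%R); [|lia|lia].
    by rewrite wneg /w !f1 qs.
  - rewrite (Z1 (i + 1)%R (Posz n.+2)) ?(Z1 (i - 1)%R (Posz n)); [|lia|lia].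
    exact: fn2.
  - rewrite (Z1 (i + 1)%R (- Posz n.+1)%R) ?(Z1 (i - 1)%R (- Posz n.+3)%R); [|lia|lia].
    by rewrite !wneg qs; apply: fn2.
  - rewrite (Z1 (i + 1)%R (- Posz 0)%R) ?(Z1 (i - 1)%R (- Posz 2)%R); [|lia|lia].
    by rewrite !wneg qs; apply: fn2.
have W1' i : e (w i) (w (i - 1)%R).
  by have := W1 (i - 1)%R; rewrite subrK (tree_sym eT).
have W2' i : ~~ q (w i) (w (i - 1)%R).
  by have := W2 (i - 1)%R; rewrite subrK qs.
have W4 i x z : q (w i) x -> e x z -> [\/ q (w i) z, q (w (i + 1)%R) z | q (w (i - 1)%R) z].
  move=> hx ez; rewrite qs in hx; have [z' ez' hz'] := qnb hx ez.
  rewrite qs in hz'.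
  have H u : q u z' -> q u z by move=> h; apply: qt hz'.
  case: (boolP (q (w i) z')) => h0; first by constructor 1; apply: H.
  case: (boolP (q (w (i + 1)%R) z')) => h1; first by constructor 2; apply: H.
  case: (boolP (q (w (i - 1)%R) z')) => h2; first by constructor 3; apply: H.
  by case: (deg (W1 i) (W1' i) ez' (W2 i) (W2' i) h0 _ h1 h2); rewrite qs.
(* A nonempty interval of positions whose orbits are closed under adjacency would cover the tree by
   finitely many orbits. *)
have notfin (i : int) (n : nat) : (forall x z, (exists2 j : nat, j < n & q (w (i + (Posz j))%R) x) -> e x z ->
    exists2 j : nat, j < n & q (w (i + (Posz j))%R) z) -> n = 0.
  move=> hcl; case: n hcl => // n hcl; exfalso.
  have [z hz] := inf (map (fun j : nat => w (i + (Posz j))%R) (iota 0 n.+1)).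
  suff [j jn hj] : exists2 j : nat, j < n.+1 & q (w (i + (Posz j))%R) z.
    have : w (i + (Posz j))%R \in map (fun j : nat => w (i + (Posz j))%R) (iota 0 n.+1).
      by apply: (map_f (fun j : nat => w (i + (Posz j))%R)); rewrite mem_iota.
    by move/hz; rewrite hj.
  apply: (conn_ind eT (P := fun x => exists2 j : nat, j < n.+1 & q (w (i + (Posz j))%R) x) _ hcl (x := w i)).
  by exists 0 => //; rewrite addr0.
(* If positions at distance [n] coincide and none at smaller distance do, the [n] orbits in between
   close up to a cycle, against [notfin]. *)
have winj0 (n : nat) i : 0 < n -> ~~ q (w i) (w (i + (Posz n))%R).
  elim/ltn_ind: n i => n IH i n0; apply/negP => hq.
  have n1 : n != 1 by apply/eqP => h; move: (W2 i); rewrite h in hq; rewrite hq.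
  have n2 : n != 2.
    apply/eqP => h; move: (W3 (i + 1)%R); rewrite addrK -addrA.
    by have -> : (i + (1 + 1) = i + (Posz n))%R; [lia|rewrite hq].
  suff : n = 0 by lia.
  (* The orbits next to [w i] occur next to [w (i + n)]. That of [w (i + 1)] is not that of
     [w (i + n - 1)], by induction at distance n - 2, so [w (i - 1)] takes this place. *)
  have hend : q (w (i + (Posz (n.-1)))%R) (w (i - 1)%R).
    have hq' := hq; rewrite qs in hq'.
    have E1 : (i + (Posz n) - 1 = i + (Posz (n.-1)))%R by lia.
    have nbq (j : int) : e (w i) (w j) -> ~~ q (w i) (w j) ->
        q (w (i + (Posz n) + 1)%R) (w j) \/ q (w (i + (Posz (n.-1)))%R) (w j).
      move=> ej nj; have [u eu hu] := qnb hq ej; rewrite qs in hu.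
      case: (W4 _ _ _ (qr _) eu) => h; [|left|right; rewrite -E1].
      - by move: nj; rewrite (qt hq (qt h hu)).
      - exact: qt h hu.
      - exact: qt h hu.
    case: (nbq _ (W1' i) (W2' i)) => // ha.
    case: (nbq _ (W1 i) (W2 i)) => hb.
      by move: (W3 i); rewrite (qt (_ : q (w (i - 1)%R) _) hb) // qs.
    have : ~~ q (w (i + 1)%R) (w (i + 1 + (Posz (n - 2)))%R) by apply: IH; lia.
    have -> : (i + 1 + (Posz (n - 2)) = i + (Posz (n.-1)))%R; first by lia.
    by rewrite qs hb.
  apply: (notfin i) => x z [j jn hj] ez.
  case: (W4 _ _ _ hj ez) => h.
  - by exists j.
  - case: (ltngtP j.+1 n) => hjn; [|lia|].
      by exists j.+1 => //; have -> : (i + (Posz j.+1) = i + (Posz j) + 1)%R; first by lia.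
    exists 0; first by lia.
    rewrite addr0; apply: qt hq _; have -> // : (i + (Posz n) = i + (Posz j) + 1)%R by lia.
  - case: j jn hj h => [|j] jn hj h; last first.
      by exists j; [lia|]; have -> : (i + (Posz j) = i + (Posz j.+1) - 1)%R; first by lia.
    exists n.-1; first by lia.
    by rewrite addr0 in h; apply: qt hend h.
have winj i j : q (w i) (w j) -> i = j.
  move=> hq; apply: contrapT => nij; have [h|h] : (i < j \/ j < i)%R by lia.
    have := @winj0 (absz (j - i)%R) i; rewrite (Z1 (i + _)%R j) ?hq; last by lia.
    by move=> H; have : false by apply: H; lia.
  have := @winj0 (absz (i - j)%R) j; rewrite (Z1 (j + _)%R i) 1?qs ?hq; last by lia.
  by move=> H; have : false by apply: H; lia.
have wcov z : exists i, q (w i) z.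
  apply: (conn_ind eT (P := fun z => exists i, q (w i) z) (x := w 0)); first by exists 0%R; apply: qr.
  by move=> x y [i hi] /(W4 _ _ _ hi) [h|h|h]; eexists; apply: h.
exists (fun i => cls q (w i)); split.
- move=> i j hij; apply: winj; have : cls q (w j) (w j) by apply: qr.
  by rewrite -hij.
- apply/seteqP; split=> [_ [i _ <-]|_ [x _ <-]].
    by exists (w i) => //; rewrite (orbitE GO).
  have [i hi] := wcov x; exists i => //; rewrite (orbitE GO); apply/seteqP; split=> z /= h.
    by apply: qt h; rewrite qs.
  exact: qt hi h.
- by move=> i; apply: (unique_edgeP qeq Gg GE); exists (w i), (w (i + 1)%R); rewrite !qr W1.
- move=> i; case: (pselect (adj e q (w i) (w i))) => h.
    by right; apply: (unique_edgeP qeq Gg GE).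
  by left; apply: no_edgeP.
- move=> i j h1 h2 h3; apply: no_edgeP => [[x [z [hx hz exz]]]].
  rewrite qs in hz.
  case: (W4 _ _ _ hx exz) => h; have := winj _ _ (qt h hz); lia.
Qed.

Lemma ray_or_line : is_ray e G \/ is_line e G.
Proof.
case: (pselect (exists x0, forall y1 y2, e x0 y1 -> e x0 y2 -> ~~ q x0 y1 -> ~~ q x0 y2 -> q y1 y2)).
  by move=> [x0 hx0]; left; apply: ray_end hx0.
move=> hn; right; have [x0 _] := inf [::].
apply: (line_noend x0) => x; apply: contrapT => h; apply: hn; exists x => y1 y2 e1 e2 n1 n2.
by apply: contrapT => /negP n12; apply: h; exists y1, y2.
Qed.

End Line.

(** * Cones *)

Section Cone.
Variables (V : choiceType) (e : rel V) (k : nat).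
Hypotheses (k2 : 2 <= k) (eT : is_tree e) (eR : regular e k).
Local Notation dist := (dist eT).
Local Notation nb := (nb eR).
Local Notation par := (par eT).

Section Base.
Variable o : V.
Local Notation dep := (dist o).

(** The depth clause fixes [j], which the root, being its own parent, would leave free. *)
Definition cone z : set V := [set y | exists j, iter j (par o) y = z /\ dep y = j + dep z].

Lemma cone_refl z : cone z z. Proof. by exists 0. Qed.

Lemma cone_dep z y : cone z y -> dep z <= dep y.
Proof. by move=> [j [_ ->]]; apply: leq_addl. Qed.

Lemma dep_par y : y != o -> dep y = (dep (par o y)).+1.
Proof. by move=> /(parP (eT := eT)) []. Qed.

Lemma dep_pos y : 0 < dep y -> y != o.
Proof. by move=> h; apply: contraTneq h => ->; rewrite dist_xx. Qed.

Lemma cone_trans x y z : cone x y -> cone y z -> cone x z.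
Proof.
move=> [i [h1 h2]] [j [h3 h4]]; exists (i + j); rewrite iterD h3 h1; split=> //; lia.
Qed.

Lemma child_dep y w : e y w -> w <> par o y -> [/\ w != o, par o w = y & dep w = (dep y).+1].
Proof. by move=> eyw hw; case: (nb_cases eT o eyw) => [[_ /hw]|[]]. Qed.

Lemma cone_child z y w : cone z y -> e y w -> w <> par o y -> cone z w.
Proof.
move=> hc eyw /(child_dep eyw) [_ hw hd]; apply: cone_trans hc _.
by exists 1; rewrite /= hw hd.
Qed.

Lemma cone_par z y : cone z y -> y <> z -> cone z (par o y).
Proof.
move=> [[|j] [h1 h2]] nyz; first by case: nyz.
exists j; rewrite -iterSr h1; split=> //.
have := @dep_par y; rewrite dep_pos ?h2 // => /(_ isT).
lia.
Qed.

Lemma cone_iter j y : j <= dep y -> cone (iter j (par o) y) y /\ dep (iter j (par o) y) = dep y - j.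
Proof.
elim: j => [|j IH] hj; first by rewrite subn0; split=> //; apply: cone_refl.
have [h1 h2] := IH (ltnW hj).
have yo : iter j (par o) y != o by apply: dep_pos; rewrite h2; lia.
have hd := dep_par yo; split=> /=; last by lia.
by apply: cone_trans h1; exists 1; rewrite /= hd.
Qed.

Lemma cone_antisym x y : cone x y -> cone y x -> x = y.
Proof.
move=> h1 /cone_dep h2; case: h1 => [[|j] [h3 h4]]; first by rewrite -h3.
lia.
Qed.

Lemma cone_nb z y w : cone z y -> y <> z -> e y w -> cone z w.
Proof.
move=> hc hy eyw; case: (pselect (w = par o y)) => [->|]; first exact: cone_par.
exact: cone_child.
Qed.

Lemma cone_ball z y n w : cone z y -> dep z + n <= dep y -> dist y w <= n -> cone z w.
Proof.
move=> hc hn; move Ed : (dist y w) => d; elim: d w Ed => [|d IH] w Ed hd.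
  by rewrite -(dist_eq0 Ed).
have [w' ew' hw'] := dist_pred Ed.
have hcw := IH _ hw' (ltnW hd).
apply: cone_nb hcw _ _; last by rewrite (tree_sym eT).
move=> wz; have := dist_tri (eT := eT) w' o y; rewrite (dist_sym w' y) hw' wz; lia.
Qed.

(** The edge from [z] to its parent is the only way out of the cone. *)
Lemma cone_conn S z y y' : subtree e S -> S y -> cone z y -> S y' -> ~ cone z y' -> S z /\ S (par o z).
Proof.
move=> [_ hS] Sy hy Sy' hy'; have [p [hp hl hpS]] := hS _ _ Sy Sy'.
elim: p y Sy hy hp hl hpS => [|w p IH] y Sy hy /= hp hl hpS; first by rewrite hl in hy.
case/andP: hp => eyw hp.
have Sw : S w by apply: hpS; rewrite mem_head.
case: (pselect (cone z w)) => hw.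
  by apply: (IH w) => // u hu; apply: hpS; rewrite inE hu orbT.
have yz : y = z by apply: contrapT => h; apply: hw; apply: cone_nb hy h eyw.
subst y; split=> //.
by have <- : w = par o z by apply: contrapT => h; apply: hw; apply: cone_child hy eyw h.
Qed.

Lemma child_ex y : exists2 w, e y w & w <> par o y.
Proof.
have [u1 [u2 [e1 e2 n12]]] := two_nb k2 eR y.
case: (pselect (u1 = par o y)) => h; last by exists u1.
by exists u2 => // h2; apply: n12; rewrite h h2.
Qed.

Lemma cone_deep z n : exists2 y, cone z y & dep y = dep z + n.
Proof.
elim: n => [|n [y hy hd]]; first by exists z; [apply: cone_refl|rewrite addn0].
have [w ew hw] := child_ex y; exists w; first exact: cone_child hy ew hw.
by have [_ _ ->] := child_dep ew hw; rewrite hd addnS.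
Qed.

(** * Cones inside the pieces of a finite cover *)

Section Cover.
Variables (K : set V) (m : nat) (T_ : 'I_m -> set V).
Hypotheses (Kf : finite_set K) (Ts : forall i, subtree e (T_ i)) (Tc : ~` K = \bigcup_i T_ i).

Lemma subcone z : exists i y, cone z y /\ cone y `<=` T_ i.
Proof.
have [D hD] : exists D, forall x, K x -> dep x < D.
  have /finite_seqP [s hs] := Kf; exists (\max_(x <- s) (dep x)).+1 => x; rewrite hs /= => xs.
  by rewrite ltnS; apply: (@leq_bigmax_seq _ s xpredT dep).
have [z' hz' hd] := cone_deep z D.
suff [i [y [hy hyT]]] : exists i y, cone z' y /\ cone y `<=` T_ i.
  by exists i, y; split=> //; apply: cone_trans hy.
have H : forall x, cone z' x -> exists2 i, i \in enum 'I_m & T_ i x.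
  move=> x /cone_dep hx; have : (~` K) x by move=> /hD; lia.
  by rewrite Tc => [[i _ hi]]; exists i; rewrite // mem_enum.
elim: (enum 'I_m) z' {hd hz'} H => [|i s IH] z' H.
  by have [] := H z' (cone_refl z').
case: (pselect (exists2 y, cone z' y & T_ i y)) => [[y2 h2 t2]|hn]; last first.
  apply: IH => x hx; have [j] := H x hx; rewrite inE => /orP[/eqP ->|]; last by exists j.
  by move=> hT; case: hn; exists x.
case: (pselect (cone y2 `<=` T_ i)) => [h|]; first by exists i, y2.
move=> /existsNP [y3 /not_implyP [h3 n3]].
have [|j [y [hy hT]]] := IH y3.
  move=> x hx; have [|j] := H x; first exact: cone_trans h2 (cone_trans h3 hx).
  rewrite inE => /orP[/eqP -> tx|]; last by exists j.
  have hn : ~ cone y3 y2 by move=> h; apply: n3; rewrite -(cone_antisym h3 h).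
  by have [] := cone_conn (Ts i) tx hx t2 hn.
by exists j, y; split=> //; apply: cone_trans h2 (cone_trans h3 hy).
Qed.

(** By pigeonhole one piece [T_ j] contains subcones below arbitrarily deep vertices of [Th]. It
    also contains a fixed cone at [y1], so, being connected, it contains the ancestors of a deep [z]
    as long as they lie deeper than [y1]. *)
Lemma deep_chain (Th : V -> Prop) N : (forall D, exists2 z, Th z & D <= dep z) ->
  exists j y0 z, [/\ cone y0 `<=` T_ j, Th z, N < dep z & forall i, i <= N -> T_ j (iter i (par o) z)].
Proof.
move=> hTh; pose J j z := exists2 y, cone z y & cone y `<=` T_ j.
have [j hj] : exists j, forall D, exists z, [/\ Th z, D <= dep z & J j z].
  apply: contrapT => /forallNP hn.
  have hb j : exists D, forall z, Th z -> D <= dep z -> ~ J j z.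
    have /existsNP [D hD] := hn j; exists D => z h1 h2 h3; apply: hD; by exists z.
  pose D := \max_j projT1 (cid (hb j)).
  have [z tz hz] := hTh D; have [j [y [hy hT]]] := subcone z.
  have := projT2 (cid (hb j)) z tz; apply; last by exists y.
  by apply: leq_trans hz; apply: (@leq_bigmax _ (fun j => projT1 (cid (hb j)))).
have [z1 [_ _ [y1 h1 t1]]] := hj 0.
have [z [tz hz [y hy tY]]] := hj (dep y1 + N.+1).
exists j, y1, z; split=> //; first by lia.
move=> i hi; have [|hc hd] := @cone_iter i z; first by lia.
have [] // := @cone_conn _ (iter i (par o) z) y y1 (Ts j); try exact: cone_refl.
- by apply: tY; apply: cone_refl.
- exact: cone_trans hc hy.
- by apply: t1; apply: cone_refl.
- by move=> /cone_dep; lia.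
Qed.

End Cover.
End Base.
End Cone.
Arguments cone {V e} eT o z _.

(** * Eventually periodic colorings have cusp quotients *)

Section Move.
Variables (V : choiceType) (e : rel V) (k : nat) (A : countType) (phi psi : V -> A).
Hypotheses (k2 : 2 <= k) (eT : is_tree e) (eR : regular e k).
Local Notation dist := (dist eT).
Local Notation R := (R phi eR).
Hypothesis hper : periodic e psi.
Variables (o y0 : V).
Hypothesis agree : forall x, cone eT o y0 x -> psi x = phi x.
Local Notation dep := (dist o).
Local Notation cone := (cone eT o).

Lemma per_reps : exists (G : set (V -> V)) (l : seq V), [/\ automorphism_group e G,
  forall g x, G g -> psi (g x) = psi x & forall x, exists r g, [/\ r \in l, G g & g r = x]].
Proof.
have [G [Gg Gi /finite_seqP [s hs]]] := hper.
exists G, (map (fun B : set V => xget o B) s); split=> // x.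
have [_ Gid _ Ginv] := Gg.
have xs : vertex_orbit G x \in s by have : quotient_vertices G (vertex_orbit G x) by [exists x]; rewrite hs.
exists (xget o (vertex_orbit G x)).
have : vertex_orbit G x (xget o (vertex_orbit G x)).
  by apply: (@xgetI _ o (vertex_orbit G x) x); exists id.
move=> [g gG hg]; have [h [hG gh _]] := Ginv _ gG.
by exists h; split=> //; [apply: map_f|rewrite -hg gh].
Qed.

(** Every orbit of the period group has a representative within [rho] of [o], so some period moves
    [x] to within [rho + rho] of any chosen [y]. Taking [y] at depth N + 2 [rho] + D below [y0]
    leaves room for the N-ball. *)
Lemma per_move x N D : exists g, [/\ automorphism e g, forall u, psi (g u) = psi u &
  forall w, dist x w <= N -> cone y0 (g w) /\ D <= dep (g w)].
Proof.
have [G [l [Gg Gi Gl]]] := per_reps; have [Ga Gid Gcomp Ginv] := Gg.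
have [rho hrho] : exists rho, forall r, r \in l -> dep r <= rho.
  exists (\max_(r <- l) dep r) => r rl; exact: (@leq_bigmax_seq _ l xpredT dep).
have [y hy hd] := cone_deep k2 eT eR o y0 (D + N + rho + rho).
have [r [g [rl gG gr]]] := Gl x; have [r' [g' [rl' gG' gr']]] := Gl y.
have [h [hG gh hg]] := Ginv _ gG.
have aG : G (g' \o h) by apply: Gcomp.
exists (g' \o h); split; [exact: Ga|by move=> u; apply: Gi|].
move=> w hw; have dyw : dist y ((g' \o h) w) <= N + rho + rho.
  have hx : (g' \o h) x = g' r by rewrite /= -gr gh.
  have h1 : dist y ((g' \o h) x) = dist r' r by rewrite hx -gr' (auto_dist eT r' r (Ga _ gG')).
  have h2 := auto_dist eT x w (Ga _ aG).
  have := dist_tri (eT := eT) ((g' \o h) x) y ((g' \o h) w).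
  have := dist_tri (eT := eT) o r' r; have := hrho _ rl; have := hrho _ rl'.
  by rewrite h1 h2 (dist_sym r' o); lia.
split.
  have hh : dep y0 + (N + rho + rho) <= dep y by rewrite hd; lia.
  exact: cone_ball hy hh dyw.
have := dist_tri (eT := eT) ((g' \o h) w) o y; rewrite (dist_sym ((g' \o h) w) y) hd; lia.
Qed.

(** M is the length of the list of orbit representatives, whatever n is: two balls inside the cone
    with centres in one orbit are matched by a period, and [psi] is [phi] there. *)
Lemma per_few : exists M, forall n (s : seq V), (forall y, y \in s -> cone y0 y /\ dep y0 + n <= dep y) ->
  pairwise (fun x y => ~~ R n x y) s -> size s <= M.
Proof.
have [G [l [Gg Gi Gl]]] := per_reps; have [Ga Gid Gcomp Ginv] := Gg.
exists (size l) => n s hs ps.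
pose P r x := `[< exists2 g, G g & g r = x >].
pose f x := find (P^~ x) l.
have fP x : f x < size l /\ P (nth x l (f x)) x.
  have hh : has (P^~ x) l.
    by apply/hasP; have [r [g [rl gG gr]]] := Gl x; exists r => //; apply/asboolP; exists g.
  by split; [rewrite -has_find|apply: (nth_find x hh)].
have bin y w : y \in s -> gball e n y w -> cone y0 w.
  by move=> /hs [h1 h2] /(gballP (eT := eT)) hw; apply: cone_ball h1 h2 hw.
rewrite -(size_map f) -(size_iota 0 (size l)); apply: uniq_leq_size.
  rewrite uniq_pairwise pairwise_map.
  apply: (sub_in_pairwise (P := [in s])) ps => [x y xs ys|]; last by apply/allP.
  apply: contraNN => /= /eqP hf; have [lx /asboolP [g gG gr]] := fP x; have [_ /asboolP [g' gG' gr']] := fP y.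
  rewrite -hf (set_nth_default x) // in gr'.
  have [h [hG gh hg]] := Ginv _ gG.
  have aG : G (g' \o h) by apply: Gcomp.
  have hxy : (g' \o h) x = y by rewrite /= -[in h x]gr gh.
  have := auto_ball_iso eT x n (Ga _ aG) (fun u => Gi _ u aG); rewrite hxy => [[b1 b2 b3]].
  apply: (@ball_iso_R V e k A phi k2 eT eR n x y (g' \o h)); split=> // u hu.
  rewrite -(agree (bin _ _ xs hu)) -agree; first exact: Gi.
  by case: b1 => b1 _ _; apply: bin ys (b1 _ hu).
by move=> i /mapP [x _ ->]; rewrite mem_iota; case: (fP x).
Qed.

End Move.

Section Fwd.
Variables (V : choiceType) (e : rel V) (k : nat) (A : countType) (phi : V -> A).
Hypotheses (k2 : 2 <= k) (eT : is_tree e) (eR : regular e k) (St : sturmian e phi).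
Local Notation dist := (dist eT).
Local Notation nb := (nb eR).
Local Notation par := (par eT).
Local Notation R := (R phi eR).
Local Notation Ri := (Ri phi eR).
Local Notation cone := (cone eT).
Variables (K : set V) (mm : nat) (T_ : 'I_mm -> set V) (psi : 'I_mm -> V -> A).
Hypotheses (Kf : finite_set K) (Ts : forall i, subtree e (T_ i)) (Tc : ~` K = \bigcup_i T_ i)
  (per : forall i, periodic e (psi i)) (agr : forall i x, T_ i x -> psi i x = phi x).

Lemma agr_cone i o y0 : cone o y0 `<=` T_ i -> forall x, cone o y0 x -> psi i x = phi x.
Proof. by move=> h x /h /agr. Qed.

(** At most M of the M + 2 classes of step M occur deep in the cone. A class that does not occur
    there is arbitrarily far from some vertices, hence finite by [far_fin]. *)
Lemma evper_bounded (o : V) : bounded_type e phi.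
Proof.
have [i [y0 [_ hT]]] := subcone k2 eT eR o Kf Ts Tc o.
have [M hM] := per_few k2 eR (per i) (agr_cone hT).
apply/(bounded_typeP phi k2 eT eR).
have [s [ss ps _]] := reps k2 eT eR St M.
pose deep y := cone o y0 y /\ dist o y0 + M <= dist o y.
have [z hz] : exists z, forall y, deep y -> ~~ R M z y.
  apply: contrapT => /forallNP hn.
  have hd z : exists y, deep y /\ R M z y.
    apply: contrapT => h; apply: (hn z) => y hy; apply/negP => hr; apply: h; by exists y.
  pose f z := projT1 (cid (hd z)).
  have fP z : deep (f z) /\ R M z (f z) by rewrite /f; case: cid.
  have := hM M (map f s); rewrite size_map ss => H.
  suff : M + 2 <= M by lia.
  apply: H => [y /mapP [z _ ->]|]; first by case: (fP z) => [[]].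
  rewrite pairwise_map; apply: sub_pairwise ps => x y /=; apply: contraNN => h.
  have [_ h1] := fP x; have [_ h2] := fP y.
  by apply: R_trans h1 (R_trans h _); rewrite R_sym.
exists M, z; apply: (far_fin k2 St) => j.
have [y hy hd] := cone_deep k2 eT eR o y0 (M + j).
exists y => w hw; rewrite ltnNge; apply/negP => hyw.
have : deep w.
  split.
    have hh : dist o y0 + j <= dist o y by rewrite hd; lia.
    exact: (cone_ball k2 hy hh hyw).
  by have := dist_tri (eT := eT) w o y; rewrite (dist_sym w y); lia.
by move/hz; rewrite hw.
Qed.

Section Core.
Variables (m : nat) (c : V).
Hypothesis Hc : core phi eR m c.
Local Notation d := (dcl phi eT eR m c).
Local Notation dnb := (dcl_nb phi eT eR m c).

Let dRi := core_Ri k2 eT St Hc.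

Lemma lev_nb x y z : d x = d y -> e x z -> exists2 w, e y w & d w = d z.
Proof.
move=> /dRi h ez; have [w ew hw] := Ri_nb h ez; exists w => //.
by apply/dRi; rewrite Ri_sym.
Qed.

Lemma up_nb x : exists2 y, e x y & d y = (d x).+1.
Proof.
have [z hz] := core_surj k2 eT St Hc (d x).+1; have [y ey hy] := dcl_pred hz.
by rewrite (tree_sym eT) in ey; have [w ew hw] := lev_nb hy ey; exists w => //; rewrite hw.
Qed.

Lemma lev_step x y : e x y -> d y <= (d x).+1 /\ d x <= (d y).+1.
Proof. by move=> h; split; apply: dnb; rewrite // (tree_sym eT). Qed.

Lemma lev_cnt (P : pred nat) x y : d x = d y ->
  count (fun w => P (d w)) (nb x) = count (fun w => P (d w)) (nb y).
Proof.
move=> /dRi h.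
have [b pb ab] := perm_match (Ri_eqr phi eR) (fun z => Ri_cnt z h).
rewrite -(permP pb); elim: (nb x) b {pb} ab => [|u s IH] [|v t] //= /andP[/dRi huv /IH ->].
by rewrite huv.
Qed.

Definition row i := forall z, d z = i ->
  count (fun w => d w == i.-1) (nb z) = 1 /\ count (fun w => d w == i.+1) (nb z) = k.-1.

Lemma row_of z i : d z = i -> count (fun w => d w == i.-1) (nb z) = 1 ->
  count (fun w => d w == i.+1) (nb z) = k.-1 -> row i.
Proof.
move=> hz h1 h2 y hy; have h : d y = d z by rewrite hy hz.
by rewrite (lev_cnt (fun j => j == i.-1) h) (lev_cnt (fun j => j == i.+1) h).
Qed.

Lemma row_same z : 0 < d z -> row (d z) -> count (fun w => d w == d z) (nb z) = 0.
Proof.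
move=> hz /(_ z erefl) [h1 h2]; have := count_pos k2 eT eR dnb hz.
by rewrite h1 h2; lia.
Qed.

Lemma row_nb z w : 0 < d z -> row (d z) -> e z w -> d w = (d z).-1 \/ d w = (d z).+1.
Proof.
move=> hz hr ezw; have [h1 h2] := lev_step ezw.
have : d w != d z.
  apply/eqP => h; have /eqP := row_same hz hr.
  rewrite -leqn0 leqNgt -has_count => /negP; apply; apply/hasP; exists w; first by rewrite mem_nb.
  by rewrite h.
by lia.
Qed.

Lemma row_pred_uniq z w w' : 0 < d z -> row (d z) -> e z w -> e z w' ->
  d w = (d z).-1 -> d w' = (d z).-1 -> w = w'.
Proof.
move=> hz hr e1 e2 h1 h2; have [c1 _] := hr z erefl.
have : size (filter (fun w => d w == (d z).-1) (nb z)) = 1 by rewrite size_filter.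
have i1 : w \in filter (fun w => d w == (d z).-1) (nb z) by rewrite mem_filter mem_nb h1 eqxx.
have i2 : w' \in filter (fun w => d w == (d z).-1) (nb z) by rewrite mem_filter mem_nb h2 eqxx.
by case: (filter _ _) i1 i2 => [|a [|b s]] //; rewrite !inE => /eqP -> /eqP ->.
Qed.

Lemma row_parent z p : 0 < d z -> e z p -> d p = (d z).-1 ->
  (forall w, e z w -> w <> p -> d w = (d z).+1) -> row (d z).
Proof.
move=> hz ezp hp hw; apply: (row_of (z := z)) => //.
  have : count (pred1 p) (nb z) = 1 by rewrite count_uniq_mem ?nb_uniq // mem_nb ezp.
  move=> <-; apply: eq_in_count => w; rewrite mem_nb => ezw /=.
  case: (eqVneq w p) => [->|/eqP hn]; first by rewrite hp eqxx.
  by rewrite (hw w ezw hn); lia.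
have := count_predC (pred1 p) (nb z); rewrite size_nb count_uniq_mem ?nb_uniq // mem_nb ezp => h.
have -> : k.-1 = count (predC (pred1 p)) (nb z) by lia.
apply: eq_in_count => w; rewrite mem_nb => ezw /=.
case: (eqVneq w p) => [->|/eqP hn]; first by rewrite hp; lia.
by rewrite (hw w ezw hn) eqxx.
Qed.

Section Asc.
Variable o : V.
Local Notation dep := (dist o).

(** As the parent is one level lower, the upper neighbour is a child, and the same holds again at
    that child. *)
Lemma cone_ascend p z n : par o z = p -> e z p -> d z = (d p).+1 -> exists2 y, cone o z y & d y = d z + n.
Proof.
move=> hp ezp hz; suff [q [y [h1 h2 h3 h4 h5]]] : exists q y, [/\ cone o z y, par o y = q, e y q, d y = (d q).+1 & d y = d z + n].
  by exists y.
elim: n => [|n [q [y [h1 h2 h3 h4 h5]]]].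
  by exists p, z; rewrite addn0; split=> //; apply: cone_refl.
have [w ew hw] := up_nb y.
have nw : w <> par o y by move=> h; move: hw; rewrite h h2 h4; lia.
have [wo wp wd] := child_dep ew nw.
exists y, w; split=> //; first exact: (cone_child k2 h1 ew nw).
  by rewrite (tree_sym eT).
by rewrite hw h5 addnS.
Qed.

(** Once a child is above its parent, [cone_ascend] applies. Otherwise take any child: on the same
    level, its own upper neighbour is not its parent; on a lower one, induct on the level. *)
Lemma cone_level_ge y L : exists2 z, cone o y z & L <= d z.
Proof.
move En : (d y) => n; elim/ltn_ind: n y En => n IH y En.
have H p w : cone o y p -> e p w -> w <> par o p -> d w = (d p).+1 -> exists2 z, cone o y z & L <= d z.
  move=> hc epw nw hw; have [wo wp wd] := child_dep epw nw.
  have [|z hz hd] := @cone_ascend p w L wp _ hw; first by rewrite (tree_sym eT).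
  exists z; last by rewrite hd; apply: leq_addl.
  exact: (cone_trans k2 (cone_child k2 hc epw nw) hz).
case: (pselect (exists2 w, e y w & w <> par o y /\ d w = (d y).+1)) => [[w ew [nw hw]]|hn].
  by apply: (H y w) => //; apply: cone_refl.
have [w ew nw] := child_ex k2 eT eR o y.
have hyw := cone_child k2 (cone_refl eT o y) ew nw.
have [wo wp wd] := child_dep ew nw.
have [l1 l2] := lev_step ew.
have : d w != (d y).+1 by apply/eqP => h; apply: hn; exists w.
case: (eqVneq (d w) (d y)) => [hd _|hd1 hd2].
  have [u eu hu] := up_nb w; apply: (H w u) => //.
  by move=> h; move: hu; rewrite h wp hd; lia.
have [|z hz hL] := IH (d w) _ w erefl; first by lia.
by exists z => //; apply: (cone_trans k2 hyw hz).
Qed.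

Lemma cone_level_ex y i : d y <= i -> exists2 z, cone o y z & d z = i.
Proof.
move=> hi; have [z hz hL] := cone_level_ge y i.
move En : (dep z) => n; elim: n z En hz hL => [|n IH] z En hz hL.
  case: (eqVneq z y) => [zy|zy]; last first.
    have := cone_dep hz; rewrite En leqn0 => /eqP /dist_eq0 oy.
    by move: zy; rewrite -oy -(dist_eq0 En) eqxx.
  by exists z => //; apply/eqP; rewrite eqn_leq hL zy hi.
case: (eqVneq (d z) i) => [h|h]; first by exists z.
case: (eqVneq z y) => [zy|/eqP zy]; first by rewrite zy in hL h; lia.
have zo : z != o by apply: (dep_pos (eT := eT)); rewrite En.
have [ez hd] := parP zo (eT := eT).
apply: (IH (par o z)); first by rewrite En in hd; case: hd.
  exact: (cone_par k2 hz zy).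
by have [] := lev_step ez; lia.
Qed.

Lemma max_dep (P : V -> Prop) B x : P x -> (forall x, P x -> dep x <= B) ->
  exists2 z, P z & forall y, P y -> dep y <= dep z.
Proof.
move=> hx hB; have hex : exists n, `[< exists2 z, P z & dep z = n >] by exists (dep x); apply/asboolP; exists x.
have hb n : `[< exists2 z, P z & dep z = n >] -> n <= B by move=> /asboolP [z /hB h <-].
case: (ex_maxnP hex hb) => n /asboolP [z hz hn] hmax; exists z => // y hy.
by rewrite hn; apply: hmax; apply/asboolP; exists y.
Qed.

(** Each level then has a deepest vertex. A child of it at the same or a lower level would have that
    level again in its cone, deeper still; so all children go up and the single remaining neighbour
    is the parent. Level 0 is similar. *)
Lemma bounded_cusp B : (forall x, d x = 0 -> dep x <= B) -> cusp_lev eR d.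
Proof.
move=> hB; split=> [z hz|z hz].
  have hBi x : d x = d z -> dep x <= B + d z.
    move=> hx; have [w hw hd] := dclP phi eT eR m c x.
    have /hB hw0 : d w = 0 by apply/dcl0.
    by have := dist_tri (eT := eT) w o x; rewrite (dist_sym w x) hd hx; lia.
  have [x hx hmax] := @max_dep (fun x => d x = d z) (B + d z) z erefl hBi.
  have hch w : e x w -> w <> par o x -> d w = (d x).+1.
    move=> exw nw; apply: contrapT => hn.
    have [l1 l2] := lev_step exw.
    have [|u hu hdu] := @cone_level_ex w (d x); first by lia.
    have [_ _ hdw] := child_dep exw nw.
    by have := hmax u (etrans hdu hx); have := cone_dep hu; lia.
  have [i hi] : exists i, d x = i.+1 by rewrite hx; case: (d z) hz => // i _; exists i.
  have [p ep hp] := dcl_pred hi.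
  have hpp : p = par o x by apply: contrapT => /(hch _ ep); lia.
  have : row (d x).
    apply: (@row_parent x p) => //; [by rewrite hi|by rewrite hp hi|].
    by move=> w ew nw; apply: hch => //; rewrite -hpp.
  by move/(_ z); rewrite hx => /(_ erefl).
have [x hx hmax] := @max_dep (fun x => d x = 0) B z hz hB.
have -> : count (fun w => d w == 0) (nb z) = count (fun w => d w == 0) (nb x).
  by apply: (lev_cnt (fun j => j == 0)); rewrite hz hx.
rewrite -size_filter; apply: (@uniq_leq_size _ _ [:: par o x]); first by rewrite filter_uniq ?nb_uniq.
move=> w; rewrite mem_filter mem_nb inE => /andP[/eqP hw exw]; apply/eqP; apply: contrapT => nw.
have [_ _ hdw] := child_dep exw nw.
by have := hmax w hw; lia.
Qed.

(* If d y were small compared to the depth of y, the levels d y, ..., d y + M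
   below y would give M.+1 inequivalent balls inside T_ i. *)
Lemma cone_linear i y0 : cone o y0 `<=` T_ i ->
  exists a, forall y, cone o y0 y -> dep y <= d y + a.
Proof.
move=> hT; have [M hM] := per_few k2 eR (per i) (agr_cone hT).
exists (dep y0 + m + M) => y hy; rewrite leqNgt; apply/negP => hlt.
have hdy := cone_dep hy.
pose n := dep y - dep y0; have nE : n = m + (n - m) by rewrite /n; lia.
have hz l : exists z, cone o y z /\ d z = d y + l.
  by have [z h1 h2] := @cone_level_ex y (d y + l) (leq_addr _ _); exists z.
pose f l := projT1 (cid (hz l)).
have fP l : cone o y (f l) /\ d (f l) = d y + l by rewrite /f; case: cid.
suff : M.+1 <= M by rewrite ltnn.
rewrite -[X in X <= _](size_iota 0) -(size_map f); apply: (hM n) => [z /mapP [l _ ->]|].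
  have [h1 h2] := fP l; split; first exact: (cone_trans k2 hy h1).
  by have := cone_dep h1; rewrite /n; lia.
rewrite pairwise_map; have := iota_ltn_sorted 0 M.+1; rewrite (sorted_pairwise ltn_trans).
apply: (sub_in_pairwise (P := fun i => i <= M)); last by apply/allP => l; rewrite mem_iota => /andP[]; lia.
move=> l l'; rewrite !unfold_in => hl hl' hll /=; apply/negP; rewrite nE => h.
have [_ h1] := fP l; have [_ h2] := fP l'.
have := dcl_sep (_ : d (f l) <= n - m) h; rewrite h1 h2 /n.
by move=> H; have := H ltac:(lia); lia.
Qed.

(** A period of [psi i] keeps [phi] between [T_ i] and the cone, where both colorings agree; by
    [cone_linear] great depth in the cone means high level. *)
Lemma tail_like i y0 : cone o y0 `<=` T_ i -> forall x N L, exists g, automorphism e g /\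
  forall w, dist x w <= N -> L <= d (g w) /\ (T_ i w -> phi (g w) = phi w).
Proof.
move=> hT x N L; have [a ha] := cone_linear hT.
have [g [ga gi gw]] := per_move k2 eT eR (per i) o y0 x N (L + a).
exists g; split=> // w hw; have [h1 h2] := gw w hw; have h3 := ha _ h1; split; first by lia.
by move=> tw; rewrite -(agr (hT _ h1)) gi (agr tw).
Qed.

(* Minimize d z - dist o z over a cone inside T_ i: below the minimizer every
   child is one level higher than its parent. *)
Lemma tail_rows : exists2 I, 1 < I & forall i, I <= i -> row i.
Proof.
have [i [y0 [_ hT]]] := subcone k2 eT eR o Kf Ts Tc o.
have [a ha] := cone_linear hT.
(* The summand [a] keeps the truncated subtraction exact on the cone of [y0]. *)
pose f z := d z + a - dep z.
have hex : exists n, `[< exists2 z, cone o y0 z & f z = n >].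
  by exists (f y0); apply/asboolP; exists y0 => //; apply: cone_refl.
case: (ex_minnP hex) => n /asboolP [z0 hz0 hn] hmin.
have fmin z : cone o z0 z -> f z0 <= f z.
  move=> hz; rewrite hn; apply: hmin; apply/asboolP; exists z => //.
  exact: (cone_trans k2 hz0 hz).
have step y w : cone o y0 y -> e y w -> w <> par o y -> f w <= f y /\ (f w = f y -> d w = (d y).+1).
  move=> hy eyw nw; have [_ _ hdw] := child_dep eyw nw; have [l1 l2] := lev_step eyw.
  have := ha _ hy; have := ha _ (cone_child k2 hy eyw nw); rewrite /f hdw; lia.
have fconst z : cone o z0 z -> f z = f z0.
  move En : (dep z) => q; elim: q z En => [|q IH] z En hz.
    by have := cone_dep hz; rewrite En leqn0 => /eqP /dist_eq0 <-; rewrite -(dist_eq0 En).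
  case: (eqVneq z z0) => [->//|/eqP nz].
  have zo : z != o by apply: (dep_pos (eT := eT)); rewrite En.
  have [ez hd] := parP zo (eT := eT); rewrite (tree_sym eT) in ez.
  have hp := cone_par k2 hz nz.
  have hfp : f (par o z) = f z0 by apply: IH => //; rewrite En in hd; case: hd.
  have nzp : z <> par o (par o z).
    move=> h; case: (eqVneq (par o z) o) => [po|po].
      by move: zo; rewrite h po par_root eqxx.
    by have [_ hd'] := parP po (eT := eT); rewrite -h in hd'; lia.
  have [h1 _] := step _ _ (cone_trans k2 hz0 hp) ez nzp.
  by have := fmin _ hz; lia.
have child z w : cone o z0 z -> e z w -> w <> par o z -> d w = (d z).+1.
  move=> hz ezw nw; have [_ h] := step _ _ (cone_trans k2 hz0 hz) ezw nw; apply: h.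
  by rewrite !fconst //; apply: (cone_child k2 hz ezw nw).
exists (d z0).+2 => // j hj.
have [z hz hdz] := @cone_level_ex z0 j (ltnW (ltnW hj)).
have nz : z <> z0 by move=> h; rewrite h in hdz; lia.
rewrite -hdz; have hpos : 0 < d z by lia.
have [p ep hp] : exists2 p, e z p & d p = (d z).-1.
  by have [p h1 h2] := dcl_pred (esym (prednK hpos)); exists p.
have hpp : p = par o z by apply: contrapT => /(child _ _ hz ep); lia.
apply: (row_parent hpos ep hp) => w ew nw; apply: child => //.
by rewrite -hpp.
Qed.

End Asc.

(** One neighbour below and one above already exhaust the two neighbours; at level 0 the upper one
    leaves at most one other. *)
Lemma cusp_two : k = 2 -> cusp_lev eR d.
Proof.
move=> kE.
have has1 (P : pred V) x w : e x w -> P w -> 0 < count P (nb x).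
  by move=> exw pw; rewrite -has_count; apply/hasP; exists w => //; rewrite mem_nb.
split=> [z hz|z hz].
  have := count_pos k2 eT eR dnb hz; have [u eu hu] := up_nb z.
  have [p ep hp] := dcl_pred (esym (prednK hz)).
  have := has1 (fun w => d w == (d z).-1) z p ep; rewrite hp eqxx => /(_ isT).
  have := has1 (fun w => d w == (d z).+1) z u eu; rewrite hu eqxx => /(_ isT).
  by lia.
have := count_zero k2 eR dnb hz; have [u eu hu] := up_nb z.
have := has1 (fun w => d w == 1) z u eu; rewrite hu hz => /(_ isT).
by lia.
Qed.

(** * Degree at least three *)

Section Three.
Hypothesis k3 : 2 < k.

Let v i := projT1 (cid (core_surj k2 eT St Hc i)).
Let vP i : d (v i) = i. Proof. by rewrite /v; case: cid. Qed.

Lemma R_lev n w u : R n w u = R n w (v (d u)).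
Proof.
have h : R n u (v (d u)) by apply: Ri_R; apply/dRi; rewrite vP.
apply/idP/idP => hw; apply: (R_trans hw) => //.
by rewrite R_sym.
Qed.

Lemma R_levl n w u : R n u w = R n (v (d u)) w.
Proof. by rewrite R_sym R_lev R_sym. Qed.

Lemma cnt_R n w z : count (R n w) (nb z) = count (fun u => R n w (v (d u))) (nb z).
Proof. by apply: eq_count => u; rewrite R_lev. Qed.

Lemma cnt_row n w z : 0 < d z -> row (d z) ->
  count (R n w) (nb z) = R n w (v (d z).-1) + R n w (v (d z).+1) * k.-1.
Proof.
move=> hz hr; rewrite cnt_R (count_levels k2 eT eR dnb (fun j => R n w (v j)) hz) (row_same hz hr).
by have [-> ->] := hr z erefl; rewrite muln0 addn0 muln1.
Qed.

(** Since k - 1 > 1, the neighbour counts distinguish the multiplicity of the upper neighbours from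
    that of the lower one. *)
Lemma nbr_match n z z' : 0 < d z -> row (d z) -> 0 < d z' -> row (d z') -> R n.+1 z z' ->
  R n (v (d z).-1) (v (d z').-1) /\ R n (v (d z).+1) (v (d z').+1).
Proof.
move=> hz hr hz' hr' hR.
have E w : R n w (v (d z).-1) + R n w (v (d z).+1) * k.-1 = R n w (v (d z').-1) + R n w (v (d z').+1) * k.-1.
  by rewrite -!cnt_row //; apply: R_cnt.
have h1 : R n (v (d z).+1) (v (d z').+1).
  have := E (v (d z).+1); rewrite R_refl mul1n.
  by case: (R n _ _); case: (R n _ (v (d z').-1)); case: (R n _ (v (d z').+1)) => //=; lia.
split=> //.
have := E (v (d z).-1); rewrite R_refl.
have -> : R n (v (d z).-1) (v (d z).+1) = R n (v (d z).-1) (v (d z').+1).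
  by apply/idP/idP => h; apply: (R_trans h) => //; rewrite R_sym.
by case: (R n _ (v (d z').-1)); case: (R n _ (v (d z').+1)) => //=; lia.
Qed.

(** No step is lost: by [core_tail], levels above 1 that agree at step m also agree at step
    [m.+1]. *)
Lemma lev_match i j : 1 < i -> row i -> 1 < j -> row j -> R m (v i) (v j) ->
  R m (v i.-1) (v j.-1) /\ R m (v i.+1) (v j.+1).
Proof.
move=> hi ri hj rj h.
have := @nbr_match m (v i) (v j); rewrite !vP => H; apply: H => //; [lia|lia|].
by rewrite -addn1; apply: (core_tail k2 St Hc); rewrite ?vP.
Qed.

Lemma not_core z : 0 < d z -> ~~ R m c z.
Proof. by move=> hz; apply/negP => /(dcl0 phi eT eR m c z) h; rewrite h in hz. Qed.

Section Tail.
Variable I : nat.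
Hypotheses (I2 : 1 < I) (Irow : forall i, I <= i -> row i).

(** Otherwise the classes of the levels from [a] on repeat with period b - a. Since every class
    except C occurs at high levels, these b - a classes and C would be all, at most m + 1 instead of
    m + 2. *)
Lemma lev_distinct a b : I <= a -> a < b -> b <= a + m -> ~~ R m (v a) (v b).
Proof.
move=> ha hab hb; apply/negP => hR.
have per_lev l : a <= l -> exists l', [/\ a <= l', l' < b & R m (v l) (v l')].
  move=> hl; rewrite -(subnK hl); elim: (l - a) => [|i [l' [h1 h2 h3]]].
    by exists a; rewrite add0n R_refl leqnn.
  have h : R m (v (i + a).+1) (v l'.+1) by apply: (lev_match _ _ _ _ h3).2; try apply: Irow; lia.
  case: (ltngtP l'.+1 b) => hl'; [|lia|].
    by exists l'.+1; rewrite addSn; split=> //; lia.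
  exists a; rewrite addSn leqnn; split=> //; apply: (R_trans h).
  by rewrite hl' R_sym.
have hcov z : exists2 r, r \in c :: map v (iota a (b - a)) & R m z r.
  case: (posnP (d z)) => hz.
    exists c; first exact: mem_head.
    by rewrite R_sym; apply/(dcl0 phi eT eR m c z).
  have [w hw haw] := core_inf k2 St Hc a hz.
  have [l' [h1 h2 h3]] := per_lev _ haw.
  exists (v l'); first by rewrite inE map_f ?orbT // mem_iota h1; lia.
  by rewrite (R_lev m z w) in hw; apply: R_trans hw h3.
by have := cover_size k2 eT St hcov; rewrite /= size_map size_iota; lia.
Qed.

(** The m + 1 consecutive levels are inequivalent to each other and to C, which accounts for all m +
    2 classes. *)
Lemma run_cover l : I <= l -> forall z, 0 < d z -> exists j, [/\ l <= j, j <= l + m & R m z (v j)].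
Proof.
move=> hl z hz; apply: contrapT => hn.
have /(pw_size k2 eT St) : pairwise (fun x y => ~~ R m x y) (c :: z :: map v (iota l m.+1)).
  rewrite 2!pairwise_cons; apply/and3P; split.
  - apply/allP => u; rewrite inE => /orP[/eqP ->|/mapP [j]]; first exact: not_core.
    by rewrite mem_iota => /andP[h1 h2] ->; apply: not_core; rewrite vP; lia.
  - apply/allP => u /mapP [j]; rewrite mem_iota => /andP[h1 h2] ->.
    by apply/negP => h; apply: hn; exists j; split=> //; lia.
  rewrite pairwise_map; have := iota_ltn_sorted l m.+1; rewrite (sorted_pairwise ltn_trans).
  apply: (sub_in_pairwise (P := fun i => (l <= i) && (i <= l + m))).
    move=> a b; rewrite !unfold_in => /andP[h1 h2] /andP[h3 h4] /= h5.
    by apply: lev_distinct; lia.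
  by apply/allP => a; rewrite mem_iota => /andP[]; lia.
by rewrite /= size_map size_iota; lia.
Qed.

End Tail.

(* If C is bounded, a farthest vertex of each level shows that the ray is a cusp.
   Otherwise a long chain of vertices near C lies in some T_ i, and a period of
   psi i moves it to high levels, where no vertex is R m equivalent to C; the
   three cases m = 0, m = 1 and m >= 2 each give a contradiction. *)
Lemma evper_cusp_core : cusp_lev eR d.
Proof.
apply: contrapT => ncusp.
have unb o D : exists2 z, d z = 0 & D <= dist o z.
  apply: contrapT => hn; apply: ncusp; apply: (@bounded_cusp o D) => x hx.
  by rewrite leqNgt; apply/negP => h; apply: hn; exists x => //; apply: ltnW.
have [I I2 Irow] := tail_rows c.
have R0 u w : R 0 u w -> phi u = phi w by move/eqP.
(* For m = 0, C is a colour class, yet a vertex of C moved to a positive level keeps its colour. *)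
case: (posnP m) => [m0|mpos].
  have [j [y0 [z [hT hz _ hch]]]] := deep_chain k2 eR Kf Ts Tc 0 (unb c).
  have [g [_ hg]] := tail_like hT z 0 1.
  have [h1 h2] := hg z (eq_leq (dist_xx z)).
  have := not_core h1; rewrite m0 => /negP; apply.
  have : R m c z by apply/(dcl0 phi eT eR m c z).
  by rewrite m0 => /R0 h; rewrite /= h (h2 (hch 0 isT)).
have [m' mE] : exists m', m = m'.+1 by exists m.-1; rewrite prednK.
have Rm' x y : 0 < d x -> 0 < d y -> R m' x y = R m x y.
  move=> hx hy; apply/idP/idP; first exact: (core_pred k2 St Hc mE).
  by rewrite mE; apply: R_S.
have I0 : 0 < I by lia.
case: m' mE Rm' => [|m''] mE Rm'.
  (* Here m = 1. Outside C the colour already determines the class of step 1, so the claim can be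
     checked on a tail level, where consecutive levels are inequivalent. *)
  have own z : 0 < d z -> count (R 0 z) (nb z) = 0.
    move=> hz; have [w hw hIw] := core_inf k2 St Hc I.+1 hz.
    have hw1 : R 1 z w by rewrite -mE.
    rewrite (R_cnt z hw1).
    have hzw : R 0 z w := R_S hw1.
    have hw0 : 0 < d w by lia.
    have hrow : row (d w) by apply: Irow; lia.
    have hd1 : (d w) = (d w).-1.+1 by lia.
    rewrite (cnt_row _ _ hw0 hrow).
    have nn l : 0 < l -> ~~ R m w (v l) -> R 0 z (v l) = false.
      move=> hl nl; apply/negP => h; move/negP: nl; apply.
      rewrite -Rm' ?vP //; apply: R_trans h; by rewrite R_sym.
    have -> : R 0 z (v (d w).-1) = false.
      apply: nn; first by lia.
      by rewrite R_levl R_sym; apply: (lev_distinct I2 Irow); lia.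
    have -> // : R 0 z (v (d w).+1) = false.
    apply: nn; first by lia.
    by rewrite R_levl; apply: (lev_distinct I2 Irow); lia.
  have two x y z : ~~ R 0 x y -> ~~ R 0 x z -> R 0 y z.
    move=> h1 h2; apply: contrapT => /negP h3.
    by have := @pw_size V e k A phi k2 eT eR St 0 [:: x; y; z]; rewrite /= h1 h2 h3 => /(_ isT).
  have full z : (forall u, e z u -> ~~ R 0 z u) -> forall w, count (R 0 w) (nb z) = if R 0 w z then 0 else k.
    move=> hu w; case: ifP => hw.
      apply/eqP; rewrite -leqn0 leqNgt -has_count; apply/negP => /hasP [u]; rewrite mem_nb => /hu /negP h1 h2.
      by apply: h1; apply: R_trans h2; rewrite R_sym.
    rewrite -[RHS](size_nb (eR := eR) z); apply/eqP; rewrite -all_count; apply/allP => u; rewrite mem_nb => /hu h1.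
    by apply: two h1; rewrite R_sym hw.
  have nown z : 0 < d z -> forall u, e z u -> ~~ R 0 z u.
    move=> hz u ezu; apply/negP => h; have /eqP := own z hz.
    rewrite -leqn0 leqNgt -has_count => /negP; apply; apply/hasP; exists u; by rewrite ?mem_nb.
  (* Otherwise all vertices coloured like [c] would have only neighbours of the other colour, and
     step 1 would not cut C off its colour class. *)
  have hc1 : exists2 w, e c w & d w = 0.
    apply: contrapT => hn.
    have hcn u : e c u -> ~~ R 0 c u.
      move=> ecu; rewrite R_sym; apply: nown; last by rewrite (tree_sym eT).
      by rewrite lt0n; apply/eqP => h; apply: hn; exists u.
    have [z hcz ncz] : exists2 z, R 0 c z & ~~ R 1 c z by apply: (core_Sp Hc mE); case: Hc.
    have hz : 0 < d z.
      by rewrite lt0n; apply: contraNneq ncz => /(dcl0 phi eT eR m c z); rewrite mE.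
    move/negP: ncz; apply; apply: R_succ => // w.
    rewrite (full _ hcn) (full _ (nown z hz)).
    suff -> : R 0 w c = R 0 w z by [].
    by apply/idP/idP => h; apply: (R_trans h) => //; rewrite R_sym.
  have dc : d c = 0 by apply/(dcl0 phi eT eR m c c); apply: R_refl.
  (* The neighbour in C of a deep vertex of C is its parent or a still deeper child. The resulting
     edge, moved to positive levels, keeps two ends of one colour, against [nown]. *)
  have hTh D : exists2 z, d z = 0 /\ d (par c z) = 0 & D <= dist c z.
    have [z hz hD] := unb c D; have hzc : d c = d z by rewrite hz dc.
    have [w0 ew0 hw0] := hc1; have [w ew hw] := lev_nb hzc ew0; rewrite hw0 in hw.
    case: (pselect (w = par c z)) => hwp; first by exists z; rewrite // -hwp hw.
    have [_ wp wd] := child_dep ew hwp.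
    by exists w; [rewrite wp hz hw|rewrite wd leqW].
  have [j [y0 [z [hT [hz hpz] hdz hch]]]] := deep_chain k2 eR Kf Ts Tc 1 hTh.
  have [g [[_ ge] hg]] := tail_like hT z 1 1.
  have zc : z != c by apply: (dep_pos (eT := eT)); lia.
  have [ez _] := parP zc (eT := eT).
  have [h1 h2] := hg z (leq_trans (eq_leq (dist_xx z)) isT).
  have [h3 h4] := hg (par c z) (eq_leq (dist_edge ez)).
  have := nown _ h1 (g (par c z)); rewrite ge => /(_ ez) /negP; apply.
  have hR : R m z (par c z).
    apply: (@R_trans _ _ _ _ _ _ _ c); last by apply/(dcl0 phi eT eR m c _).
    by rewrite R_sym; apply/(dcl0 phi eT eR m c z).
  have /R0 hphi := R_le (leq0n m) hR.
  by rewrite /= (h2 (hch 0 isT)) (h4 (hch 1 isT)) hphi.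
(* Here m >= 2, so three consecutive tail levels are inequivalent. Downward induction from the tail:
   level [i.+1] agrees with a tail level [L] at step m, hence [i] with [L.-1]. The counts at step m
   - 1, where levels outside C are separated as well as at step m, make [i] a row. *)
have rows i : 0 < i -> row i.
  move=> hi; have : I <= i + I by lia.
  move: {2}I => q; elim: q i hi => [|q IH] i hi hq; first by apply: Irow; rewrite addn0 in hq.
  have hr1 : row i.+1 by apply: IH => //; rewrite addSnnS.
  have hi1 : 0 < d (v i.+1) by rewrite vP.
  have [w hw hIw] := core_inf k2 St Hc I.+2 hi1.
  rewrite R_lev in hw; set L := d w in hw hIw.
  have [hm1 _] : R m (v i) (v L.-1) /\ R m (v i.+2) (v L.+1).
    apply: (lev_match (i := i.+1)) => //; first by lia.
    by apply: Irow; lia.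
  pose i' := L.-1; have LE : L = i'.+1 by rewrite /i'; lia.
  rewrite -/i' in hm1; rewrite LE in hw hIw.
  have vi0 : 0 < d (v i) by rewrite vP.
  have vi0' : 0 < d (v i') by rewrite vP; lia.
  have rv' : row (d (v i')) by rewrite vP; apply: Irow; lia.
  have C w' : count (R m''.+1 w') (nb (v i)) = R m''.+1 w' (v i'.-1) + R m''.+1 w' (v i'.+1) * k.-1.
    rewrite (R_cnt (n := m''.+1) (y := v i')); first by rewrite (cnt_row _ _ vi0' rv') vP.
    by rewrite -mE.
  have nR a b : I <= a -> a < b -> b <= a + 2 -> R m (v a) (v b) = false.
    by move=> h1 h2 h3; apply/negbTE/(lev_distinct I2 Irow); lia.
  have zero : count (fun u => d u == d (v i)) (nb (v i)) = 0.
    have := C (v i); rewrite !Rm' ?vP //; last by lia.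
    have -> : R m (v i) (v i'.-1) = false.
      apply/negP => h; have := nR i'.-1 i' ltac:(lia) ltac:(lia) ltac:(lia).
      by rewrite (R_trans (_ : R m _ (v i)) hm1) // R_sym.
    have -> : R m (v i) (v i'.+1) = false.
      apply/negP => h; have := nR i' i'.+1 ltac:(lia) ltac:(lia) ltac:(lia).
      by rewrite (R_trans (_ : R m _ (v i)) h) // R_sym.
    rewrite /= => /eqP; rewrite -leqn0 leqNgt -has_count => hh.
    apply/eqP; rewrite -leqn0 leqNgt -has_count; apply: contraNN hh => /hasP [u hu /eqP hdu].
    apply/hasP; exists u => //; change (is_true (R m''.+1 (v i) u)).
    by rewrite R_lev hdu R_refl.
  have one : count (fun u => d u == (d (v i)).-1) (nb (v i)) = 1.
    have := C (v i'.-1); rewrite R_refl.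
    have -> : R m''.+1 (v i'.-1) (v i'.+1) = false.
      by rewrite Rm' ?vP; [apply: nR; lia|lia|].
    rewrite cnt_R (count_levels k2 eT eR dnb (fun j => R m''.+1 (v i'.-1) (v j)) vi0) zero !vP muln0 addn0 mul0n addn0.
    have -> : R m''.+1 (v i'.-1) (v i.+1) = false.
      rewrite Rm' ?vP; [|lia|by []].
      apply/negP => h; have := nR i'.-1 i'.+1 ltac:(lia) ltac:(lia) ltac:(lia).
      by rewrite (R_trans h hw).
    by rewrite mul0n addn0 => /eqP; rewrite muln_eq1 => /andP[_ /eqP].
  have := count_pos k2 eT eR dnb vi0; rewrite zero one => hk.
  apply: (@row_of (v i)); rewrite ?vP // -1?[X in _ == X.-1](vP i) //.
    by move: one; rewrite vP.
  by rewrite vP in hk; lia.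
have dc : d c = 0 by apply/(dcl0 phi eT eR m c c); apply: R_refl.
(* The lower neighbour [w] of [y] is unique, so the parent of [y] is higher still, and so on up to
   [c], which has level 0. *)
have noup n w y : par c w = y -> w != c -> d y = (d w).+1 -> dist c y = n -> False.
  elim: n w y => [|n IH] w y hp wc hd hn.
    by move: hd; rewrite -(dist_eq0 hn) dc.
  have yc : y != c by apply: (dep_pos (eT := eT)); rewrite hn.
  have [ey hdy] := parP yc (eT := eT).
  have [eyw hyw] := par_nb wc hp.
  have hy0 : 0 < d y by rewrite hd.
  apply: (IH y (par c y)) => //; last by rewrite hn in hdy; case: hdy.
  case: (row_nb hy0 (rows _ hy0) ey) => // hh.
  have : par c y = w by apply: (row_pred_uniq hy0 (rows _ hy0) ey eyw) => //; rewrite hd.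
  by move=> h; rewrite h in hdy; lia.
have upC z : d z = 0 -> d (par c z) = 0.
  move=> hz; case: (eqVneq z c) => [->|zc]; first by rewrite par_root.
  have [ez _] := parP zc (eT := eT); have [l1 l2] := lev_step ez.
  case: (posnP (d (par c z))) => // hpos; exfalso.
  by apply: (noup _ z (par c z) erefl zc _ erefl); lia.
(* The moved chain may fall and then rise: either it rises from one of the first m steps on, leaving
   m rising steps, or its first m steps all fall. *)
pose N := m + m.
have [j [y0 [z [hT hz hdz hch]]]] := deep_chain k2 eR Kf Ts Tc N (unb c).
have [g [[[h gh hg'] ge] hg]] := tail_like hT z N I.
pose p i := iter i (par c) z.
have pC i : d (p i) = 0 by elim: i => //= i; apply: upC.
have pd i : i <= N -> dist c (p i) = dist c z - i.
  move=> hi; have hiz : i <= dist c z by lia.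
  by have [_ ->] := @cone_iter V e k k2 eT c i z hiz.
have pe i : i < N -> e (p i) (p i.+1).
  move=> hi; have hpc : p i != c by apply: (dep_pos (eT := eT)); rewrite pd; lia.
  by have [] := parP hpc (eT := eT).
have pz i : i <= N -> dist z (p i) <= i.
  elim: i => [|i IH] hi; first by rewrite dist_xx.
  by apply: leq_trans (dist_nb _ (pe _ hi)) _; rewrite ltnS IH // ltnW.
pose f i := d (g (p i)).
have fI i : i <= N -> I <= f i by move=> hi; have [] := hg (p i) (leq_trans (pz _ hi) hi).
have fc i : i <= N -> R 0 (v (f i)) c.
  move=> hi; have [_ h2] := hg (p i) (leq_trans (pz _ hi) hi).
  have : R m c (p i) by apply/(dcl0 phi eT eR m c _).
  move=> /(R_le (leq0n m)) /R0 h3.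
  by rewrite -R_levl /= (h2 (hch _ hi)) h3.
have fS i : i < N -> f i.+1 = (f i).-1 \/ f i.+1 = (f i).+1.
  move=> hi; apply: row_nb; first by have := fI i (ltnW hi); rewrite /f; lia.
    by apply: Irow; apply: fI; apply: ltnW.
  by rewrite ge; apply: pe.
(* Falling right after a rise would return to the unique lower neighbour, hence to [g (p i)],
   against injectivity. *)
have fS2 i : i.+1 < N -> f i.+1 = (f i).+1 -> f i.+2 = (f i.+1).+1.
  move=> hi h1; case: (fS _ hi) => // h2.
  have hp1 : 0 < d (g (p i.+1)) by have := fI i.+1 (ltnW hi); rewrite /f; lia.
  have hr1 : row (d (g (p i.+1))) by apply: rows.
  have : g (p i) = g (p i.+2).
    apply: (row_pred_uniq hp1 hr1); rewrite ?ge //.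
    - by rewrite (tree_sym eT); apply: pe; apply: ltnW.
    - exact: pe.
    - by rewrite -/(f i) -/(f i.+1) h1.
  move=> /(can_inj gh) hpp; have := pd i ltac:(lia); have := pd i.+2 hi.
  by rewrite hpp; lia.
(* These m + 1 consecutive levels carry the colour of [c] and represent every class except C, so
   only one colour remains, while step 0 has two. *)
have [l [hl hrun]] : exists l, I <= l /\ forall j, l <= j -> j <= l + m -> R 0 (v j) c.
  case: (pselect (exists2 i, i < m & f i.+1 = (f i).+1)) => [[i0 hi0 hf]|hn].
    have inc q : i0 + q < N -> f (i0 + q).+1 = (f (i0 + q)).+1.
      elim: q => [|q IH]; first by rewrite addn0.
      by rewrite addnS => hq; apply: fS2 => //; apply: IH; apply: ltnW.
    have incr q : i0 + q <= N -> f (i0 + q) = f i0 + q.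
      elim: q => [|q IH]; first by rewrite !addn0.
      by rewrite !addnS => hq; rewrite inc // IH // ltnW.
    exists (f i0); split; first by apply: fI; rewrite /N; lia.
    move=> q h1 h2; have -> : q = f i0 + (q - f i0) by lia.
    by rewrite -incr; [apply: fc|]; rewrite /N; lia.
  have dec i : i <= m -> f i + i = f 0.
    elim: i => [|i IH] hi; first by rewrite addn0.
    have := fI i ltac:(rewrite /N; lia); have := IH (ltnW hi).
    case: (fS i) => [|h1|h1]; [by rewrite /N; lia|by rewrite h1; lia|].
    by case: hn; exists i.
  exists (f m); split; first by apply: fI; rewrite /N; lia.
  have := dec m (leqnn _) => hm q h1 h2.
  have hq : f (f 0 - q) = q by have := dec (f 0 - q) ltac:(lia); have := fI (f 0 - q) ltac:(rewrite /N; lia); lia.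
  by rewrite -hq; apply: fc; rewrite /N; lia.
have all0 z' : R 0 z' c.
  case: (posnP (d z')) => hz'.
    by rewrite R_sym; apply: (R_le (leq0n m)); apply/(dcl0 phi eT eR m c z').
  have [q [h1 h2 h3]] := run_cover I2 Irow hl hz'.
  exact: R_trans (R_le (leq0n m) h3) (hrun q h1 h2).
have := @cover_size V e k A phi k2 eT eR St 0 [:: c].
have H : forall z, exists2 r, r \in [:: c] & R 0 z r by move=> z'; exists c; rewrite ?mem_head.
by move=> /(_ H).
Qed.

End Three.

End Core.

End Fwd.

(** * Cusp quotients give eventually periodic colorings *)

Section Bwd.
Variables (V : choiceType) (e : rel V) (k : nat).
Hypotheses (k2 : 2 <= k) (eT : is_tree e) (eR : regular e k).
Local Notation dist := (dist eT).
Local Notation nb := (nb eR).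
Local Notation par := (par eT).

Lemma count_nb1 (P : pred V) x y (b : bool) : e x y -> (forall w, e x w -> w <> y -> P w = b) ->
  count P (nb x) = P y + b * k.-1.
Proof.
move=> exy hb; have yn : y \in nb x by rewrite mem_nb.
rewrite (permP (perm_to_rem yn)) /=; congr (_ + _).
have sz : size (rem y (nb x)) = k.-1 by rewrite size_rem // size_nb.
have hw : {in rem y (nb x), P =1 (fun=> b)}.
  move=> w; rewrite mem_rem_uniq ?nb_uniq // inE mem_nb => /andP[/eqP nw ew].
  exact: hb.
rewrite (eq_in_count hw); case: b {hb hw}; first by rewrite count_predT sz mul1n.
by rewrite count_pred0.
Qed.

(** * Periodic colorings from a height function modulo q *)

Section Periodic.
Variables (q : nat) (kap : V -> nat) (down : V -> V).
Hypotheses (q0 : 0 < q) (e_down : forall x, e x (down x))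
  (kap_down : forall x, (kap (down x)).+1 = kap x %[mod q])
  (kap_up : forall x w, e x w -> w <> down x -> kap w = (kap x).+1 %[mod q]).
Let col (x : V) : nat := kap x %% q.

(** The height of a vertex modulo q determines those of its neighbours with multiplicities, so
    refinement never separates anything. In [kap_periodic] this bounds the number of orbits of the
    automorphisms of [col] by q. *)
Lemma kap_R n x y : R col eR n x y = (col x == col y).
Proof.
elim: n x y => [//|n IH] x y; apply/idP/eqP => [/R_S|h].
  by rewrite IH => /eqP.
apply: R_succ => [|z]; first by rewrite IH h.
have E u : count (R col eR n z) (nb u) =
    ((kap z).+1 %% q == kap u %% q) + (kap z %% q == (kap u).+1 %% q) * k.-1.
  rewrite (count_nb1 (b := kap z %% q == (kap u).+1 %% q) (e_down u)).
    rewrite IH /col -(kap_down u); congr (nat_of_bool _ + _).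
    by rewrite -[(kap z).+1]addn1 -[(kap (down u)).+1]addn1 eqn_modDr.
  by move=> w ew hw; rewrite IH /col (kap_up ew hw).
rewrite !E; have -> : kap x %% q = kap y %% q by [].
by rewrite -[(kap x).+1]addn1 -[(kap y).+1]addn1 -(modnDml (kap x)) -(modnDml (kap y)) -/(col x) -/(col y) h.
Qed.

Lemma kap_periodic (o : V) (B : countType) (psi : nat -> B) :
  (forall x y, x = y %[mod q] -> psi x = psi y) -> periodic e (fun x => psi (kap x)).
Proof.
move=> hpsi; exists (autG e col); split; first exact: autG_group.
  by move=> g x [_ hg]; apply: hpsi; apply: hg.
have col_Ri x y : col x = col y -> Ri col eR x y.
  by move=> h; apply/asboolP => n; rewrite kap_R h.
pose h i := vertex_orbit (autG e col) (xget o [set x | col x = i]).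
apply: (sub_finite_set (B := h @` `I_q)); last exact/finite_image/finite_II.
move=> _ [x _ <-]; exists (col x); first by rewrite /= ltn_mod.
have hr : col (xget o [set y | col y = col x]) = col x.
  exact: (@xgetI _ o [set y | col y = col x] x).
rewrite /h; set r := xget _ _ in hr *; apply/seteqP; split=> z /= [g [ga gc] <-].
  have [g' hg' <-] := Ri_autG k2 eT (col_Ri x (g r) (esym (etrans (gc r) hr))).
  by exists g'.
have [g' hg' <-] := Ri_autG k2 eT (col_Ri r (g x) (etrans hr (esym (gc x)))).
by exists g'.
Qed.

End Periodic.

(** * A Busemann function modulo q *)

Section Horo.
Variables (o a : V) (q : nat).
Hypotheses (ea : e o a) (q0 : 0 < q).
Local Notation dep := (dist o).

Lemma horo_next y : exists w, [/\ e y w, w <> par o y & w <> a].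
Proof.
case: (pselect (y = o)) => [->|yo].
  have [u1 [u2 [e1 e2 n12]]] := two_nb k2 eR o; rewrite par_root.
  have ne u : e o u -> u <> o by move=> h h2; rewrite h2 tree_irr in h.
  case: (pselect (u1 = a)) => h; last by exists u1; split=> //; apply: ne.
  by exists u2; split=> //; [apply: ne|move=> h2; apply: n12; rewrite h h2].
have [w ew hw] := child_ex k2 eT eR o y; exists w; split=> // wa.
have [_ hd _] := child_dep ew hw; apply: yo; rewrite -hd wa.
by case: (nb_cases eT o ea) => [[]|[_ <-]] //; rewrite eqxx.
Qed.

(* horo is, modulo q, the Busemann function of the ray horo_ray, which starts at
   o and avoids the neighbour a; the step -1 along the ray is taken as q.-1. *)
Definition horo_ray n := iter n (fun y => projT1 (cid (horo_next y))) o.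
Definition on_ray z := z == horo_ray (dep z).
Fixpoint horo_rec n z := if n is n'.+1 then
  horo_rec n' (par o z) + (if on_ray z then q.-1 else 1) else 0.
Definition horo z := horo_rec (dep z) z.
Definition horo_down z := if on_ray z then horo_ray (dep z).+1 else par o z.

Lemma horo_rayS n : [/\ e (horo_ray n) (horo_ray n.+1), horo_ray n.+1 <> par o (horo_ray n) & horo_ray n.+1 <> a].
Proof. by rewrite /=; case: cid. Qed.

Lemma horo_ray_dep n : dep (horo_ray n) = n.
Proof.
elim: n => [|n IH]; first by rewrite dist_xx.
by have [h1 h2 _] := horo_rayS n; have [_ _ ->] := child_dep h1 h2; rewrite IH.
Qed.

Lemma horo_ray_par n : par o (horo_ray n.+1) = horo_ray n.
Proof. by have [h1 h2 _] := horo_rayS n; have [] := child_dep h1 h2. Qed.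

Lemma horo_par z : z != o -> horo z = horo (par o z) + (if on_ray z then q.-1 else 1).
Proof. by move=> /(dep_par eT) h; rewrite /horo h. Qed.

Lemma on_rayP n : on_ray (horo_ray n).
Proof. by rewrite /on_ray horo_ray_dep. Qed.

Lemma horo_e_down z : e z (horo_down z).
Proof.
rewrite /horo_down; case: ifP => [/eqP h|h]; first by rewrite {1}h; case: (horo_rayS (dep z)).
have zo : z != o by apply: contraFneq h => ->; rewrite /on_ray dist_xx.
by have [] := parP zo (eT := eT).
Qed.

Lemma horo_kap_down z : (horo (horo_down z)).+1 = horo z %[mod q].
Proof.
rewrite /horo_down; case: ifP => [/eqP h|h].
  have ne : horo_ray (dep z).+1 != o by apply: (dep_pos (eT := eT)); rewrite horo_ray_dep.
  rewrite (horo_par ne) horo_ray_par on_rayP -h -addnS prednK // -[in RHS](addn0 (horo z)).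
  by rewrite -modnDmr modnn.
have zo : z != o by apply: contraFneq h => ->; rewrite /on_ray dist_xx.
by rewrite [in RHS](horo_par zo) h addn1.
Qed.

(** Every edge joins one of its ends to the [horo_down] of that end, so here [z] is
    [horo_down w]. *)
Lemma horo_kap_up z w : e z w -> w <> horo_down z -> horo w = (horo z).+1 %[mod q].
Proof.
move=> ezw hw; suff -> : z = horo_down w by rewrite horo_kap_down.
have edge x y : e x y -> y <> par o x -> y = horo_down x \/ x = horo_down y.
  move=> exy hy; have [_ hp hd] := child_dep exy hy; rewrite /horo_down.
  case: ifP => hx; last by right; case: ifP => [/eqP h|_ //]; move: hx; rewrite -hp h hd horo_ray_par on_rayP.
  case: (boolP (on_ray y)) => [/eqP h|_]; last by right.
  by left; rewrite {1}h hd.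
case: (pselect (w = par o z)) => h; last by case: (edge _ _ ezw h).
have zo : z <> par o w.
  move=> h2; case: (eqVneq z o) => [zo|/(dep_par eT) hd].
    by move: ezw; rewrite h zo par_root tree_irr.
  case: (eqVneq w o) => [wo|/(dep_par eT) hd2].
    by move: ezw; rewrite h2 wo par_root tree_irr.
  by move: hd hd2; rewrite -h -h2; lia.
by rewrite (tree_sym eT) in ezw; case: (edge _ _ ezw zo).
Qed.

(** The ray avoids [a], hence the cone below it, so every step from [o] adds 1. *)
Lemma horo_cone z : cone eT o a z -> horo z = dep z.
Proof.
have na n : horo_ray n <> a.
  case: n => [|n]; last by case: (horo_rayS n).
  by move=> h; move: ea; rewrite -h /= tree_irr.
have ao : a != o by apply/eqP => h; move: ea; rewrite h tree_irr.
have pa : par o a = o by case: (nb_cases eT o ea) => [[]|[]] //; rewrite eqxx.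
have nray n : ~ cone eT o a (horo_ray n).
  elim: n => [|n IH] h.
    by have := cone_dep h; rewrite dist_xx (dep_par eT ao).
  by apply: IH; rewrite -horo_ray_par; apply: (cone_par k2 h (na _)).
have non x : cone eT o a x -> on_ray x = false.
  by move=> hx; apply/eqP => h; apply: (nray (dep x)); rewrite -h.
move En : (dep z) => n; elim: n z En => [|n IH] z En hz.
  by have := cone_dep hz; rewrite En (dep_par eT ao).
have zo : z != o by apply: (dep_pos (eT := eT)); rewrite En.
rewrite horo_par // non // addn1; congr _.+1.
case: (pselect (z = a)) => [za|nz].
  by move: En; rewrite za (dep_par eT ao) pa /horo dist_xx => [[<-]].
by apply: IH; [move: En; rewrite (dep_par eT zo) => [[]]|apply: (cone_par k2 hz nz)].
Qed.

End Horo.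

Lemma subtree_down (o r : V) (S : set V) : S r -> (forall y, S y -> y <> r -> y != o /\ S (par o y)) -> subtree e S.
Proof.
move=> Sr Sp; split; first by exists r.
have H y : S y -> (exists p, [/\ path e r p, last r p = y & forall z, z \in p -> S z]) /\
    (exists p, [/\ path e y p, last y p = r & forall z, z \in p -> S z]).
  move En : (dist o y) => n; elim: n y En => [|n IH] y En Sy.
    case: (pselect (y = r)) => [->|/(Sp _ Sy) [yo _]]; first by split; exists [::].
    by move/eqP: yo; rewrite (dist_eq0 En).
  case: (pselect (y = r)) => [->|/(Sp _ Sy) [yo Spy]]; first by split; exists [::].
  have [ey hd] := parP yo (eT := eT).
  have [|[p [h1 h2 h3]] [p' [h4 h5 h6]]] := IH (par o y) _ Spy; first by rewrite hd in En; case: En.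
  split.
    exists (rcons p y); rewrite rcons_path h1 h2 last_rcons (tree_sym eT); split=> // z.
    by rewrite mem_rcons inE => /orP[/eqP ->|/h3].
  exists (par o y :: p'); rewrite /= ey h4; split=> // z.
  by rewrite inE => /orP[/eqP ->|/h6].
move=> x y /H [_ [p [h1 h2 h3]]] /H [[p' [h4 h5 h6]] _].
exists (p ++ p'); rewrite cat_path h1 last_cat h2 h4; split=> // z.
by rewrite mem_cat => /orP[/h3|/h6].
Qed.

Lemma ball_seq o n : exists s : seq V, forall z, dist o z <= n -> z \in s.
Proof.
elim: n => [|n [s hs]].
  by exists [:: o] => z; rewrite leqn0 => /eqP /dist_eq0 ->; apply: mem_head.
exists (s ++ flatten (map nb s)) => z; rewrite mem_cat leq_eqVlt => /orP[/eqP hz|/hs -> //].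
have [w ew hw] := dist_pred hz; apply/orP; right; apply/flattenP; exists (nb w).
  by apply: map_f; apply: hs; rewrite hw.
by rewrite mem_nb (tree_sym eT).
Qed.

Section EvPer.
Variables (A : countType) (phi : V -> A) (d : V -> nat) (U : nat -> A) (o : V) (I q : nat).
Hypotheses (dnb : forall x y, e x y -> d y <= (d x).+1) (hc : cusp_lev eR d) (d_o : d o = 0)
  (phiU : forall z, phi z = U (d z)) (q0 : 0 < q) (Uq : forall i, I <= i -> U (i + q) = U i).
Local Notation dep := (dist o).
Local Notation cone := (cone eT o).

(** Inductively the parent is the lower neighbour of [y], or both lie on level 0 along the loop next
    to [o]. In either case it uses up the only neighbour that does not go up. *)
Lemma cusp_child y w : y != o -> e y w -> w <> par o y -> d w = (d y).+1.
Proof.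
have two (P : pred V) (x u u' : V) : count P (nb x) <= 1 -> e x u -> e x u' -> u <> u' -> P u -> ~~ P u'.
  move=> hP eu eu' nu Pu; apply/negP => Pu'; move: hP; rewrite -size_filter leqNgt => /negP; apply.
  apply: (@uniq_leq_size _ [:: u; u']) => [|v]; first by rewrite /= inE andbT; apply/eqP.
  by rewrite !inE mem_filter mem_nb => /orP[] /eqP ->; rewrite ?Pu ?Pu'.
move En : (dep y) => n; elim: n y w En => [|n IH] y w En yo eyw nw.
  by move: yo; rewrite (dist_eq0 En) eqxx.
have [ep hd] := parP yo (eT := eT).
have hcase : (d y = 0 /\ d (par o y) = 0) \/ d y = (d (par o y)).+1.
  case: (eqVneq (par o y) o) => po.
    have := dnb (_ : e o y); rewrite po d_o -{1}po (tree_sym eT) => /(_ ep).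
    by case: (d y) => [|[|]] //; [left|right].
  right; apply: IH => //; first by rewrite hd in En; case: En.
    by rewrite (tree_sym eT).
  by move=> h; move: (dep_par eT po); rewrite -h; lia.
have h1 := dnb eyw; have h2 := dnb (_ : e w y); rewrite (tree_sym eT) in h2; have {}h2 := h2 eyw.
case: hcase => [[hy hp]|hy].
  have := two _ _ _ _ (hc.2 y hy) ep eyw (nesym nw); rewrite hp eqxx => /(_ isT).
  by lia.
have hpos : 0 < d y by rewrite hy.
have [c1 c2] := hc.1 y hpos.
have := two _ _ _ _ (eq_leq c1) ep eyw (nesym nw); rewrite [in X in X -> _]hy eqxx => /(_ isT) h3.
have := count_pos k2 eT eR dnb hpos; rewrite c1 c2 => h4.
have h5 : count (fun v => d v == d y) (nb y) = 0 by lia.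
have : d w != d y.
  apply/eqP => h; move/eqP: h5; rewrite -leqn0 leqNgt -has_count => /negP; apply.
  by apply/hasP; exists w; rewrite ?mem_nb // h.
by lia.
Qed.

Lemma cusp_cone y z : y != o -> cone y z -> d z + dep y = d y + dep z.
Proof.
move=> yo; move En : (dep z) => n; elim: n z En => [|n IH] z En hz.
  by have := cone_dep hz; rewrite En (dep_par eT yo).
case: (pselect (z = y)) => [zy|nz]; first by rewrite -En zy addnC.
have hp := cone_par k2 hz nz.
have zo : z != o by apply: (dep_pos (eT := eT)); rewrite En.
have [ez hd] := parP zo (eT := eT).
have hn : dep (par o z) = n by rewrite hd in En; case: En.
have po : par o z != o.
  by apply: (dep_pos (eT := eT)); have := cone_dep hp; rewrite (dep_par eT yo); lia.
have := IH _ hn hp; rewrite (@cusp_child (par o z) z) //; first by lia.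
  by rewrite (tree_sym eT).
by move=> h; move: (dep_par eT po); rewrite -h; lia.
Qed.

Lemma cusp_evper : eventually_periodic e phi.
Proof.
(* The level lags behind the depth by at most one, so vertices at depth [I.+2] or more have levels
   where [U] is periodic. *)
pose N := I.+2; have [s hs] := ball_seq o N.
pose t := filter (fun z => dep z == N) s.
have tP (i : 'I_(size t)) : dep (nth o t i) = N.
  by have := mem_nth o (ltn_ord i); rewrite mem_filter => /andP[/eqP].
exists (gball e I.+1 o), (size t), (fun i : 'I_(size t) => cone (nth o t i)).
have Uqn j i : I <= i -> U (i + j * q) = U i.
  by elim: j => [|j IH] hi; rewrite ?mul0n ?addn0 // mulSn addnCA addnC Uq ?IH //; lia.
have big z : ~ gball e I.+1 o z <-> N <= dep z.
  split=> [h|h /(gballP (eT := eT))]; last by lia.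
  by rewrite ltnNge; apply/negP => h2; apply: h; apply/(gballP (eT := eT)).
have inT z : N <= dep z -> exists i : 'I_(size t), cone (nth o t i) z.
  move=> hz; have [|h1 h2] := @cone_iter V e k k2 eT o (dep z - N) z; first by lia.
  set r := iter _ _ _ in h1 h2; have rt : r \in t.
    by rewrite mem_filter h2 hs; [apply/andP; split=> //; lia|lia].
  by have rt' := rt; rewrite -index_mem in rt'; exists (Ordinal rt'); rewrite /= nth_index.
split.
- split; last first.
    apply: (sub_finite_set _ (finite_seq (filter (fun z => dep z <= I.+1) s))) => z /(gballP (eT := eT)) hz /=.
    by rewrite mem_filter hz hs // /N; lia.
  apply: (@subtree_down o o) => [|y]; first by apply/(gballP (eT := eT)); rewrite dist_xx.
  move=> /(gballP (eT := eT)) hy yo; have {}yo : y != o by apply/eqP.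
  by split=> //; apply/(gballP (eT := eT)); have := dep_par eT yo; lia.
- move=> i; apply: (@subtree_down o (nth o t i)); first exact: cone_refl.
  move=> y hy ny; split; last exact: cone_par hy ny.
  by apply: (dep_pos (eT := eT)); have := cone_dep hy; rewrite tP; lia.
- apply/seteqP; split=> z; first by move=> /big /inT [i hi]; exists i.
  by move=> [i _ /cone_dep]; rewrite tP => /big.
- move=> x y /big hx /big hy exy.
  have H u w : N <= dep u -> e u w -> w <> par o u -> exists i : 'I_(size t), cone (nth o t i) u /\ cone (nth o t i) w.
    by move=> /inT [i hi] euw nw; exists i; split=> //; apply: (cone_child k2 hi euw nw).
  case: (pselect (y = par o x)) => hyx; last exact: H.
  have eyx : e y x by rewrite (tree_sym eT).
  have [i [h1 h2]] : exists i : 'I_(size t), cone (nth o t i) y /\ cone (nth o t i) x.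
    apply: H => // h; have xo : x != o by apply: (dep_pos (eT := eT)); lia.
    have yo : y != o by apply: (dep_pos (eT := eT)); lia.
    by have := dep_par eT xo; have := dep_par eT yo; rewrite -h -hyx; lia.
  by exists i.
move=> i; set r := nth o t i.
have [h1 h2] := @cone_iter V e k k2 eT o N.-1 r ltac:(rewrite tP; lia).
set a := iter _ _ _ in h1 h2; rewrite tP in h2.
have {}h2 : dep a = 1 by rewrite h2 /N; lia.
have ao : a != o by apply: (dep_pos (eT := eT)); rewrite h2.
have oa : e o a.
  by have [w ew hw] := dist_pred h2; rewrite -(dist_eq0 hw) (tree_sym eT) in ew.
(* The multiple of q lifts every argument of [U] into its periodic range. If [d a = 0], the depth
   exceeds the level by one on the cone of [a], and [q.-1] makes up for it modulo q. *)
pose C := q * I + (if d a == 0 then q.-1 else 0).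
exists (fun x => U (horo q oa x + C)); split.
  have H u : U (u + C) = U (u %% q + C).
    rewrite {1}(divn_eq u q) -[in RHS](Uqn (u %/ q)); first by congr U; lia.
    by rewrite /C; nia.
  have Hp x y : x = y %[mod q] -> U (x + C) = U (y + C) by move=> h; rewrite H h -H.
  exact: (@kap_periodic q (horo q oa) _ q0 (horo_e_down oa) (horo_kap_down oa q0) (horo_kap_up q0) o
    A (fun i => U (i + C)) Hp).
move=> z hz; have haz := cone_trans k2 h1 hz.
rewrite phiU (horo_cone q oa haz).
have := cusp_cone ao haz; rewrite h2 => hdz.
have hdep := cone_dep hz; rewrite tP in hdep.
have := dnb oa; rewrite d_o /C => hda.
case: eqP => ha; last first.
  have -> : dep z = d z by lia.
  by rewrite addn0 mulnC Uqn //; lia.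
have -> : dep z + (q * I + q.-1) = d z + I.+1 * q by lia.
by rewrite Uqn //; lia.
Qed.

End EvPer.

End Bwd.

(** * Periodicity along the levels of a cusp *)

Section Tail.
Variables (V : choiceType) (e : rel V) (k : nat) (A : countType) (phi : V -> A).
Hypotheses (k2 : 2 <= k) (eT : is_tree e) (eR : regular e k) (St : sturmian e phi).
Local Notation nb := (nb eR).
Local Notation R := (R phi eR).
Local Notation Ri := (Ri phi eR).
Variables (d : V -> nat) (v : nat -> V).
Hypotheses (dRi : forall x y, d x = d y -> Ri x y) (vP : forall i, d (v i) = i)
  (dnb : forall x y, e x y -> d y <= (d x).+1) (hc : cusp_lev eR d).

Lemma cusp_count n w i : 0 < i ->
  count (R n w) (nb (v i)) = R n w (v i.-1) + R n w (v i.+1) * k.-1.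
Proof.
move=> hi; have hz : 0 < d (v i) by rewrite vP.
have -> : count (R n w) (nb (v i)) = count (fun u => R n w (v (d u))) (nb (v i)).
  apply: eq_count => u; have h : R n u (v (d u)) by apply/Ri_R/dRi; rewrite vP.
  by apply/idP/idP => hw; apply: (R_trans hw) => //; rewrite R_sym.
rewrite (count_levels k2 eT eR dnb (fun j => R n w (v j)) hz).
have [c1 c2] := hc.1 _ hz; have := count_pos k2 eT eR dnb hz.
by rewrite c1 c2 vP => h; have -> : count (fun u => d u == i) (nb (v i)) = 0; lia.
Qed.

(** Pairs of consecutive classes take finitely many values, so some pair recurs, and from there on
    the determinism repeats the whole sequence. *)
Lemma level_pigeon n I0 :
  (forall i j, I0 <= i -> I0 <= j -> R n (v i) (v j) -> R n (v i.+1) (v j.+1) -> R n (v i.+2) (v j.+2)) ->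
  exists I q, 0 < q /\ forall i, I <= i -> R n (v (i + q)) (v i).
Proof.
move=> hdet; have [s [_ _ hs]] := reps k2 eT eR St n.
pose f i := find (R n (v i)) s.
have fP i : f i < size s /\ R n (v i) (nth (v 0) s (f i)).
  have hh : has (R n (v i)) s by apply/hasP; have [y yt hy] := hs (v i); exists y.
  by split; [rewrite -has_find|apply: nth_find].
have fE i j : f i = f j -> R n (v i) (v j).
  move=> h; have [_ h1] := fP i; have [_ h2] := fP j; apply: R_trans h1 _.
  by rewrite R_sym h.
pose g i := (f i, f i.+1); pose L := iota I0 (size s * size s).+1.
have : ~~ uniq (map g L).
  apply/negP => hu; suff : (size s * size s).+1 <= size s * size s by rewrite ltnn.
  have := @uniq_leq_size _ _ (allpairs pair (iota 0 (size s)) (iota 0 (size s))) hu.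
  rewrite size_map size_allpairs !size_iota; apply=> _ /mapP [i _ ->].
  by apply: allpairs_f; rewrite mem_iota; have [] := fP i; have [] := fP i.+1.
move=> /(uniqPn (g 0)) [i [j [hij]]]; rewrite size_map size_iota => hj.
have hi := ltn_trans hij hj.
rewrite !(nth_map 0) ?size_iota // ?nth_iota //.
move=> [h1 h2]; exists (I0 + i), (j - i); split; first by lia.
have hq : I0 + i + (j - i) = I0 + j by lia.
suff H l : R n (v (l + (I0 + i) + (j - i))) (v (l + (I0 + i))) /\
    R n (v (l + (I0 + i) + (j - i)).+1) (v (l + (I0 + i)).+1).
  by move=> l hl; have [] := H (l - (I0 + i)); rewrite subnK.
elim: l => [|l [IH1 IH2]]; first by rewrite !add0n hq; split; rewrite R_sym; apply: fE.
rewrite !addSn; split=> //; apply: hdet => //; lia.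
Qed.

(** The single lower neighbour cannot be replaced by a multiple of k - 1 > 1 upper ones in the
    counts. *)
Lemma prev_match i j : 2 < k -> 0 < i -> 0 < j -> R 1 (v i) (v j) -> R 0 (v i.-1) (v j.-1).
Proof.
move=> k3 hi hj /R_cnt => /(_ (v i.-1)); rewrite !cusp_count // R_refl.
by case: (R 0 _ (v j.-1)) => //; case: (R 0 _ (v i.+1)); case: (R 0 _ (v j.+1)) => /=; lia.
Qed.

Lemma next_match n i j : 0 < i -> 0 < j -> R n (v i.-1) (v j.-1) -> R n.+1 (v i) (v j) -> R n (v i.+1) (v j.+1).
Proof.
move=> hi hj h /R_cnt => /(_ (v i.+1)); rewrite !cusp_count // R_refl.
have -> : R n (v i.+1) (v j.-1) = R n (v i.+1) (v i.-1).
  by apply/idP/idP => h1; apply: (R_trans h1) => //; rewrite R_sym.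
by case: (R n _ (v j.+1)) => //; lia.
Qed.

(* Otherwise two of the three 1-balls would have the same colour at the centre and
   the same colour one level below, leaving a single 1-ball for the other colour;
   this forces the same colour on all levels. *)
Lemma three_det : 2 < k -> forall i j, R 0 (v i) (v j) -> R 0 (v i.+1) (v j.+1) -> R 0 (v i.+2) (v j.+2).
Proof.
move=> k3.
have two x y z : ~~ R 0 x y -> ~~ R 0 x z -> R 0 y z.
  move=> h1 h2; apply: contrapT => /negP h3.
  by have := @pw_size V e k A phi k2 eT eR St 0 [:: x; y; z]; rewrite /= h1 h2 h3 => /(_ isT).
have main i j : R 0 (v i) (v j) -> R 0 (v i.+1) (v j.+1) -> R 0 (v i.+2) (v i.+1) -> ~~ R 0 (v j.+2) (v i.+1) -> False.
  move=> h0 h1 h2 h3.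
  have n1 : ~~ R 1 (v i.+1) (v j.+1).
    apply/negP => h; have := @next_match 0 i.+1 j.+1 isT isT h0 h => h4.
    by move/negP: h3; apply; apply: R_trans h2; rewrite R_sym.
  have n2 : ~~ R 1 (v i.+1) (v j.+2).
    by apply: contraNN h3 => /R_S; rewrite R_sym.
  have n3 : ~~ R 1 (v j.+1) (v j.+2).
    by apply: contraNN h3 => /R_S h; rewrite R_sym; apply: R_trans h1 h.
  have cover x : [\/ R 1 x (v i.+1), R 1 x (v j.+1) | R 1 x (v j.+2)].
    apply: contrapT => hn.
    have m1 : ~~ R 1 x (v i.+1) by apply/negP => h; apply: hn; constructor.
    have m2 : ~~ R 1 x (v j.+1) by apply/negP => h; apply: hn; constructor 2.
    have m3 : ~~ R 1 x (v j.+2) by apply/negP => h; apply: hn; constructor 3.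
    have := @pw_size V e k A phi k2 eT eR St 1 [:: x; v i.+1; v j.+1; v j.+2].
    by rewrite !pairwise_cons /all m1 m2 m3 n1 n2 n3 => /(_ isT).
  (* Only the classes of [v i.+1] and [v j.+1] have this colour at the centre, and both have the
     colour of [v i] one level below. *)
  have fA l : 0 < l -> R 0 (v l) (v i.+1) -> R 0 (v l.-1) (v i).
    move=> hl hR; case: (cover (v l)) => h.
    - exact: (@prev_match l i.+1 k3 hl isT h).
    - by apply: (R_trans (@prev_match l j.+1 k3 hl isT h)); rewrite R_sym.
    - move/negP: h3; case; apply: R_trans hR; rewrite R_sym; exact: R_S h.
  have h4 : R 0 (v i.+1) (v i) := fA i.+2 isT h2.
  (* Whichever colour level [l.+1] has, the level below it has the colour of [v i.+1]. *)
  have all l : R 0 (v l) (v i.+1).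
    case: (boolP (R 0 (v l.+1) (v i.+1))) => hl.
      by apply: R_trans (fA l.+1 isT hl) _; rewrite R_sym.
    have hl3 : R 1 (v l.+1) (v j.+2).
      case: (cover (v l.+1)) => // h; exfalso; move/negP: hl; apply; first exact: R_S h.
      by apply: R_trans (R_S h) _; rewrite R_sym.
    by apply: (R_trans (@prev_match l.+1 j.+2 k3 isT isT hl3)); rewrite R_sym.
  by rewrite all in h3.
move=> i j h0 h1; apply: contrapT => /negP hn.
case: (boolP (R 0 (v i.+2) (v i.+1))) => hi.
  apply: (main i j) => //; apply: contraNN hn => h; apply: (R_trans hi); by rewrite R_sym.
have hj : R 0 (v j.+2) (v j.+1).
  by apply: R_trans h1; rewrite R_sym; apply: two hi hn.
apply: (main j i) => //; [by rewrite R_sym|by rewrite R_sym|].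
apply: contraNN hi => h; apply: (R_trans h); by rewrite R_sym.
Qed.

Lemma evper_of_tail n : (exists I q, 0 < q /\ forall i, I <= i -> R n (v (i + q)) (v i)) ->
  eventually_periodic e phi.
Proof.
move=> [I [q [q0 hq]]].
apply: (@cusp_evper V e k k2 eT eR A phi d (fun i => phi (v i)) (v 0) I q) => //.
  by move=> z; have /(Ri_R 0) /eqP := dRi (esym (vP (d z))).
  by move=> i hi; apply/eqP; exact: (R_le (leq0n n) (hq i hi)).
Qed.

Lemma cusp_evper3 : 2 < k -> eventually_periodic e phi.
Proof.
move=> k3; apply: (evper_of_tail (n := 0)); apply: (level_pigeon (I0 := 0)) => i j _ _.
exact: three_det.
Qed.

End Tail.

(** The classes of step m replace the colours: levels above 1 that agree at step m agree at step
    [m.+1], and then agreement one level below forces agreement one level above. *)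
Lemma core_evper2 (V : choiceType) (e : rel V) (k : nat) (A : countType) (phi : V -> A)
  (k2 : 2 <= k) (eT : is_tree e) (eR : regular e k) (St : sturmian e phi) m c :
  core phi eR m c -> k = 2 -> eventually_periodic e phi.
Proof.
move=> Hc kE; have dRi x y : dcl phi eT eR m c x = dcl phi eT eR m c y -> Ri phi eR x y.
  by move/(core_Ri k2 eT St Hc).
have [v vP] := choice (core_surj k2 eT St Hc).
have dnb := @dcl_nb V e k A phi eT eR m c.
have hc := cusp_two k2 eT St Hc kE.
apply: (evper_of_tail k2 eT dRi vP dnb hc (n := m)).
apply: (level_pigeon k2 eT St (I0 := 1)) => i j hi hj h0 h1.
apply: (next_match k2 eT dRi vP dnb hc (i := i.+1) (j := j.+1)) => //.
by rewrite -addn1; apply: (core_tail k2 St Hc); rewrite // vP.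
Qed.

Lemma evper_core (V : choiceType) (e : rel V) (k : nat) (A : countType) (phi : V -> A)
  (k2 : 2 <= k) (eT : is_tree e) (eR : regular e k) (St : sturmian e phi) (o : V) :
  eventually_periodic e phi -> bounded_type e phi /\ forall m c, core phi eR m c -> cusp_lev eR (dcl phi eT eR m c).
Proof.
move=> [K [mm [T_ [[_ Kf] Ts Tc _ hpsi]]]].
pose psi i := projT1 (cid (hpsi i)).
have psiP i : periodic e (psi i) /\ forall x, T_ i x -> psi i x = phi x by rewrite /psi; case: cid.
have per i := (psiP i).1; have agr i := (psiP i).2.
split; first exact: (evper_bounded k2 eT eR St Kf Ts Tc per agr o).
move=> m c Hc; case: (ltngtP k 2) => hk; first by lia.
  exact: (evper_cusp_core k2 eT St Kf Ts Tc per agr Hc hk).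
exact: cusp_two.
Qed.

(** * The quotient graph of a Sturmian coloring *)

Lemma invariant_factor (V : choiceType) (e : rel V) (A : countType) (phi : V -> A) (o : V)
  (G : set (V -> V)) : automorphism_group e G -> invariant_under phi G ->
  exists phiX : set V -> A, forall x, phi x = phiX (vertex_orbit G x).
Proof.
move=> [_ Gid _ _] Gi; exists (fun P => phi (xget o P)) => x.
have [g gG <-] : vertex_orbit G x (xget o (vertex_orbit G x)).
  by apply: (@xgetI _ o (vertex_orbit G x) x); exists id.
by rewrite Gi.
Qed.

Section Main.
Variables (k : nat) (V : choiceType) (e : rel V) (A : countType) (phi : V -> A).
Hypotheses (k2 : 2 <= k) (eT : is_tree e) (eR : regular e k) (St : sturmian e phi).
Local Notation R := (R phi eR).
Local Notation Ri := (Ri phi eR).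
Local Notation G := (autG e phi).

Let GO x y : Ri x y <-> exists2 g, G g & g x = y.
Proof. by split=> [/(Ri_autG k2 eT) //|[g gG <-]]; apply: autG_Ri. Qed.

Let GE x y x1 y1 : Ri x y -> e x x1 -> e y y1 -> Ri x1 y1 -> exists g, [/\ G g, g x = y & g x1 = y1].
Proof. exact: Ri_autG_edge. Qed.

Let qeq := Ri_eqr phi eR.
Let Gg := autG_group e phi.

Lemma sturmian_not_covered (q : rel V) :
  (forall n x y, q x y -> R n y x) -> forall l : seq V, exists z, forall r, r \in l -> ~~ q r z.
Proof.
move=> hq l; apply: contrapT => /forallNP hn.
suff : size l + 2 <= size l by lia.
apply: (cover_size k2 eT St) => z.
by have /existsNP [r /not_implyP [rl /negP/negPn qr]] := hn z; exists r => //; apply: hq.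
Qed.

Lemma bounded_quotient m c : core phi eR m c ->
  is_ray e G /\ (eventually_periodic e phi <-> looped_cusp e k.-1 G \/ loopless_cusp e k.-1 G).
Proof.
move=> Hc; have dRi := core_Ri k2 eT St Hc; have dsurj := core_surj k2 eT St Hc.
have dnb := @dcl_nb V e k A phi eT eR m c; have dpred := @dcl_pred V e k A phi eT eR m c.
split.
  by exists (fun i => [set x | dcl phi eT eR m c x = i]); apply: (lev_ray k2 eT qeq Gg GO GE).
split=> [ev|hc].
  apply: (cusp_levP k2 eT qeq Gg GO GE dRi dsurj dnb dpred).
  by have [_ H] := evper_core k2 eT eR St c ev; apply: H.
case: (ltngtP k 2) => hk; [lia| |exact: core_evper2 Hc hk].
have [d [h1 h2 h3 h4]] := cusp_lev_ex k2 eT eR qeq Gg GO GE hc; have [v vP] := choice h2.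
by apply: (cusp_evper3 k2 eT St _ vP h3 h4 hk) => x y /h1.
Qed.

(* For k = 2 the trivial group is used: the quotient by Aut(phi) may be a cusp
   although phi is not eventually periodic. *)
Lemma unbounded_quotient : ~ bounded_type e phi -> exists G' : set (V -> V),
  [/\ automorphism_group e G', invariant_under phi G', is_ray e G' \/ is_line e G'
    & looped_cusp e k.-1 G' \/ loopless_cusp e k.-1 G' -> eventually_periodic e phi].
Proof.
move=> unb; case: (ltngtP k 2) => hk; [lia| |].
  exists G; split=> //.
  - by move=> g x [_ ->].
  - apply: (ray_or_line k2 eT qeq Gg GO GE) => [x y1 y2 y3|].
      exact: (degree_unbounded k2 eT St (unbounded_special k2 eT eR unb x)).
    by apply: sturmian_not_covered => n x y /Ri_R h; rewrite R_sym.
  move=> hc; have [d [h1 h2 h3 h4]] := cusp_lev_ex k2 eT eR qeq Gg GO GE hc; have [v vP] := choice h2.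
  by apply: (cusp_evper3 k2 eT St _ vP h3 h4 hk) => x y /h1.
pose q : rel V := fun x y => x == y; pose G' : set (V -> V) := [set id].
have q_eq : equivalence_rel q.
  by apply/equivalence_relP; split=> [x|x y /eqP ->] //; apply: eqxx.
have Gg' : automorphism_group e G'.
  split=> [g ->|//|g h -> ->|g ->] //; first by split=> //; exists id.
  by exists id.
have GO' x y : q x y <-> exists2 g, G' g & g x = y.
  by split=> [/eqP ->|[g -> ->]]; [exists id|apply: eqxx].
have GE' x y x1 y1 : q x y -> e x x1 -> e y y1 -> q x1 y1 -> exists g, [/\ G' g, g x = y & g x1 = y1].
  by move=> /eqP -> _ _ /eqP ->; exists id.
exists G'; split=> //; first by move=> g x ->.
  apply: (ray_or_line k2 eT q_eq Gg' GO' GE') => [x y1 y2 y3 e1 e2 e3 _ _ _ n1 n2 n3|].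
    have := @uniq_leq_size _ [:: y1; y2; y3] (nb eR x).
    rewrite size_nb /= !inE negb_or n1 n2 n3 => /(_ isT) H; move/negP: (isT : ~~ (2 < 2)); rewrite -{2}hk.
    apply; apply: H.
    by move=> u; rewrite !inE mem_nb => /or3P[] /eqP ->.
  by apply: sturmian_not_covered => n x y /eqP ->; apply: R_refl.
(* Neither graph occurs: for the trivial group a level is a single vertex, but the two neighbours of
   the vertex of level 0 would both be on level 1. *)
move=> hc; have [d [h1 h2 h3 _]] := cusp_lev_ex k2 eT eR q_eq Gg' GO' GE' hc.
exfalso; have [z hz] := h2 0; have [u1 [u2 [e1 e2 n12]]] := two_nb k2 eR z.
have H u : e z u -> d u = 1.
  move=> eu; have := h3 _ _ eu; rewrite hz; case Eu : (d u) => [|[|]] // _.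
  have /h1 /eqP zu : d z = d u by rewrite hz Eu.
  by move: eu; rewrite -zu tree_irr.
by apply: n12; apply/eqP/h1; rewrite !H.
Qed.

End Main.

Theorem mainTheorem1 (k : nat) (V : choiceType) (e : rel V)
    (A : countType) (phi : V -> A) :
  2 <= k -> is_tree e -> regular e k -> sturmian e phi ->
  exists G : set (V -> V),
    [/\ automorphism_group e G,
        invariant_under phi G
          /\ (exists phiX : set V -> A, forall x, phi x = phiX (vertex_orbit G x)),
        is_ray e G \/ is_line e G,
        bounded_type e phi -> is_ray e G
      & eventually_periodic e phi <->
          looped_cusp e k.-1 G \/ loopless_cusp e k.-1 G].
Proof.
move=> k2 eT eR St; have [_ _ [[o _] _] _] := eT.
case: (pselect (bounded_type e phi)) => [hb|unb].
  have [m [c Hc]] := core_ex k2 eT eR hb; have [hr he] := bounded_quotient k2 eT St Hc.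
  have gi : invariant_under phi (autG e phi) by move=> g x [_ ->].
  have gg := autG_group e phi.
  exists (autG e phi); split=> //; last by left.
  by split=> //; exact: (invariant_factor o gg gi).
have [G [gg gi hrl hc]] := unbounded_quotient k2 eT eR St unb.
exists G; split=> //; first by split=> //; exact: (invariant_factor o gg gi).
(* An eventually periodic coloring is of bounded type, which is excluded here. *)
by split=> // /(evper_core k2 eT eR St o) [].
Qed.
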